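(* Let $\Omega_1,\Omega_2\subset\mathbb{R}^2$ be two open disks with non-empty intersection, neither contained in the other, let $L\in\mathbb{N}$, and let $\mathcal{H}$, $B$, $\mathcal{H}_L$, $\mathbb{P}_L$, $\theta$, $f$ be as in the context. For $\mathbf{e}^{(0)}\in\mathcal{H}$ put $\mathbf{e}^{(n)}=(\mathbb{P}_LB\mathbb{P}_L)^n\mathbf{e}^{(0)}$. Then for every $\epsilon>0$ and all $n\in\mathbb{N}$ large enough, $$\|\mathbf{e}^{(n)}\|_{\mathcal{H}}\le(f(\theta)+\epsilon)^n\,\|\mathbf{e}^{(0)}\|_{\mathcal{H}} .$$ In particular, for every $\mathbf{g}\in\mathcal{H}$ and every initial $\mathbf{u}^{(0)}\in\mathcal{H}_L$, the sequence $\mathbf{u}^{(n)}=\mathbb{P}_L\mathbf{g}+\mathbb{P}_LB\mathbb{P}_L\mathbf{u}^{(n-1)}$ converges exponentially fast to the solution $\mathbf{u}\in\mathcal{H}_L$ of the discrete ddCOSMO equation $\mathbb{P}_L(I-B)\mathbb{P}_L\mathbf{u}=\mathbb{P}_L\mathbf{g}$.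
   Context: Geometry: $\Omega_i=B_{r_i}(\mathbf{x}_i)\subset\mathbb{R}^2$, $i=1,2$, are open disks with $\Omega_1\cap\Omega_2\ne\emptyset$ and neither contained in the other; $\Omega=\Omega_1\cup\Omega_2$; $\Gamma_i^{\rm ext}=\partial\Omega_i\cap\partial\Omega$, $\Gamma_i^{\rm int}=\partial\Omega_i\setminus\Gamma_i^{\rm ext}$. $\theta\in(0,\pi)$ is the angle, at one of the two points $p$ of $\partial\Omega_1\cap\partial\Omega_2$, between the segments from $p$ to $\mathbf{x}_1$ and from $p$ to $\mathbf{x}_2$. $L^2(\partial\Omega_i)$ is the complex $L^2$ space for the one-dimensional Hausdorff measure $\mathscr{H}^1$, and $\mathcal{H}=L^2(\partial\Omega_1)\times L^2(\partial\Omega_2)$ is the Hilbert direct sum. For $i\ne j$, $\gamma_j:L^2(\partial\Omega_i)\to L^2(\partial\Omega_j)$ sends $g$ to the function equal to $\mathrm{P}_i[g]|_{\Gamma_j^{\rm int}}$ on $\Gamma_j^{\rm int}$ and $0$ on $\Gamma_j^{\rm ext}$, where $\mathrm{P}_i[g](\mathbf{x})=\frac1{2\pi}\int_{\partial\Omega_i}\frac{r_i^2-|\mathbf{x}-\mathbf{x}_i|^2}{r_i|\mathbf{x}-\mathbf{y}|^2}g(\mathbf{y})\,d\mathscr{H}^1(\mathbf{y})$ for $\mathbf{x}\in\Omega_i$ is the Poisson integral. This is a bounded operator. Define $B:\mathcal{H}\to\mathcal{H}$, $B(u_1,u_2)=(\gamma_1u_2,\gamma_2u_1)$. For $L\in\mathbb{N}$,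 identifying $\mathbb{R}^2\simeq\mathbb{C}$, $\mathcal{H}_L(\partial\Omega_j)\subset L^2(\partial\Omega_j)$ is the span of the restrictions to $\partial\Omega_j$ of $(\mathbf{x}-\mathbf{x}_j)^\ell$ and $\overline{(\mathbf{x}-\mathbf{x}_j)}^{\,\ell}$, $0\le\ell\le L$; $\mathcal{H}_L=\mathcal{H}_L(\partial\Omega_1)\times\mathcal{H}_L(\partial\Omega_2)$, and $\mathbb{P}_L:\mathcal{H}\to\mathcal{H}_L$ is the orthogonal projection. The function $f$ (which satisfies $0<f<1$ on $(0,\pi)$): with $a_+=\max\{0,a\}$, $$f(\theta)=\tfrac12\Big(1+\sin(\theta/2)^2+g(\theta)+\sqrt{4\sin(\theta/2)^2+h(\theta)}\Big)^{1/2},$$ $$g(\theta)=\Big(\tfrac{\alpha(\theta)_+}{2}\tfrac{\theta}{\pi}+\tfrac{\cos(\theta)_+}{2}\tfrac{\pi-\theta}{\pi}\Big)\tfrac{\pi-\theta}{\pi}-\sin(\theta/2)^2\Big(1-\sqrt{1+\tfrac{\alpha(\theta)_+}{\sin(\theta/2)^2}\tfrac{\theta}{\pi}\tfrac{\pi-\theta}{\pi}}\Big),$$ $$\alpha(\theta)=\frac{\pi^2\sin(\theta/2)^2\cos\theta+\theta^2}{\pi^2\sin(\theta/2)^2+\theta^2\cos\theta},\qquad h(\theta)=g(\theta)^2+2g(\theta)\big(1+\sin(\theta/2)^2\big)-\cos(\theta/2)^2\cos(\theta)_+\tfrac{(\pi-\theta)^2}{\pi^2}.$$ *)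

(* Defs.v *)
From HB Require Import structures.
From mathcomp Require Import all_boot all_order all_algebra.
From mathcomp Require Import all_classical all_reals all_analysis.
From mathcomp Require Import complex.

Set Implicit Arguments.
Unset Strict Implicit.
Unset Printing Implicit Defensive.

Import Order.TTheory GRing.Theory Num.Theory.
Import numFieldNormedType.Exports.

Local Open Scope classical_set_scope.
Local Open Scope ring_scope.
Local Open Scope complex_scope.

Section hausdorff_measure.
Context {R : realType}.
Local Notation plane := (R * R)%type.
Implicit Types (x y : plane) (A B X U : set plane).

Definition enorm x : R := Num.sqrt (x.1 ^+ 2 + x.2 ^+ 2).

Local Open Scope ereal_scope.

(* 0 is added so that the empty set has diameter 0 rather than -oo. *)
Definition diam U : \bar R :=
  ereal_sup (0 |` [set (enorm (z.1 - z.2)%R)%:E | z in U `*` U]).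

Definition hausdorff1_cover (delta : R) A : set ((set plane)^nat) :=
  [set U | A `<=` \bigcup_k U k /\ forall k, diam (U k) <= delta%:E].

Definition hausdorff1_pre (delta : R) A : \bar R :=
  ereal_inf [set \sum_(0 <= k <oo) diam (U k) | U in hausdorff1_cover delta A].

(* No normalising constant: in dimension one this is arc length on curves. *)
Definition hausdorff1 A : \bar R :=
  ereal_sup [set hausdorff1_pre delta A | delta in [set d | (0 < d)%R]].

Lemma diam_ge0 U : 0 <= diam U.
Proof. by apply: ereal_sup_ubound; left. Qed.
Hint Resolve diam_ge0 : core.

Lemma diam0 : diam set0 = 0.
Proof.
apply/eqP; rewrite eq_le diam_ge0 andbT; apply: ge_ereal_sup => x [->//|].
by move=> [z [] []].
Qed.

Lemma diam_enorm U x y : U x -> U y -> (enorm (x - y)%R)%:E <= diam U.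
Proof. by move=> Ux Uy; apply: ereal_sup_ubound; right; exists (x, y). Qed.

Lemma hausdorff1_pre_ge0 d A : 0 <= hausdorff1_pre d A.
Proof. by apply: le_ereal_inf_tmp => _ [U _ <-]; exact: nneseries_ge0. Qed.

Lemma le_hausdorff1_pre d A B : A `<=` B -> hausdorff1_pre d A <= hausdorff1_pre d B.
Proof.
move=> AB; apply: ereal_inf_le_tmp => _ [U [BU dU] <-].
by exists U => //; split=> //; apply: subset_trans BU.
Qed.

Lemma hausdorff1_pre_le_delta d e A : (d <= e)%R -> hausdorff1_pre e A <= hausdorff1_pre d A.
Proof.
move=> de; apply: ereal_inf_le_tmp => _ [U [BU dU] <-].
by exists U => //; split=> // k; rewrite (le_trans (dU k))// lee_fin.
Qed.

Lemma hausdorff1_pre0 d : (0 < d)%R -> hausdorff1_pre d set0 = 0.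
Proof.
move=> d0; apply/eqP; rewrite eq_le hausdorff1_pre_ge0 andbT.
apply: ereal_inf_lbound; exists (fun=> set0).
  by split=> // k; rewrite diam0 lee_fin ltW.
by rewrite eseries0// => ? _ _; rewrite diam0.
Qed.

Lemma hausdorff1_pre_sigma_subadditive d : (0 < d)%R -> sigma_subadditive (hausdorff1_pre d).
Proof.
move=> d0 A; have [[i ioo]|] := pselect (exists i, hausdorff1_pre d (A i) = +oo).
  rewrite (eseries_pinfty _ _ ioo) ?leey// => n _.
  by rewrite -ltNye (lt_le_trans _ (hausdorff1_pre_ge0 _ _)).
rewrite -forallNE => Aoo.
suff add2e (e : {posnum R}) : hausdorff1_pre d (\bigcup_n A n) <=
    \sum_(0 <= i <oo) hausdorff1_pre d (A i) + e%:num%:E.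
  by apply/lee_addgt0Pr => _/posnumP[].
rewrite (le_trans _ (epsilon_trick _ _ _))//; last first.
  by move=> n; exact: hausdorff1_pre_ge0.
pose P n (B : (set plane)^nat) := hausdorff1_cover d (A n) B /\
  \sum_(0 <= k <oo) diam (B k) <=
    hausdorff1_pre d (A n) + (e%:num / (2 ^ n.+1)%:R)%:E.
have [G PG] : {G : ((set plane)^nat)^nat & forall n, P n (G n)}.
  apply: (@choice _ _ P) => n; rewrite /P.
  have fn : hausdorff1_pre d (A n) \is a fin_num.
    by rewrite ge0_fin_numE ?hausdorff1_pre_ge0// ltey; exact/eqP/Aoo.
  have en1 : (0 < e%:num / (2 ^ n.+1)%:R)%R by [].
  have [_ [B cB <-] h] := lb_ereal_inf_adherent en1 fn.
  by exists B; split => //; exact: ltW.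
have muG_ge0 (ij : nat * nat) : 0 <= (diam \o uncurry G) ij by exact: diam_ge0.
apply: (@le_trans _ _ (\esum_(i in setT) (diam \o uncurry G) i)).
  apply: ereal_inf_lbound => /=.
  have /card_esym/ppcard_eqP[f] := card_nat2.
  exists (uncurry G \o f).
    split => [|i]; last by rewrite /=; case: (f i) => a b; exact: (PG a).1.2.
    apply: (@subset_trans _  (\bigcup_n \bigcup_k G n k)) => [t [i _]|].
      by move=> /((PG i).1.1) -[j _ ?]; exists i => //; exists j.
    move=> t [i _ [j _ Bijt]]; exists (f^-1%FUN (i, j)) => //=.
    by rewrite invK ?inE.
  rewrite -(esum_pred_image (diam \o uncurry G) _ xpredT) ?[fun=> _]set_true//.
  by rewrite image_eq.
rewrite (_ : esum _ _ = \sum_(0 <= i <oo) \sum_(0 <= j <oo ) diam (G i j)); last first.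
  pose J : nat -> set (nat * nat) := fun i => [set (i, j) | j in setT].
  rewrite (_ : setT = \bigcup_k J k); last first.
    by rewrite predeqE => -[a b]; split => // _; exists a => //; exists b.
  rewrite esum_bigcupT /=; last 2 first.
    - apply/trivIsetP => i j _ _ ij.
      rewrite predeqE => -[n m] /=; split => //= -[] [_] _ [<-{n} _].
      by move=> [m' _] [] /esym/eqP; rewrite (negbTE ij).
    - by move=> /= [n m]; apply: diam_ge0.
  rewrite -(image_id [set: nat]) -fun_true esum_pred_image//; last first.
    by move=> n _; exact: esum_ge0.
  apply: eq_eseriesr => /= j _.
  rewrite -(esum_pred_image (diam \o uncurry G) (pair j) predT)//=; last first.
    by move=> ? ? _ _; exact: (@can_inj _ _ _ snd).
  by congr esum; rewrite predeqE => -[a b]; split; move=> [i _ <-]; exists i.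
apply: lee_lim.
- apply: is_cvg_nneseries => n *.
  by apply: nneseries_ge0 => m *; exact: (muG_ge0 (n, m)).
- by apply: is_cvg_nneseries => n *; apply: adde_ge0 => //; exact: hausdorff1_pre_ge0.
- by near=> n; apply: lee_sum => i _; exact: (PG i).2.
Unshelve. all: by end_near. Qed.

Lemma hausdorff1_pre_le d A : (0 < d)%R -> hausdorff1_pre d A <= hausdorff1 A.
Proof. by move=> d0; apply: ereal_sup_ubound; exists d. Qed.

Lemma hausdorff1_0 : hausdorff1 set0 = 0.
Proof.
apply/eqP; rewrite eq_le; apply/andP; split.
  by apply: ge_ereal_sup => _ [d d0 <-]; rewrite hausdorff1_pre0.
exact: le_trans (hausdorff1_pre_ge0 1 _) (hausdorff1_pre_le _ ltr01).
Qed.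

Lemma hausdorff1_ge0 A : 0 <= hausdorff1 A.
Proof. exact: le_trans (hausdorff1_pre_ge0 1 _) (hausdorff1_pre_le _ ltr01). Qed.

Lemma le_hausdorff1 : {homo hausdorff1 : A B / A `<=` B >-> A <= B}.
Proof.
move=> A B AB; apply: ge_ereal_sup => _ [d d0 <-].
exact: le_trans (le_hausdorff1_pre d AB) (hausdorff1_pre_le _ d0).
Qed.

Lemma hausdorff1_sigma_subadditive : sigma_subadditive hausdorff1.
Proof.
move=> A; apply: ge_ereal_sup => _ [d d0 <-].
apply: (le_trans (hausdorff1_pre_sigma_subadditive d0 A)); apply: lee_nneseries.
  by move=> *; exact: hausdorff1_pre_ge0.
by move=> *; exact: hausdorff1_pre_le.
Qed.

HB.instance Definition _ := isOuterMeasure.Build R plane hausdorff1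
  hausdorff1_0 hausdorff1_ge0 le_hausdorff1 hausdorff1_sigma_subadditive.

Lemma hausdorff1_metric (e : R) A B : (0 < e)%R ->
  (forall x y, A x -> B y -> (e <= enorm (x - y))%R) ->
  hausdorff1 A + hausdorff1 B <= hausdorff1 (A `|` B).
Proof.
move=> e0 sep.
have key d : (0 < d)%R -> (d < e)%R ->
    hausdorff1_pre d A + hausdorff1_pre d B <= hausdorff1_pre d (A `|` B).
  move=> d0 de; apply: le_ereal_inf_tmp => _ [U [ABU dU] <-].
  pose V C k := if `[< U k `&` C !=set0 >] then U k else set0.
  have covV C : C `<=` A `|` B -> hausdorff1_cover d C (V C).
    move=> CAB; split=> [x Cx|k]; rewrite /V.
      have [k _ Ukx] := ABU _ (CAB _ Cx).
      by exists k => //; case: asboolP => // -[]; exists x.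
    by case: asboolP => // _; rewrite diam0 lee_fin ltW.
  have lV C : C `<=` A `|` B ->
      hausdorff1_pre d C <= \sum_(0 <= k <oo) diam (V C k).
    by move=> CAB; apply: ereal_inf_lbound; exists (V C) => //; exact: covV.
  apply: (le_trans (leeD (lV A _) (lV B _))) => //.
  rewrite -nneseriesD//; apply: lee_nneseries => [*|k _]; first exact: adde_ge0.
  rewrite /V; case: asboolP => [[x [Ux Ax]]|]; case: asboolP => [[y [Uy By]]|];
    rewrite ?diam0 ?adde0 ?add0e//.
  have := le_trans (diam_enorm Ux Uy) (dU k).
  by rewrite lee_fin leNgt (lt_le_trans de)// sep.
have key2 c d : (0 < c)%R -> (0 < d)%R ->
    hausdorff1_pre c A + hausdorff1_pre d B <= hausdorff1 (A `|` B).
  move=> c0 d0; pose m : R := Num.min (Num.min c d) (e / 2)%R.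
  have m0 : (0 < m)%R by rewrite !lt_min c0 d0 divr_gt0.
  have me : (m < e)%R by rewrite gt_min gtr_pMr// invf_lt1// ltr1n orbT.
  apply: le_trans (hausdorff1_pre_le _ m0); apply: le_trans (key _ m0 me).
  by apply: leeD; apply: hausdorff1_pre_le_delta; rewrite !ge_min lexx ?orbT.
have [->|ABfin] := eqVneq (hausdorff1 (A `|` B)) +oo; first exact: leey.
have fin C : C `<=` A `|` B -> hausdorff1 C \is a fin_num.
  move=> CAB; rewrite ge0_fin_numE ?hausdorff1_ge0//.
  by rewrite (le_lt_trans (le_hausdorff1 CAB))// ltey.
have fpre c C : (0 < c)%R -> C `<=` A `|` B -> hausdorff1_pre c C \is a fin_num.
  move=> c0 CAB; rewrite ge0_fin_numE ?hausdorff1_pre_ge0//.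
  by apply: le_lt_trans (hausdorff1_pre_le C c0) _; rewrite -ge0_fin_numE ?hausdorff1_ge0 ?fin.
rewrite -leeBrDr ?fin//; apply: ge_ereal_sup => _ [c c0 <-].
rewrite leeBrDr ?fin// addeC -leeBrDr ?fpre//; apply: ge_ereal_sup => _ [d d0 <-].
by rewrite leeBrDr ?fpre// addeC; exact: key2.
Qed.


Lemma enorm_ge_fst x : (`|x.1| <= enorm x)%R.
Proof. by rewrite -sqrtr_sqr ler_wsqrtr// lerDl sqr_ge0. Qed.

Lemma enorm_ge_snd x : (`|x.2| <= enorm x)%R.
Proof. by rewrite -sqrtr_sqr ler_wsqrtr// lerDr sqr_ge0. Qed.

(* Applied below to the two coordinate functions, whose preimages generate the
   Borel sets of the plane. *)
Section caratheodory_criterion.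
Variable phi : plane -> R.
Hypothesis phi_lip : forall x y, (`|phi x - phi y| <= enorm (x - y))%R.

Lemma hausdorff1_gap (a b : R) A B : (a < b)%R ->
  (forall x, A x -> (b < phi x)%R) -> (forall x, B x -> (phi x <= a)%R) ->
  hausdorff1 A + hausdorff1 B <= hausdorff1 (A `|` B).
Proof.
move=> ab Ab Ba; apply: (@hausdorff1_metric (b - a)%R); first by rewrite subr_gt0.
move=> x y /Ab bx /Ba ya; apply: le_trans (phi_lip x y).
by apply: le_trans (ler_norm _); rewrite lerB// ltW.
Qed.

Lemma caratheodory_gt (a : R) : hausdorff1.-caratheodory [set x | (a < phi x)%R].
Proof.
apply: le_caratheodory_measurable => X; set A := [set x | _].
suff : hausdorff1 (X `&` A) + hausdorff1 (X `&` ~` A) <= hausdorff1 X by [].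
have [->|Xfin] := eqVneq (hausdorff1 X) +oo; first exact: leey.
pose s n : R := (a + n.+1%:R^-1)%R.
have ltS n m : (n < m)%N -> (s m < s n)%R.
  by move=> nm; rewrite ltrD2l ltf_pV2 ?posrE// ltr_nat.
have leS n m : (n <= m)%N -> (s m <= s n)%R.
  by move=> nm; rewrite lerD2l lef_pV2 ?posrE// ler_nat.
have sa n : (a < s n)%R by rewrite ltrDl invr_gt0.
pose D n := X `&` [set x | (s n.+2 < phi x)%R /\ (phi x <= s n.+1)%R].
have sumD (c : bool) n : \sum_(0 <= k < n) hausdorff1 (D (k.*2 + c)%N) <=
    hausdorff1 (\bigcup_(k in `I_n) D (k.*2 + c)%N).
  elim: n => [|n ih]; first by rewrite big_nil hausdorff1_ge0.
  rewrite big_nat_recr//= (le_trans (leeD2r _ ih))//.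
  apply: le_trans (@hausdorff1_gap (s (n.*2 + c).+1) (s (n.*2 + c)%N) _ _ _ _ _) _.
  - exact: ltS.
  - move=> x [k /= kn [_ [+ _]]]; apply: le_lt_trans; apply: leS.
    by rewrite -!addSn leq_add2r -doubleS leq_double.
  - by move=> x [_ []].
  - apply: le_hausdorff1 => x [[k kn Dx]|Dx]; [exists k|exists n] => //=.
    exact: leqW.
have DX (c : bool) n : \sum_(0 <= k < n) hausdorff1 (D (k.*2 + c)%N) <= hausdorff1 X.
  by apply: le_trans (sumD c n) _; apply: le_hausdorff1 => x [k _ []].
have split2 n : \sum_(0 <= k < n.*2) hausdorff1 (D k) =
    \sum_(0 <= k < n) hausdorff1 (D (k.*2 + false)%N) +
    \sum_(0 <= k < n) hausdorff1 (D (k.*2 + true)%N).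
  elim: n => [|n ih]; first by rewrite !big_nil adde0.
  rewrite doubleS !big_nat_recr//= ih addn0 addn1 -!addeA; congr (_ + _).
  by rewrite addeCA.
have sum_lty : \sum_(0 <= k <oo) hausdorff1 (D k) < +oo.
  apply: (@le_lt_trans _ _ (hausdorff1 X + hausdorff1 X)); last first.
    by rewrite lte_add_pinfty// ltey.
  apply: lime_le; first by apply: is_cvg_nneseries => *; exact: hausdorff1_ge0.
  apply: nearW => n; apply: (@le_trans _ _ (\sum_(0 <= k < n.*2) hausdorff1 (D k))).
    apply: lee_sum_nneg_natr => //; last by rewrite -addnn leq_addr.
    by move=> *; exact: hausdorff1_ge0.
  by rewrite split2 leeD.
have step n : hausdorff1 (X `&` A) + hausdorff1 (X `&` ~` A) <=
    hausdorff1 X + \sum_(n <= k <oo) hausdorff1 (D k).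
  have XA : hausdorff1 (X `&` A) <=
      hausdorff1 (X `&` [set x | (s n.+1 < phi x)%R]) +
      \sum_(n <= k <oo) hausdorff1 (D k).
    apply: le_trans (leeD2l _ (outer_measure_sigma_subadditive_tail hausdorff1 n D)).
    apply: le_trans (outer_measureU2 hausdorff1 _ _); apply: le_hausdorff1 => x.
    move=> [Xx Ax]; case: (ltP (s n.+1) (phi x)) => sx; [by left|right].
    have ex : exists m, (s m < phi x)%R.
      have /ltr_add_invr[m] : (a < phi x)%R by [].
      by exists m.
    case: (ex_minnP ex) => m sm mmin.
    have nm : (n.+1 < m)%N.
      by rewrite ltnNge; apply/negP => /leS /(le_trans sx); rewrite leNgt sm.
    case: m nm sm mmin => [//|[//|m]] nm sm mmin.
    exists m; first by rewrite /=; apply/negP; rewrite -leqNgt.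
    by split => //; split => //; rewrite leNgt; apply/negP => /mmin; rewrite ltnn.
  apply: (le_trans (leeD2r _ XA)); rewrite addeAC leeD2r//.
  apply: le_trans (@hausdorff1_gap a (s n.+1) _ _ _ _ _) _ => //.
  - by move=> x [].
  - by move=> x [_ /negP]; rewrite -leNgt.
  - by apply: le_hausdorff1 => x [] [].
have tail0 := nneseries_tail_cvg sum_lty (fun n _ => hausdorff1_ge0 (D n)).
have : hausdorff1 X + \sum_(n <= k <oo) hausdorff1 (D k) @[n --> \oo] -->
    hausdorff1 X + 0.
  by apply: cvgeD => //; [rewrite fin_num_adde_defl|exact: cvg_cst].
rewrite adde0 => cvgX; rewrite -(cvg_lim _ cvgX)//.
by apply: lime_ge; [apply/cvg_ex; eexists; exact: cvgX|exact: nearW].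
Qed.

Lemma caratheodory_preimage (B : set R) : measurable B ->
  hausdorff1.-caratheodory (phi @^-1` B).
Proof.
move=> mB.
have mphi : measurable_fun [set: caratheodory_type hausdorff1] phi.
  apply: (measurability _ (measurable_realfun.RGenOInfty.measurableE R)) => _ [_ [a ->] <-].
  rewrite setTI (_ : _ @^-1` _ = [set x | (a < phi x)%R]).
    exact: caratheodory_gt.
  by apply/seteqP; split=> x /=; rewrite in_itv/= andbT.
by have := mphi measurableT _ mB; rewrite setTI.
Qed.

End caratheodory_criterion.

Lemma borel_caratheodory A : measurable A -> hausdorff1.-caratheodory A.
Proof.
move: A; apply: smallest_sub => [|A].
  exact: (@sigma_algebra_measurable _ (caratheodory_type hausdorff1)).
case=> -[B mB <-]; rewrite setTI; apply: caratheodory_preimage mB => x y.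
- exact: (enorm_ge_fst (x - y)%R).
- exact: (enorm_ge_snd (x - y)%R).
Qed.

Let semi_sigma_additive_hausdorff1 :
  semi_sigma_additive (hausdorff1 : set plane -> \bar R).
Proof.
move=> F mF tF _.
apply: (@caratheodory_measure_sigma_additive _ _ hausdorff1) => //.
  by move=> i; exact: borel_caratheodory.
by apply: (@caratheodory_measurable_bigcup _ _ hausdorff1) => i; exact: borel_caratheodory.
Qed.

HB.instance Definition _ := isMeasure.Build _ plane R hausdorff1
  hausdorff1_0 hausdorff1_ge0 semi_sigma_additive_hausdorff1.

End hausdorff_measure.

Section disks.
Context {R : realType}.
Local Notation plane := (R * R)%type.
Implicit Types (x y c p : plane) (r : R).

Definition disk c r : set plane := [set x | enorm (x - c) < r].

Definition boundary (A : set plane) : set plane := closure A `\` interior A.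

Definition circle c r : set plane := boundary (disk c r).

(* The exterior and interior parts of the boundary of [disk c r] relative to
   the union [disk c r `|` disk c' r']. *)
Definition circle_ext c r c' r' : set plane :=
  circle c r `&` boundary (disk c r `|` disk c' r').
Definition circle_int c r c' r' : set plane :=
  circle c r `\` circle_ext c r c' r'.

Definition dotp x y : R := x.1 * y.1 + x.2 * y.2.

(* The angle at p between the segments from p to x and from p to y. *)
Definition angle p x y : R :=
  acos (dotp (x - p) (y - p) / (enorm (x - p) * enorm (y - p))).

Definition to_complex x : R[i] := x.1 +i* x.2.

End disks.

Section complex_L2.
Context {R : realType}.
Local Notation plane := (R * R)%type.
Implicit Types (D : set plane) (u v g : plane -> R[i]) (c x : plane) (r : R).

Definition cintegral D g : R[i] :=
  (\int[hausdorff1]_(x in D) complex.Re (g x)) +i* (\int[hausdorff1]_(x in D) complex.Im (g x)).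

(* Elements of the complex L^2(D) are represented by functions on the plane, of
   which only the values on D matter; equality in L^2(D) is [eqL2 D]. *)
Definition L2 D : set (plane -> R[i]) :=
  [set u | [/\ measurable_fun D (fun x => complex.Re (u x) : R),
               measurable_fun D (fun x => complex.Im (u x) : R) &
               (\int[hausdorff1]_(x in D) (complex.Re (u x) ^+ 2 + complex.Im (u x) ^+ 2)%:E
                  < +oo)%E]].

Definition eqL2 D u v : Prop := u = v %[ae hausdorff1 in D].

Definition dotL2 D u v : R[i] := cintegral D (fun x => u x * (v x)^*).

Definition poisson c r g x : R[i] :=
  ((2 * pi)^-1)%:C *
  cintegral (circle c r) (fun y =>
    ((r ^+ 2 - enorm (x - c) ^+ 2) / (r * enorm (x - y) ^+ 2))%:C * g y).

(* [gamma c r c' r'] maps functions on the boundary of [disk c r] to functions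
   on the boundary of [disk c' r']. *)
Definition gamma c r c' r' g : plane -> R[i] :=
  fun x => if x \in circle_int c' r' c r then poisson c r g x else 0.

Definition HL_circle (L : nat) c r : set (plane -> R[i]) :=
  [set u | L2 (circle c r) u /\
    exists a b : 'I_L.+1 -> R[i], eqL2 (circle c r) u (fun x =>
      \sum_(l < L.+1) (a l * to_complex (x - c) ^+ l +
                       b l * ((to_complex (x - c))^* ) ^+ l))].

End complex_L2.

Section ddcosmo.
Context {R : realType}.
Local Notation plane := (R * R)%type.
Local Notation HH := ((plane -> R[i]) * (plane -> R[i]))%type.
Variables (x1 : plane) (r1 : R) (x2 : plane) (r2 : R).
Implicit Types (u v w : HH) (L : nat).

Definition calH : set HH :=
  [set u | L2 (circle x1 r1) u.1 /\ L2 (circle x2 r2) u.2].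

Definition eqH u v : Prop :=
  eqL2 (circle x1 r1) u.1 v.1 /\ eqL2 (circle x2 r2) u.2 v.2.

Definition dotH u v : R[i] :=
  dotL2 (circle x1 r1) u.1 v.1 + dotL2 (circle x2 r2) u.2 v.2.

Definition normH u : R := Num.sqrt (complex.Re (dotH u u)).

Definition opB u : HH := (gamma x2 r2 x1 r1 u.2, gamma x1 r1 x2 r2 u.1).

Definition calHL L : set HH :=
  [set u | HL_circle L x1 r1 u.1 /\ HL_circle L x2 r2 u.2].

Definition is_orthogonal_projection (S : set HH) u v : Prop :=
  S v /\ forall w, S w -> dotH (u - v) w = 0.

(* The orthogonal projection onto H_L: the element of H_L, unique up to [eqH],
   whose difference with u is orthogonal to H_L (0 if there were none). *)
Definition projL L u : HH := xget 0 [set v | is_orthogonal_projection (calHL L) u v].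

End ddcosmo.

Section rate.
Context {R : realType}.
Implicit Types theta a : R.

Definition pospart a : R := Num.max 0 a.

Definition rate_alpha theta : R :=
  (pi ^+ 2 * sin (theta / 2) ^+ 2 * cos theta + theta ^+ 2) /
  (pi ^+ 2 * sin (theta / 2) ^+ 2 + theta ^+ 2 * cos theta).

Definition rate_g theta : R :=
  (pospart (rate_alpha theta) / 2 * (theta / pi) +
   pospart (cos theta) / 2 * ((pi - theta) / pi)) * ((pi - theta) / pi)
  - sin (theta / 2) ^+ 2 *
    (1 - Num.sqrt (1 + pospart (rate_alpha theta) / sin (theta / 2) ^+ 2 *
                       (theta / pi) * ((pi - theta) / pi))).

Definition rate_h theta : R :=
  rate_g theta ^+ 2 + 2 * rate_g theta * (1 + sin (theta / 2) ^+ 2)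
  - cos (theta / 2) ^+ 2 * pospart (cos theta) * ((pi - theta) ^+ 2 / pi ^+ 2).

Definition rate_f theta : R :=
  2^-1 * Num.sqrt (1 + sin (theta / 2) ^+ 2 + rate_g theta +
                   Num.sqrt (4 * sin (theta / 2) ^+ 2 + rate_h theta)).

End rate.

(* Main.v *)
Require Import Defs.
From HB Require Import structures.
From mathcomp Require Import all_boot all_order all_algebra.
From mathcomp Require Import all_classical all_reals all_analysis.
From mathcomp Require Import measurable_realfun complex ring lra.
Set Implicit Arguments.
Unset Strict Implicit.
Unset Printing Implicit Defensive.
Import Order.TTheory GRing.Theory Num.Theory.
Import numFieldNormedType.Exports.
Local Open Scope classical_set_scope.
Local Open Scope ring_scope.

(** Let [w_n] be the projection of [e^(n)]. The projection acts on each circle separately, so testing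
    the recursion with [w_(n+1)] itself gives [||w_(n+1)||^2 = <gamma w_n, w_(n+1)>] on each circle,
    and since [gamma w_n] vanishes on the exterior arc only the norm [a(w_(n+1))] of [w_(n+1)] on the
    interior arc enters. Suppose that [Re <gamma u, w> <= X(u) a(w)] with a weighted sum
    [X(u) = sg ||u||_int + ta ||u||_ext] of the norms on the two arcs, and that
    [X(u) a(u) <= Lam ||u||^2]. Then [||w_(n+1)|| <= X(w_n)], and multiplying
    [||w_(n+1)||^2 <= X(w_n) a(w_(n+1))] by [X(w_(n+1))] gives [X(w_(n+1)) <= Lam X(w_n)]. Two
    half steps, one for each circle, thus contract by [Lam1 Lam2] ([iteration_decay]), and it remains
    to find weights with [Lam1 Lam2 <= f(theta)^2] and [Lam1 Lam2 < 1].

    The weights come from a Schur test ([schur_test]) for the Poisson kernel between an arc of one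
    circle and the interior arc of the other, with test function [(sqrt z + 1 / sqrt z) / 2], where
    [z] is the ratio of the distances to the two common points of the circles. Parametrised by
    [w = sqrt z], all these arcs have rational coordinates, and the squared distances between them, the
    speeds and the kernel are rational with quartics of one form in their numerators and denominators
    ([arc_dist], [pker_arc]). Hence the integrals of the test are
    explicit: integrated over the first circle the kernel reproduces the test function exactly, with
    factor [s = sin (theta / 2)] on the interior and [c = cos (theta / 2)] on the exterior arc
    ([poisson_row]); integrated over the second circle it gives a rational function of the test
    function ([poisson_col]), which is again at most [s], respectively [c], times the test function
    when the interior arc is at most a half circle, and is a little larger otherwise ([int_col],
    [ext_col]). In the first case [X(u) a(u)] is the quadratic form [s x^2 + c x y], so that
    [Lam = (1 + s) / 2]; in the second case [Lam = 87 / 100] ([arc_form_bound]). The second case occurs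
    on at most one circle and only for acute angles. Since [f >= (1 + s) / 2] always and
    [f^2 >= 87 / 100 (1 + s) / 2] for acute angles ([rate_ge], [rate_ge_acute]), the first claim
    follows. As every estimate is from above, upper bounds for Hausdorff measure suffice: an integral
    over a curve is at most the increment of an antiderivative of integrand times speed
    ([curve_integral_le]).

    For the equation, the weak form on the finite-dimensional space is a square linear system. A
    solution of the homogeneous system is a constant sequence of the iteration, hence null by the
    decay; so the system is solvable ([gram_solve]), and the error of the iteration decays because it
    satisfies the homogeneous recursion ([discrete_equation]). *)

(** * Upper bounds for the length of a curve *)

Section hausdorff_length.
Context {R : realType}.
Local Notation plane := (R * R)%type.

Lemma diam_le (U : set plane) (m : R) : 0 <= m ->
  (forall x y, U x -> U y -> enorm (x - y) <= m) -> (diam U <= m%:E)%E.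
Proof.
move=> m0 Um; apply: ge_ereal_sup => _ [->|[[x y] [/= Ux Uy] <-]].
  by rewrite lee_fin.
by rewrite lee_fin Um.
Qed.

Lemma enorm0 : enorm (0 : plane) = 0.
Proof. by rewrite /enorm /= expr0n/= addr0 sqrtr0. Qed.

Lemma hausdorff1_finite_cover (n : nat) (m : R) (U : (set plane)^nat)
    (A : set plane) : 0 <= m -> A `<=` \bigcup_(k in `I_n) U k ->
  (forall k, (k < n)%N -> (diam (U k) <= m%:E)%E) ->
  (hausdorff1_pre m A <= (n%:R * m)%:E)%E.
Proof.
move=> m0 AU Um; pose V k := if (k < n)%N then U k else set0.
apply: (@le_trans _ _ (\sum_(0 <= k <oo) diam (V k))%E).
  apply: ereal_inf_lbound; exists V => //; split.
    by move=> x /AU[k /= kn Ux]; exists k => //; rewrite /V kn.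
  by move=> k; rewrite /V; case: ifPn => kn; [exact: Um|rewrite diam0 lee_fin].
rewrite (nneseries_split 0 n)//; last by move=> *; exact: diam_ge0.
rewrite [X in (_ + X)%E]eseries0 ?adde0; last first.
  by move=> i /= + _; rewrite /V add0n ltnNge => ->; rewrite diam0.
rewrite add0n; apply: (@le_trans _ _ (\sum_(0 <= k < n) m%:E)%E).
  rewrite big_nat [leRHS]big_nat; apply: lee_sum => i /andP[_ ni].
  by rewrite /V ni Um.
by rewrite sumEFin lee_fin big_const_nat subn0 iter_addr addr0 mulr_natl.
Qed.

Lemma hausdorff1_point (x : plane) : hausdorff1 [set x] = 0%E.
Proof.
apply/eqP; rewrite eq_le hausdorff1_ge0 andbT.
apply: ge_ereal_sup => _ [d d0 <-].
apply: (le_trans (hausdorff1_pre_le_delta _ (ltW d0))).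
have := @hausdorff1_finite_cover 1 0 (fun=> [set x]) [set x] (lexx _).
rewrite mulr0; apply.
  by move=> y ->; exists 0%N.
move=> k _; apply: diam_le => // a b -> ->.
by rewrite subrr enorm0.
Qed.

(** Cutting the parameter interval into equal pieces shows that a Lipschitz
    curve is at most as long as its Lipschitz constant times the time spent. *)
Lemma hausdorff1_lipschitz (Y : R -> plane) (a b M : R) : a <= b -> 0 <= M ->
  (forall x y, a <= x <= b -> a <= y <= b ->
     enorm (Y x - Y y) <= M * `|x - y|) ->
  (hausdorff1 (Y @` `[a, b]) <= (M * (b - a))%:E)%E.
Proof.
move=> ab M0 lipY; apply: ge_ereal_sup => _ [d d0 <-].
have ba0 : 0 <= b - a by rewrite subr_ge0.
pose n := (Num.truncn (M * (b - a) / d)).+1.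
have n0 : (0 : R) < n%:R by rewrite ltr0n.
pose h := (b - a) / n%:R.
have h0 : 0 <= h by rewrite divr_ge0// ltW.
have hn : n%:R * h = b - a by rewrite /h mulrCA mulfV ?mulr1// gt_eqF.
have Mhd : M * h <= d.
  have := truncnS_gt (M * (b - a) / d); rewrite -/n ltr_pdivrMr// => /ltW.
  by rewrite /h mulrA ler_pdivrMr// [d * _]mulrC.
apply: (le_trans (hausdorff1_pre_le_delta _ Mhd)).
have Mh0 : 0 <= M * h by rewrite mulr_ge0.
pose U k := Y @` [set x | a <= x <= b /\ a + k%:R * h <= x <= a + k.+1%:R * h].
have := @hausdorff1_finite_cover n (M * h) U (Y @` `[a, b]) Mh0.
have -> : n%:R * (M * h) = M * (b - a) by rewrite mulrCA hn.
apply.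
- move=> z [x /=]; rewrite in_itv/= => /andP[ax xb] <-{z}.
  have [h0'|hpos] := leP h 0.
    have hE : h = 0 by apply/eqP; rewrite eq_le h0' h0.
    have := hn; rewrite hE mulr0 => /esym/eqP; rewrite subr_eq0 => /eqP ba.
    exists 0%N => //=; exists x => //=; rewrite hE !mulr0 addr0 ax xb.
    by rewrite -ba.
  have xah : 0 <= (x - a) / h by rewrite divr_ge0// subr_ge0.
  have [xb'|xb'] := eqVneq x b.
    exists n.-1 => //=; exists x => //=; rewrite ax xb; split=> //.
    move: hn; rewrite /n -natr1 mulrDl mul1r => hn'.
    by apply/andP; split; lra.
  have xn : (Num.truncn ((x - a) / h) < n)%N.
    rewrite -(ltr_nat R); apply: (@le_lt_trans _ _ ((x - a) / h)); first by rewrite truncn_le.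
    rewrite ltr_pdivrMr// hn ltrD2r lt_neqAle xb'//.
  exists (Num.truncn ((x - a) / h)) => //=; exists x => //=.
  rewrite ax xb; split=> //.
  have := truncn_le ((x - a) / h); rewrite xah ler_pdivlMr// => h1.
  have := truncnS_gt ((x - a) / h); rewrite ltr_pdivrMr// => h2.
  by apply/andP; split; lra.
- move=> k kn; apply: diam_le => // _ _ [x [xab xk] <-] [y [yab yk] <-].
  apply: (le_trans (lipY _ _ xab yab)); rewrite ler_wpM2l//.
  move: xk yk; rewrite -natr1 mulrDl mul1r ler_norml => /andP[? ?] /andP[? ?].
  by apply/andP; split; lra.
Qed.

End hausdorff_length.

(** Real induction: the supremum of the [x] with [P a x] is attained and cannot lie below [b]. *)
Lemma interval_gluing (R : realType) (P : R -> R -> Prop) (a b : R) : a <= b ->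
  (forall x y z, a <= x -> x <= y -> y <= z -> z <= b ->
     P x y -> P y z -> P x z) ->
  (forall w, a <= w <= b -> exists2 d, 0 < d & forall x y,
     a <= x -> y <= b -> w - d < x -> x <= w -> w <= y -> y < w + d -> P x y) ->
  P a b.
Proof.
move=> ab Ptrans Ploc.
have Prefl w : a <= w <= b -> P w w.
  move=> wab; have [d d0] := Ploc w wab; move: wab => /andP[aw wb].
  by apply=> //; lra.
pose S := [set x | a <= x <= b /\ P a x].
have Sa : S a by split; [rewrite lexx ab|apply: Prefl; rewrite lexx ab].
have hS : has_sup S by split; [exists a|exists b => x [/andP[]]].
pose s := sup S.
have as_ : a <= s by exact: (sup_upper_bound hS).
have sb : s <= b by apply: ge_sup; [exists a|move=> x [/andP[]]].
have [d d0 Pd] := Ploc s ltac:(by rewrite as_ sb).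
have [x [/andP[ax xb] Pax] sdx] := sup_adherent d0 hS.
have xs : x <= s by apply: (sup_upper_bound hS); split=> //; rewrite ax xb.
pose y := Num.min b (s + d / 2).
have sy : s <= y by rewrite le_min sb/= lerDl divr_ge0// ltW.
have yb : y <= b by rewrite ge_min lexx.
have ysd : y < s + d.
  by rewrite gt_min; apply/orP; right; rewrite ltrD2l ltr_pdivrMr// ltr_pMr// ltr1n.
have Pxy : P x y by apply: Pd.
have Pay : P a y by apply: (Ptrans a x y) => //; exact: le_trans xs sy.
have : y <= s.
  apply: (sup_upper_bound hS); split=> //.
  by rewrite (le_trans as_ sy) yb.
rewrite ge_min => /orP[bs|]; last by rewrite gerDl leNgt divr_gt0.
suff <- : y = b by [].
by apply/eqP; rewrite eq_le yb (le_trans bs).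
Qed.

(** * A fundamental theorem of calculus along a curve *)

Section curve_integral.
Context {R : realType}.
Local Notation plane := (R * R)%type.
Variables (G : set plane) (W : plane -> R) (Y : R -> plane).
Variables (F : plane -> R) (Phi J : R -> R).
Hypothesis mG : measurable G.
Hypothesis mW : measurable_fun [set: plane] W.
Hypothesis mF : measurable_fun [set: plane] F.
Hypothesis F0 : forall x, 0 <= F x.
Hypothesis GW : forall x, G x -> 0 < W x /\ Y (W x) = x.
Hypothesis FYc : forall w : R, 0 < w -> {for w, continuous (F \o Y)}.
Hypothesis J0 : forall w : R, 0 < w -> 0 <= J w.
Hypothesis Ylip : forall w e : R, 0 < w -> 0 < e -> exists2 d, 0 < d &
  forall x y : R, w - d < x < w + d -> w - d < y < w + d ->
    enorm (Y x - Y y) <= (J w + e) * `|x - y|.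
Hypothesis dPhi : forall w : R, 0 < w -> is_derive w (1 : R) Phi (F (Y w) * J w).

Let S a b := G `&` (W @^-1` `]a, b]).

Let mS a b : measurable (S a b).
Proof. by apply: measurableI => //; rewrite -[X in measurable X]setTI; exact: mW. Qed.

Let I a b := (\int[hausdorff1]_(x in S a b) (F x)%:E)%E.

Let mFE (A : set plane) : measurable_fun A (EFin \o F).
Proof. by apply/measurable_EFinP; exact: measurable_funS mF. Qed.

Let I_split x y z : x <= y -> y <= z -> I x z = (I x y + I y z)%E.
Proof.
move=> xy yz; rewrite /I; have -> : S x z = S x y `|` S y z.
  rewrite /S -setIUr -preimage_setU; congr (_ `&` _ @^-1` _).
  by rewrite -itv_bndbnd_setU// bnd_simp.
apply: ge0_integral_setU => //; [by move=> t _; rewrite lee_fin|].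
apply/disj_setPS => t [[_ /=]]; rewrite in_itv/= => /andP[_ Wy] [_ /=].
by rewrite in_itv/= => /andP[+ _]; rewrite ltNge Wy.
Qed.

(* On a short interval the integrand and the speed are almost constant, so the
   integral is almost at most [F (Y w) * J w] times the length of the interval,
   which is almost the increment of [Phi]. *)
Let I_local (w e : R) : 0 < w -> 0 < e -> exists2 d, 0 < d & forall x y : R, 0 < x ->
  w - d < x -> x <= w -> w <= y -> y < w + d ->
  (I x y <= (Phi y - Phi x + e * (y - x))%:E)%E.
Proof.
move=> w0 e0; set f0 := F (Y w); set j0 := J w.
have f00 : 0 <= f0 by exact: F0.
have j00 : 0 <= j0 by exact: J0.
pose D := f0 + j0 + 1; have D0 : 0 < D by rewrite /D; lra.
pose e1 := Num.min 1 (e / 2 / D).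
have e10 : 0 < e1 by rewrite lt_min ltr01 !divr_gt0.
have e11 : e1 <= 1 by rewrite ge_min lexx.
have e1D : e1 * D <= e / 2 by rewrite -ler_pdivlMr// ge_min lexx orbT.
have prod_le : (f0 + e1) * (j0 + e1) <= f0 * j0 + e / 2.
  have : e1 * e1 <= e1 by rewrite ler_piMr// ltW.
  by rewrite /D in e1D; nra.
have [d1 d10 lip1] := Ylip w0 e10.
have /cvgrPdist_lt/(_ _ e10)/nbhs_ballP[d2 /= d20 cF] := FYc w0.
have e20 : 0 < e / 2 by rewrite divr_gt0.
have [dP dPE] := dPhi w0.
have [d3 d30 cP] : exists2 d, 0 < d & forall y, `|y - w| < d ->
    `|Phi y - Phi w - f0 * j0 * (y - w)| <= e / 2 * `|y - w|.
  have /cvgrPdist_le/(_ _ e20) := dP.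
  rewrite -/(derive Phi w 1) dPE => /nbhs_ballP[d3 /= d30 cP].
  exists d3 => // y yw; have [->|yw0] := eqVneq y w.
    by rewrite !subrr mulr0 subrr normr0 mulr0.
  have yw0' : y - w != 0 by rewrite subr_eq0.
  have := cP (y - w); rewrite /ball/= sub0r normrN => /(_ yw yw0').
  rewrite [_ *: 1]mulr1 subrK /GRing.scale/= => h.
  have -> : Phi y - Phi w - f0 * j0 * (y - w) =
      - ((f0 * j0 - (y - w)^-1 * (Phi y - Phi w)) * (y - w)).
    by field.
  by rewrite normrN normrM ler_wpM2r.
pose d := Num.min d1 (Num.min d2 d3).
exists d; first by rewrite !lt_min d10 d20.
move=> x y x0 wdx xw wy ywd.
have dd1 : d <= d1 by rewrite ge_min lexx.
have dd2 : d <= d2 by rewrite !ge_min lexx orbT.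
have dd3 : d <= d3 by rewrite !ge_min lexx !orbT.
have Fb t : S x y t -> F t <= f0 + e1.
  move=> [Gt /=]; rewrite in_itv/= => /andP[xt ty].
  have [Wt0 YW] := GW Gt.
  have : ball w d2 (W t) by rewrite /ball/= ltr_norml; apply/andP; split; lra.
  move=> /cF/=; rewrite YW -/f0 ltr_norml => /andP[? ?]; lra.
have HS : (hausdorff1 (S x y) <= ((j0 + e1) * (y - x))%:E)%E.
  apply: (@le_trans _ _ (hausdorff1 (Y @` `[x, y]))).
    apply: le_hausdorff1 => t [Gt /=]; rewrite in_itv/= => /andP[xt ty].
    have [Wt0 YW] := GW Gt; exists (W t) => //=.
    by rewrite in_itv/= ty ltW.
  apply: hausdorff1_lipschitz; [exact: le_trans xw wy|lra|].
  by move=> u v /andP[? ?] /andP[? ?]; apply: lip1; apply/andP; split; lra.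
apply: (@le_trans _ _ (\int[hausdorff1]_(t in S x y) (cst (f0 + e1)%:E t))%E).
  apply: ge0_le_integral => //.
  by move=> t _; rewrite lee_fin.
rewrite integral_cst//.
apply: (@le_trans _ _ ((f0 + e1)%:E * ((j0 + e1) * (y - x))%:E)%E).
  by apply: lee_wpmul2l => //; rewrite lee_fin; lra.
rewrite -EFinM lee_fin mulrA.
have yx0 : 0 <= y - x by lra.
apply: (le_trans (ler_wpM2r yx0 prod_le)).
have : `|y - w| = y - w by rewrite ger0_norm// subr_ge0.
have : `|x - w| = w - x by rewrite ler0_norm ?opprB// subr_le0.
move=> xwE ywE.
have := cP y; rewrite ywE => /(_ ltac:(lra)); rewrite ler_norml => /andP[h1 _].
have := cP x; rewrite xwE => /(_ ltac:(lra)); rewrite ler_norml => /andP[_ h2].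
by lra.
Qed.

Let I_le a b : 0 < a -> a <= b -> (I a b <= (Phi b - Phi a)%:E)%E.
Proof.
move=> a0 ab; apply/lee_addgt0Pr => e e0.
have [->|anb] := eqVneq a b.
  rewrite /I /S set_itv_ge ?preimage_set0 ?setI0 ?integral_set0 ?bnd_simp ?ltxx//.
  by rewrite subrr add0e lee_fin ltW.
have ba : 0 < b - a by rewrite subr_gt0 lt_neqAle anb.
pose e' := e / (b - a); have e'0 : 0 < e' by rewrite divr_gt0.
suff : (I a b <= (Phi b - Phi a + e' * (b - a))%:E)%E.
  by rewrite /e' divfK ?gt_eqF// EFinD.
apply: (@interval_gluing _
  (fun x y => (I x y <= (Phi y - Phi x + e' * (y - x))%:E)%E)) => //.
- move=> x y z ax xy yz zb h1 h2; rewrite (I_split xy yz).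
  apply: (le_trans (leeD h1 h2)); rewrite -EFinD lee_fin; lra.
- move=> w /andP[aw wb].
  have [d d0 Id] := I_local (lt_le_trans a0 aw) e'0.
  by exists d => // x y ax yb; apply: Id; exact: lt_le_trans ax.
Qed.

(** The bound holds up to [e] times the length on short intervals, hence by additivity on compact ones;
    these exhaust the half-line. [W] reads off the parameter of a point, and the Lipschitz constants
    of [Y] near [w] stand in for its speed. *)
Theorem curve_integral_le (L0 L1 : R) :
  Phi n.+1%:R @[n --> \oo] --> L1 -> Phi n.+1%:R^-1 @[n --> \oo] --> L0 ->
  (\int[hausdorff1]_(x in G) (F x)%:E <= (L1 - L0)%:E)%E.
Proof.
move=> cL1 cL0.
pose T n := S n.+1%:R^-1 n.+1%:R.
have TG : \bigcup_n T n = G.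
  apply/seteqP; split=> [x [n _ []]//|x Gx].
  have [Wx0 _] := GW Gx.
  have [n1 hn1] : exists n, W x <= n.+1%:R.
    by exists (Num.truncn (W x)); rewrite ltW// truncnS_gt.
  have [n2 hn2] : exists n, n.+1%:R^-1 < W x.
    by have /ltr_add_invr[n] := Wx0; rewrite add0r => h; exists n.
  exists (maxn n1 n2) => //; split=> //=; rewrite in_itv/=; apply/andP; split.
    apply: le_lt_trans hn2; rewrite lef_pV2 ?posrE// ler_nat ltnS.
    exact: leq_maxr.
  by apply: (le_trans hn1); rewrite ler_nat ltnS leq_maxl.
rewrite -TG.
have cvgI : (\int[hausdorff1]_(x in T n) (F x)%:E)%E @[n --> \oo] -->
    (\int[hausdorff1]_(x in \bigcup_n T n) (F x)%:E)%E.
  apply: ge0_nondecreasing_set_cvg_integral => //.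
  - move=> m n mn; apply/subsetPset => x [Gx /=]; rewrite !in_itv/=.
    move=> /andP[h1 h2]; split=> //=; rewrite in_itv/=; apply/andP; split.
      by apply: le_lt_trans h1; rewrite lef_pV2 ?posrE// ler_nat ltnS.
    by apply: (le_trans h2); rewrite ler_nat ltnS.
  - by move=> i; exact: mS.
  - by move=> i x _; rewrite lee_fin.
rewrite -(cvg_lim _ cvgI)//.
have cvgP : ((Phi n.+1%:R - Phi n.+1%:R^-1)%:E)%E @[n --> \oo] --> (L1 - L0)%:E.
  by apply: cvg_EFin; [exact: nearW|exact: cvgB].
rewrite -(cvg_lim _ cvgP)//; apply: lee_lim.
- by apply/cvg_ex; eexists; exact: cvgI.
- by apply/cvg_ex; eexists; exact: cvgP.
- apply: nearW => n; apply: I_le => //.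
  by rewrite (@le_trans _ _ 1) ?invf_le1 ?ler1n.
Qed.

End curve_integral.

(** * Antiderivatives with a quartic denominator *)

Lemma eq_cvgn (R : realType) (u v : nat -> R) (l : R) : u =1 v ->
  u n @[n --> \oo] --> l -> v n @[n --> \oo] --> l.
Proof. by move=> /funext ->. Qed.

Section quartic_primitive.
Context {R : realType}.
Implicit Types (a b k rho w : R).

Definition quartic k rho w : R := w ^+ 4 - 2 * k * rho ^+ 2 * w ^+ 2 + rho ^+ 4.

Definition atan_prim k rho w : R :=
  atan ((w / rho - rho / w) / Num.sqrt (2 - 2 * k)).

Definition ln_prim k rho w : R :=
  ln ((w / rho + rho / w - Num.sqrt (2 + 2 * k)) /
      (w / rho + rho / w + Num.sqrt (2 + 2 * k))).

Definition quartic_prim a b k rho w : R :=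
  (a + b / rho ^+ 2) / (2 * rho * Num.sqrt (2 - 2 * k)) * atan_prim k rho w +
  (a - b / rho ^+ 2) / (4 * rho * Num.sqrt (2 + 2 * k)) * ln_prim k rho w.

Lemma quartic_gt0 k rho w : -1 < k < 1 -> 0 < rho -> 0 < w ->
  0 < quartic k rho w.
Proof.
move=> /andP[k1 k2] rho0 w0.
have -> : quartic k rho w = (w ^+ 2 - rho ^+ 2) ^+ 2 +
    (2 - 2 * k) * (rho * w) ^+ 2 by rewrite /quartic; ring.
rewrite ltr_wpDl ?sqr_ge0// mulr_gt0 ?exprn_gt0 ?mulr_gt0//; lra.
Qed.

Let sum_gt k rho w : -1 < k < 1 -> 0 < rho -> 0 < w ->
  Num.sqrt (2 + 2 * k) < w / rho + rho / w.
Proof.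
move=> /andP[k1 k2] rho0 w0.
apply: (@lt_le_trans _ _ (Num.sqrt (2 ^+ 2))).
  by rewrite ltr_sqrt; lra.
rewrite sqrtr_sqr ger0_norm//.
rewrite -subr_ge0 (_ : _ - 2 = (w - rho) ^+ 2 / (rho * w)); last first.
  by field; rewrite !gt_eqF.
by rewrite divr_ge0 ?sqr_ge0// ltW// mulr_gt0.
Qed.

Lemma is_derive_quotient rho w e : 0 < rho -> 0 < w ->
  is_derive w (1 : R) (fun x => x / rho + e * (rho / x))
    ((w ^+ 2 - e * rho ^+ 2) / (rho * w ^+ 2)).
Proof.
move=> rho0 w0.
have dV : is_derive w (1 : R) (fun x : R => x^-1) (- w ^- 2 *: 1).
  by apply: (@is_deriveV _ id); rewrite gt_eqF.
have dd := is_deriveD (is_deriveZ rho^-1 (is_derive_id w (1 : R)))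
  (is_deriveZ (e * rho) dV).
rewrite (_ : (fun x => _) =
    rho^-1 \*: id + (e * rho) \*: (fun x : R => x^-1)); last first.
  by apply/funext => x; rewrite fctE /= /GRing.scale/=; ring.
apply: is_derive_eq dd _.
by rewrite /GRing.scale/=; field; rewrite !gt_eqF.
Qed.

Lemma is_derive_atan_prim k rho w : -1 < k < 1 -> 0 < rho -> 0 < w ->
  is_derive w (1 : R) (atan_prim k rho)
    (rho * Num.sqrt (2 - 2 * k) * (w ^+ 2 + rho ^+ 2) / quartic k rho w).
Proof.
move=> k1 rho0 w0; set K := Num.sqrt _.
have K2 : K ^+ 2 = 2 - 2 * k by rewrite sqr_sqrtr//; lra.
have K0 : 0 < K by rewrite sqrtr_gt0; lra.
have d1 := is_derive_quotient (-1) rho0 w0.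
have d2 := is_deriveZ K^-1 d1.
have d3 := is_derive1_comp (is_derive1_atan _) d2.
rewrite (_ : atan_prim k rho = atan \o (K^-1 \*: (fun x => x / rho + -1 * (rho / x)))).
  apply: is_derive_eq d3 _; rewrite /= /GRing.scale/=.
  have q0 := quartic_gt0 k1 rho0 w0.
  have -> : quartic k rho w = (w ^+ 2 - rho ^+ 2) ^+ 2 + K ^+ 2 * (rho * w) ^+ 2.
    by rewrite K2 /quartic; ring.
  have p1 : 0 < (w ^+ 2 - rho ^+ 2) ^+ 2 + K ^+ 2 * (rho * w) ^+ 2.
    by rewrite ltr_wpDl ?sqr_ge0// mulr_gt0 ?exprn_gt0 ?mulr_gt0.
  by field; rewrite !gt_eqF// exprMn.
by apply/funext => x; rewrite /atan_prim /= /GRing.scale/= mulN1r mulrC.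
Qed.

Lemma is_derive_ln_prim k rho w : -1 < k < 1 -> 0 < rho -> 0 < w ->
  is_derive w (1 : R) (ln_prim k rho)
    (2 * rho * Num.sqrt (2 + 2 * k) * (w ^+ 2 - rho ^+ 2) / quartic k rho w).
Proof.
move=> k1 rho0 w0; set l := Num.sqrt _.
have l2 : l ^+ 2 = 2 + 2 * k by rewrite sqr_sqrtr//; lra.
have l0 : 0 < l by rewrite sqrtr_gt0; lra.
have lw := sum_gt k1 rho0 w0; rewrite -/l in lw.
have d1 := is_derive_quotient 1 rho0 w0.
have dN := is_deriveD d1 (is_derive_cst (- l) w 1).
have dD := is_deriveD d1 (is_derive_cst l w 1).
have D0 : w / rho + 1 * (rho / w) + l != 0 by rewrite mul1r gt_eqF//; lra.
have dV := @is_deriveV _ (fun x => x / rho + 1 * (rho / x) + l) _ _ _ D0 dD.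
have dM := is_deriveM dN dV.
have pos : 0 < (w / rho + 1 * (rho / w) - l) / (w / rho + 1 * (rho / w) + l).
  by rewrite mul1r divr_gt0; lra.
pose g x : R := (x / rho + 1 * (rho / x) - l) / (x / rho + 1 * (rho / x) + l).
have {}dM : is_derive w (1 : R) g _ := dM.
have d3 := @is_derive1_comp _ (@ln R) g _ _ _ (is_derive1_ln pos) dM.
have q0 := quartic_gt0 k1 rho0 w0.
have q1 : quartic k rho w =
    (w ^+ 2 + rho ^+ 2 - l * (rho * w)) * (w ^+ 2 + rho ^+ 2 + l * (rho * w)).
  rewrite (_ : _ * _ = (w ^+ 2 + rho ^+ 2) ^+ 2 - l ^+ 2 * (rho * w) ^+ 2); last by ring.
  by rewrite l2 /quartic; ring.
have q2 : 0 < w ^+ 2 + rho ^+ 2 + l * (rho * w).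
  by rewrite addr_gt0 ?addr_gt0 ?exprn_gt0 ?mulr_gt0.
have q3 : 0 < w ^+ 2 + rho ^+ 2 - l * (rho * w).
  by rewrite -(pmulr_lgt0 _ q2) -q1.
have -> : ln_prim k rho = @ln R \o g.
  by apply/funext => x; rewrite /ln_prim /= /g !mul1r.
apply: is_derive_eq d3 _.
rewrite q1 fctE /= /cst /GRing.scale/= !addr0.
have -> : w / rho + 1 * (rho / w) - l = (w ^+ 2 + rho ^+ 2 - l * (rho * w)) / (rho * w).
  by field; rewrite !gt_eqF.
have -> : w / rho + 1 * (rho / w) + l = (w ^+ 2 + rho ^+ 2 + l * (rho * w)) / (rho * w).
  by field; rewrite !gt_eqF.
by field; rewrite !gt_eqF.
Qed.

(** Splitting the numerator into multiples of [w ^+ 2 + rho ^+ 2] and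
    [w ^+ 2 - rho ^+ 2] separates the two primitives. *)
Lemma is_derive_quartic_prim a b k rho w : -1 < k < 1 -> 0 < rho -> 0 < w ->
  is_derive w (1 : R) (quartic_prim a b k rho)
    ((a * w ^+ 2 + b) / quartic k rho w).
Proof.
move=> k1 rho0 w0.
have dd := is_deriveD
  (is_deriveZ ((a + b / rho ^+ 2) / (2 * rho * Num.sqrt (2 - 2 * k)))
    (is_derive_atan_prim k1 rho0 w0))
  (is_deriveZ ((a - b / rho ^+ 2) / (4 * rho * Num.sqrt (2 + 2 * k)))
    (is_derive_ln_prim k1 rho0 w0)).
apply: is_derive_eq dd _; rewrite /GRing.scale/=.
have q0 := quartic_gt0 k1 rho0 w0.
have K0 : 0 < Num.sqrt (2 - 2 * k) by rewrite sqrtr_gt0; lra.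
have l0 : 0 < Num.sqrt (2 + 2 * k) by rewrite sqrtr_gt0; lra.
by field; rewrite !gt_eqF.
Qed.

Let nat_y (c : R) : 0 < c -> n.+1%:R / c @[n --> \oo] --> +oo.
Proof.
move=> c0; apply/cvgryPge => A; near=> n.
rewrite ler_pdivlMr//; apply: (@le_trans _ _ n%:R); last by rewrite ler_nat.
by near: n; apply: nbhs_infty_ger.
Unshelve. all: by end_near. Qed.

Let inv_nat (c : R) : c / n.+1%:R @[n --> \oo] --> 0.
Proof.
rewrite -(mulr0 c); apply: cvgM; first exact: cvg_cst.
exact: cvg_harmonic.
Qed.

Lemma atan_prim_cvgy k rho : -1 < k < 1 -> 0 < rho ->
  atan_prim k rho n.+1%:R @[n --> \oo] --> pi / 2.
Proof.
move=> k1 rho0; set K := Num.sqrt (2 - 2 * k).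
have K0 : 0 < K by rewrite sqrtr_gt0; lra.
apply: (cvg_comp _ _ _ (@cvgy_atan R)).
apply/cvgryPge => A.
have h := nat_y (mulr_gt0 rho0 K0); have h2 := inv_nat (rho / K).
move/cvgryPge: h => h; near=> n.
have -> : (n.+1%:R / rho - rho / n.+1%:R) / K = n.+1%:R / (rho * K) - rho / K / n.+1%:R.
  by field; rewrite !gt_eqF.
rewrite lerBrDr; apply: (@le_trans _ _ (A + rho / K)).
  by rewrite lerD2l ler_pdivrMr// ler_peMr ?ler1n// divr_ge0// ltW.
by near: n; exact: h.
Unshelve. all: by end_near. Qed.

Lemma ln_prim_cvgy k rho : -1 < k < 1 -> 0 < rho ->
  ln_prim k rho n.+1%:R @[n --> \oo] --> 0.
Proof.
move=> k1 rho0; set l := Num.sqrt (2 + 2 * k).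
have l0 : 0 < l by rewrite sqrtr_gt0; lra.
rewrite -(@ln1 R); apply: (@cvg_comp _ _ _ _ (@ln R) _ (nbhs (1 : R))); last exact: (@continuous_ln R 1 ltr01).
have h0 : (rho ^+ 2 / n.+1%:R - l * rho) / n.+1%:R @[n --> \oo] --> 0.
  rewrite -(mulr0 (0 - l * rho)); apply: cvgM; last exact: cvg_harmonic.
  by apply: cvgB; [exact: inv_nat|exact: cvg_cst].
have h1 : (rho ^+ 2 / n.+1%:R + l * rho) / n.+1%:R @[n --> \oo] --> 0.
  rewrite -(mulr0 (0 + l * rho)); apply: cvgM; last exact: cvg_harmonic.
  by apply: cvgD; [exact: inv_nat|exact: cvg_cst].
have c1 : (1 : R) @[n --> \oo] --> (1 : R) by exact: cvg_cst.
have h2 : 1 + (rho ^+ 2 / n.+1%:R - l * rho) / n.+1%:R @[n --> \oo] --> (1 : R).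
  by rewrite -[X in _ --> X]addr0; exact: cvgD.
have h3 : 1 + (rho ^+ 2 / n.+1%:R + l * rho) / n.+1%:R @[n --> \oo] --> (1 : R).
  by rewrite -[X in _ --> X]addr0; exact: cvgD.
have := cvgM h2 (cvgV (oner_neq0 _) h3).
rewrite invr1 mulr1 => h; apply: eq_cvgn (h _ _) => n /=.
have n0 : (0 : R) < n.+1%:R by [].
rewrite /ln_prim -/l; have -> : n.+1%:R / rho + rho / n.+1%:R - l =
    n.+1%:R / rho * (1 + (rho ^+ 2 / n.+1%:R - l * rho) / n.+1%:R).
  by field; rewrite !gt_eqF.
have -> : n.+1%:R / rho + rho / n.+1%:R + l =
    n.+1%:R / rho * (1 + (rho ^+ 2 / n.+1%:R + l * rho) / n.+1%:R).
  by field; rewrite !gt_eqF.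
by rewrite -mulf_div divff ?mul1r// mulf_neq0// ?invr_neq0// gt_eqF.
Qed.

Lemma atan_prim_cvg0 k rho : -1 < k < 1 -> 0 < rho ->
  atan_prim k rho n.+1%:R^-1 @[n --> \oo] --> - (pi / 2).
Proof.
move=> k1 rho0; have r0 : 0 < rho^-1 by rewrite invr_gt0.
apply: eq_cvgn (cvgN (atan_prim_cvgy k1 r0)) => n /=.
by rewrite /atan_prim -atanN; congr atan; rewrite !invrK; ring.
Qed.

Lemma ln_prim_cvg0 k rho : -1 < k < 1 -> 0 < rho ->
  ln_prim k rho n.+1%:R^-1 @[n --> \oo] --> 0.
Proof.
move=> k1 rho0; have r0 : 0 < rho^-1 by rewrite invr_gt0.
apply: eq_cvgn (ln_prim_cvgy k1 r0) => n /=.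
rewrite /ln_prim !invrK; congr (ln ((_ - _) / (_ + _)));
  by rewrite addrC [_^-1 * _]mulrC [_ * rho]mulrC.
Qed.

(** The logarithmic part vanishes at both ends. *)
Definition quartic_total a b k rho : R :=
  (a + b / rho ^+ 2) / (2 * rho * Num.sqrt (2 - 2 * k)) * pi.

Lemma quartic_prim_cvg a b k rho : -1 < k < 1 -> 0 < rho ->
  quartic_prim a b k rho n.+1%:R @[n --> \oo] --> quartic_total a b k rho / 2 /\
  quartic_prim a b k rho n.+1%:R^-1 @[n --> \oo] --> - (quartic_total a b k rho / 2).
Proof.
move=> k1 rho0; split.
  rewrite (_ : _ / 2 = (a + b / rho ^+ 2) / (2 * rho * Num.sqrt (2 - 2 * k)) * (pi / 2)
    + (a - b / rho ^+ 2) / (4 * rho * Num.sqrt (2 + 2 * k)) * 0).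
    by apply: cvgD; apply: cvgMl_tmp; [exact: atan_prim_cvgy|exact: ln_prim_cvgy].
  by rewrite mulr0 addr0 mulrA.
rewrite (_ : - _ = (a + b / rho ^+ 2) / (2 * rho * Num.sqrt (2 - 2 * k)) * (- (pi / 2))
  + (a - b / rho ^+ 2) / (4 * rho * Num.sqrt (2 + 2 * k)) * 0).
  by apply: cvgD; apply: cvgMl_tmp; [exact: atan_prim_cvg0|exact: ln_prim_cvg0].
by rewrite mulr0 addr0 mulrN mulrA.
Qed.

End quartic_primitive.

(** * Arcs through two points *)

Section arcs.
Context {R : realType}.
Local Notation plane := (R * R)%type.
Implicit Types (M e x y c : plane) (l cg sg w r : R).

Lemma enorm_sqr x : enorm x ^+ 2 = x.1 ^+ 2 + x.2 ^+ 2.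
Proof. by rewrite sqr_sqrtr// addr_ge0// sqr_ge0. Qed.

Definition frame_x M e y : R := (y.1 - M.1) * e.1 + (y.2 - M.2) * e.2.
Definition frame_y M e y : R := (y.2 - M.2) * e.1 - (y.1 - M.1) * e.2.

(** The coordinates of [arc_pt] in the frame with origin [M] and axes [e] and its rotation. *)
Definition arc_x l cg sg w : R := - 2 * l * w ^+ 2 * sg / quartic cg 1 w.
Definition arc_y l cg w : R := l * (1 - w ^+ 4) / quartic cg 1 w.

(** In complex notation, with the end points at [+-i l], this is the point
    [i l (1 + z) / (1 - z)] for [z = w ^+ 2 * (cg + i sg)]: the ratio of its
    distances to the end points is [w ^+ 2], and its position on the arc enters
    all distances through a quartic in [w]. *)
Definition arc_pt M e l cg sg w : plane :=
  (M.1 + arc_x l cg sg w * e.1 - arc_y l cg w * e.2,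
   M.2 + arc_x l cg sg w * e.2 + arc_y l cg w * e.1).

Definition arc_param M e l y : R := Num.sqrt (Num.sqrt
  ((frame_x M e y ^+ 2 + (frame_y M e y - l) ^+ 2) /
   (frame_x M e y ^+ 2 + (frame_y M e y + l) ^+ 2))).

(** The weight of the Schur test: with [z] the ratio of the distances of [y] to the two common points
    of the circles, this is [(sqrt z + 1 / sqrt z) / 2]. *)
Definition arc_weight M e l y : R :=
  (arc_param M e l y + (arc_param M e l y)^-1) / 2.

(** The point with parameter 1, in the middle of the arc, is left out: there a
    partial fraction decomposition used below degenerates. *)
Definition arc M e l cg sg : set plane :=
  [set y | [/\ sg * (frame_x M e y ^+ 2 + frame_y M e y ^+ 2 - l ^+ 2) +
                 2 * l * cg * frame_x M e y = 0,
               sg * frame_x M e y < 0 & arc_param M e l y != 1]].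

Definition arc_speed l cg w : R := 4 * l * w / quartic cg 1 w.

Section frame.
Variables (M e : plane) (l cg sg : R).
Hypothesis e1 : e.1 ^+ 2 + e.2 ^+ 2 = 1.
Hypothesis l0 : 0 < l.
Hypothesis g1 : cg ^+ 2 + sg ^+ 2 = 1.
Hypothesis sg0 : sg != 0.

Lemma arc_cos_bounds : -1 < cg < 1.
Proof.
have : 0 < sg ^+ 2 by rewrite exprn_even_gt0.
have -> : sg ^+ 2 = (1 - cg) * (1 + cg) by rewrite -(addrK (cg ^+ 2) (sg ^+ 2)) [sg ^+ 2 + _]addrC g1; ring.
by move=> h; apply/andP; split; nra.
Qed.
Let cgb := arc_cos_bounds.

Lemma enorm_frame x y : enorm (x - y) ^+ 2 =
  (frame_x M e x - frame_x M e y) ^+ 2 + (frame_y M e x - frame_y M e y) ^+ 2.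
Proof.
rewrite enorm_sqr /= /frame_x /frame_y.
have -> : (x.1 - y.1) ^+ 2 + (x.2 - y.2) ^+ 2 =
  ((x.1 - y.1) ^+ 2 + (x.2 - y.2) ^+ 2) * (e.1 ^+ 2 + e.2 ^+ 2) by rewrite e1 mulr1.
by ring.
Qed.

Lemma arc_pt_frame w : frame_x M e (arc_pt M e l cg sg w) = arc_x l cg sg w /\
  frame_y M e (arc_pt M e l cg sg w) = arc_y l cg w.
Proof.
rewrite /frame_x /frame_y /=; split.
  by rewrite -[RHS]mulr1 -e1; ring.
by rewrite -[RHS]mulr1 -e1; ring.
Qed.

Let den_gt0 w : 0 < w -> 0 < quartic cg 1 w.
Proof. exact: quartic_gt0. Qed.

Let sgE : sg ^+ 2 = 1 - cg ^+ 2. Proof. by rewrite -g1; ring. Qed.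

Let quartic1E k w : quartic k 1 w = w ^+ 4 - 2 * k * w ^+ 2 + 1.
Proof. by rewrite /quartic; ring. Qed.

Let end_dist w (s : R) : 0 < w -> s ^+ 2 = 1 ->
  arc_x l cg sg w ^+ 2 + (arc_y l cg w - s * l) ^+ 2 =
  4 * l ^+ 2 * ((1 + w ^+ 4) - s * (1 - w ^+ 4)) / 2 / quartic cg 1 w.
Proof.
move=> w0 s1; have d0 := den_gt0 w0; rewrite /arc_x /arc_y.
set q := quartic cg 1 w; rewrite -/q in d0.
have qE : q = w ^+ 4 - 2 * cg * w ^+ 2 + 1 by exact: quartic1E.
transitivity (((- 2 * l * w ^+ 2 * sg) ^+ 2 +
  (l * (1 - w ^+ 4) - s * l * q) ^+ 2) / q ^+ 2); first by field; rewrite gt_eqF.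
transitivity (2 * l ^+ 2 * ((1 + w ^+ 4) - s * (1 - w ^+ 4)) * q / q ^+ 2);
    last by field; rewrite gt_eqF.
congr (_ / _); rewrite qE.
by ring: (sgE) (s1).
Qed.

Lemma arc_pt_param w : 0 < w -> arc_param M e l (arc_pt M e l cg sg w) = w.
Proof.
move=> w0; have [Ex Ey] := arc_pt_frame w; rewrite /arc_param Ex Ey.
have d0 := den_gt0 w0.
have := end_dist w0 (expr1n _ 2); rewrite mul1r => ->.
have N1 : (- 1 : R) ^+ 2 = 1 by rewrite sqrrN expr1n.
have := end_dist w0 N1; rewrite mulN1r opprK => ->.
rewrite (_ : _ / _ = (w ^+ 2) ^+ 2).
  by rewrite sqrtr_sqr ger0_norm ?sqr_ge0// sqrtr_sqr ger0_norm// ltW.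
have -> : 1 + w ^+ 4 - 1 * (1 - w ^+ 4) = 2 * w ^+ 4 by ring.
have -> : 1 + w ^+ 4 - -1 * (1 - w ^+ 4) = 2 by ring.
by field; rewrite !gt_eqF.
Qed.

Lemma arc_param_pt y : arc M e l cg sg y ->
  0 < arc_param M e l y /\ arc_pt M e l cg sg (arc_param M e l y) = y.
Proof.
move=> [eqy sX _].
set X := frame_x M e y in eqy sX; set Z := frame_y M e y in eqy.
pose N := X ^+ 2 + (Z + l) ^+ 2; pose N' := X ^+ 2 + (Z - l) ^+ 2.
have X0 : X != 0 by apply/eqP => X0; rewrite X0 mulr0 ltxx in sX.
have X2 : 0 < X ^+ 2 by rewrite exprn_even_gt0.
have N0 : 0 < N by rewrite ltr_wpDr ?sqr_ge0.
pose z := - 2 * l * (sg * X) / (sg ^+ 2 * N).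
have s2 : 0 < sg ^+ 2 by rewrite exprn_even_gt0.
have z0 : 0 < z.
  apply: divr_gt0; last exact: mulr_gt0.
  by have : 0 < l * - (sg * X) by [rewrite mulr_gt0 ?oppr_gt0]; lra.
have NN : sg ^+ 2 * (N * N') = 4 * l ^+ 2 * X ^+ 2.
  transitivity ((sg * (X ^+ 2 + Z ^+ 2 - l ^+ 2)) ^+ 2 +
    sg ^+ 2 * (4 * l ^+ 2 * X ^+ 2));
    first by rewrite /N /N'; ring.
  have -> : sg * (X ^+ 2 + Z ^+ 2 - l ^+ 2) = - (2 * l * cg * X).
    by apply/eqP; rewrite -subr_eq0 opprK eqy.
  by ring: (sgE).
have z2 : N' / N = z ^+ 2.
  transitivity (sg ^+ 2 * (N * N') / (sg * N) ^+ 2).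
    by field; rewrite gt_eqF.
  by rewrite NN /z; field; rewrite gt_eqF.
have W2 : arc_param M e l y ^+ 2 = z.
  by rewrite /arc_param -/X -/Z -/N -/N' z2 sqrtr_sqr gtr0_norm// sqr_sqrtr// ltW.
have W0 : 0 < arc_param M e l y.
  by rewrite lt_neqAle sqrtr_ge0 andbT eq_sym -sqrf_eq0 W2 gt_eqF.
split=> //; set w := arc_param M e l y in W2 W0 *.
have w4 : w ^+ 4 = z ^+ 2 by rewrite -W2; ring.
have q0 : quartic cg 1 w = 4 * l ^+ 2 / N.
  rewrite quartic1E w4 W2 -z2 /z.
  apply: (mulIf (lt0r_neq0 s2)); apply: (mulIf (lt0r_neq0 N0)).
  transitivity (sg * (sg * N' + sg * N + 4 * l * cg * X)).
    by field; rewrite sg0 gt_eqF.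
  transitivity (sg * (4 * l ^+ 2 * sg));
    last by field; rewrite gt_eqF.
  congr (_ * _).
  transitivity (2 * (sg * (X ^+ 2 + Z ^+ 2 - l ^+ 2) + 2 * l * cg * X) +
    4 * l ^+ 2 * sg);
    first by rewrite /N /N'; ring.
  by rewrite eqy mulr0 add0r.
have xE : arc_x l cg sg w = X.
  by rewrite /arc_x q0 W2 /z; field; rewrite sg0 !gt_eqF.
have yE : arc_y l cg w = Z.
  rewrite /arc_y q0 w4 -z2; transitivity ((N - N') / (4 * l)).
    by field; rewrite !gt_eqF.
  by rewrite /N /N'; field; rewrite gt_eqF.
rewrite /arc_pt xE yE [RHS]surjective_pairing /X /Z /frame_x /frame_y.
congr (_, _).
- by rewrite -[y.1 in RHS](subrK M.1) -[y.1 - M.1 in RHS]mulr1 -e1; ring.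
- by rewrite -[y.2 in RHS](subrK M.2) -[y.2 - M.2 in RHS]mulr1 -e1; ring.
Qed.

Lemma arc_weight_pt w : 0 < w ->
  arc_weight M e l (arc_pt M e l cg sg w) = (w + w^-1) / 2.
Proof. by move=> w0; rewrite /arc_weight arc_pt_param. Qed.

End frame.

(** Distances between points on any two arcs through the same end points are governed by one quartic
    in the parameters. *)
Lemma arc_dist M e l cg sg cg' sg' v w : e.1 ^+ 2 + e.2 ^+ 2 = 1 ->
  cg ^+ 2 + sg ^+ 2 = 1 -> sg != 0 -> cg' ^+ 2 + sg' ^+ 2 = 1 -> sg' != 0 ->
  0 < v -> 0 < w ->
  enorm (arc_pt M e l cg sg v - arc_pt M e l cg' sg' w) ^+ 2 =
  4 * l ^+ 2 * quartic (cg * cg' + sg * sg') w v /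
    (quartic cg 1 v * quartic cg' 1 w).
Proof.
move=> e1 g1 s0 g1' s0' v0 w0.
have d0 := quartic_gt0 (arc_cos_bounds g1 s0) ltr01 v0.
have d0' := quartic_gt0 (arc_cos_bounds g1' s0') ltr01 w0.
rewrite (enorm_frame M e1).
have [-> ->] := arc_pt_frame M l cg sg e1 v.
have [-> ->] := arc_pt_frame M l cg' sg' e1 w.
rewrite /arc_x /arc_y; set q := quartic cg 1 v; set q' := quartic cg' 1 w.
rewrite -/q -/q' in d0 d0'.
have sE : sg ^+ 2 = 1 - cg ^+ 2 by rewrite -g1; ring.
have sE' : sg' ^+ 2 = 1 - cg' ^+ 2 by rewrite -g1'; ring.
transitivity (((- 2 * l * v ^+ 2 * sg * q' + 2 * l * w ^+ 2 * sg' * q) ^+ 2 +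
  (l * (1 - v ^+ 4) * q' - l * (1 - w ^+ 4) * q) ^+ 2) / (q * q') ^+ 2).
  by field; rewrite !gt_eqF.
transitivity (4 * l ^+ 2 * quartic (cg * cg' + sg * sg') w v * (q * q') /
  (q * q') ^+ 2);
    last by field; rewrite !gt_eqF.
congr (_ / _); rewrite /q /q' /quartic.
by ring: (sE) (sE').
Qed.

Lemma quartic_continuous (k rho : R) : continuous (quartic k rho).
Proof.
move=> w; apply: cvgD; last exact: cvg_cst.
apply: cvgB; first exact: exprn_continuous.
by apply: cvgM; [exact: cvg_cst|exact: exprn_continuous].
Qed.

Lemma arc_pt_lipschitz M e l cg sg w (eps : R) : e.1 ^+ 2 + e.2 ^+ 2 = 1 ->
  0 < l -> cg ^+ 2 + sg ^+ 2 = 1 -> sg != 0 -> 0 < w -> 0 < eps ->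
  exists2 d, 0 < d & forall x y : R, w - d < x < w + d -> w - d < y < w + d ->
    enorm (arc_pt M e l cg sg x - arc_pt M e l cg sg y) <=
    (arc_speed l cg w + eps) * `|x - y|.
Proof.
move=> e1 l0 g1 s0 w0 eps0.
have cb := arc_cos_bounds g1 s0.
have q0 (x : R) : 0 < x -> 0 < quartic cg 1 x by move=> x0; exact: quartic_gt0.
set D := (quartic cg 1 w)^-1; have D0 : 0 < D by rewrite invr_gt0 q0.
pose eta := Num.min w (Num.min 1 (eps / (4 * l * (w + D + 1)))).
have wD : 0 < w + D + 1 by lra.
have eta0 : 0 < eta by rewrite !lt_min w0 ltr01 !divr_gt0// mulr_gt0// mulr_gt0.
have eta_w : eta <= w by rewrite ge_min lexx.
have eta1 : eta <= 1 by rewrite !ge_min lexx orbT.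
have etaE : 4 * l * ((w + eta) * (D + eta)) <= 4 * l * w * D + eps.
  have : eta * (4 * l * (w + D + 1)) <= eps.
    by rewrite -ler_pdivlMr ?mulr_gt0// !ge_min lexx !orbT.
  have : l * (eta * eta) <= l * eta by rewrite ler_wpM2l ?ler_piMl// ltW.
  by lra.
have : {for w, continuous (fun x : R => (quartic cg 1 x)^-1)}.
  by apply: cvgV; [rewrite gt_eqF// q0|exact: quartic_continuous].
move=> /cvgrPdist_lt/(_ _ eta0)/nbhs_ballP[d1 /= d10 cD].
exists (Num.min d1 eta); first by rewrite lt_min d10.
have near (x : R) : w - Num.min d1 eta < x < w + Num.min d1 eta ->
    [/\ 0 < x, x <= w + eta & (quartic cg 1 x)^-1 <= D + eta].
  have m1 : Num.min d1 eta <= d1 by rewrite ge_min lexx.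
  have m2 : Num.min d1 eta <= eta by rewrite ge_min lexx orbT.
  move=> /andP[h1 h2]; split; [lra|lra|].
  have : ball w d1 x by rewrite /ball/= ltr_norml; apply/andP; split; lra.
  by move=> /cD/=; rewrite -/D ltr_norml => /andP[? ?]; lra.
move=> x y /near[x0 xw Dx] /near[y0 yw Dy].
have qx := q0 x x0; have qy := q0 y y0.
have Jge : 0 <= arc_speed l cg w + eps.
  by rewrite addr_ge0 ?divr_ge0 ?mulr_ge0 ?ltW// q0.
rewrite -(@ler_pXn2r _ 2) ?nnegrE ?mulr_ge0 ?sqrtr_ge0//.
rewrite arc_dist//.
have -> : quartic (cg * cg + sg * sg) y x = ((x - y) * (x + y)) ^+ 2.
  by rewrite -!expr2 g1 /quartic; ring.
set a := (quartic cg 1 x)^-1 in Dx; set b := (quartic cg 1 y)^-1 in Dy.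
have a0 : 0 < a by rewrite invr_gt0.
have b0 : 0 < b by rewrite invr_gt0.
rewrite invfM -/a -/b [leRHS]exprMn real_normK ?num_real// [leRHS]mulrC.
have -> : 4 * l ^+ 2 * ((x - y) * (x + y)) ^+ 2 * (a * b) =
  (x - y) ^+ 2 * (4 * l ^+ 2 * (x + y) ^+ 2 * (a * b)) by ring.
rewrite ler_wpM2l ?sqr_ge0//.
apply: (@le_trans _ _ ((4 * l * ((w + eta) * (D + eta))) ^+ 2)).
  have -> : 4 * l ^+ 2 * (x + y) ^+ 2 * (a * b) =
    (4 * l) ^+ 2 * (((x + y) / 2) ^+ 2 * (a * b)) by field.
  rewrite [leRHS]exprMn ler_wpM2l ?sqr_ge0// [leRHS]exprMn.
  apply: ler_pM; [exact: sqr_ge0|by rewrite mulr_ge0// ltW| |].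
    by rewrite ler_sqr ?nnegrE; lra.
  by rewrite expr2 ler_pM// ltW.
have h0 : 0 <= 4 * l * ((w + eta) * (D + eta)).
  by rewrite mulr_ge0 ?mulr_ge0 ?addr_ge0 ?ltW.
by rewrite ler_sqr ?nnegrE.
Qed.

End arcs.

(** * Poisson integrals over arcs *)

Lemma measurable_funV d (T : measurableType d) (R : realType) (D : set T)
    (f : T -> R) : measurable_fun D f -> measurable_fun D (fun x => (f x)^-1).
Proof.
move=> mf; rewrite (_ : (fun x => (f x)^-1) = (fun x => f x * (`|f x| `^ (- 2)))).
  apply: measurable_funM => //.
  apply: (measurableT_comp (measurable_powR (- 2))).
  exact: (measurableT_comp (@normr_measurable R setT)).
apply/funext => x; have [->|fx0] := eqVneq (f x) 0; first by rewrite invr0 mul0r.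
by rewrite powRN powR_mulrn// real_normK ?num_real// expr2 invfM mulrA mulfV ?mul1r.
Qed.

Lemma measurable_fun_sqrt d (T : measurableType d) (R : realType) (D : set T)
    (f : T -> R) : measurable_fun D f ->
  measurable_fun D (fun x => Num.sqrt (f x)).
Proof.
have ms : measurable_fun [set: R] (@Num.sqrt R).
  by apply: continuous_measurable_fun; exact: sqrt_continuous.
exact: (measurableT_comp ms).
Qed.

Section poisson_arc.
Context {R : realType}.
Local Notation plane := (R * R)%type.
Implicit Types (M e x y c : plane) (l cg sg w r h : R).

(** The Poisson kernel inside the circle; the absolute value makes it nonnegative everywhere. *)
Definition pker c r x y : R :=
  `|r ^+ 2 - enorm (x - c) ^+ 2| / (r * enorm (x - y) ^+ 2) / (2 * pi).

Lemma pker_ge0 c r x y : 0 <= r -> 0 <= pker c r x y.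
Proof.
by move=> r0; rewrite /pker !divr_ge0// mulr_ge0 ?pi_ge0// sqr_ge0.
Qed.

Section measurability.
Context d (T : measurableType d) (D : set T).

Lemma measurable_enorm2 (f g : T -> plane) :
  measurable_fun D f -> measurable_fun D g ->
  measurable_fun D (fun t => enorm (f t - g t) ^+ 2).
Proof.
move=> mf mg; rewrite (_ : (fun t => _) =
  (fun t => ((f t).1 - (g t).1) ^+ 2 + ((f t).2 - (g t).2) ^+ 2)).
  by apply: measurable_funD; apply: measurable_funX; apply: measurable_funB;
    apply: measurableT_comp.
by apply/funext => t; rewrite enorm_sqr.
Qed.

Lemma measurable_pker c r (f g : T -> plane) :
  measurable_fun D f -> measurable_fun D g ->
  measurable_fun D (fun t => pker c r (f t) (g t)).
Proof.
move=> mf mg; apply: measurable_funM => //; apply: measurable_funM.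
  apply: measurableT_comp => //; apply: measurable_funB => //.
  exact: measurable_enorm2.
apply: measurable_funV; apply: measurable_funM => //; exact: measurable_enorm2.
Qed.

Lemma measurable_frame_x M e (f : T -> plane) : measurable_fun D f ->
  measurable_fun D (fun t => frame_x M e (f t)).
Proof.
by move=> mf; apply: measurable_funD; apply: measurable_funM => //;
  apply: measurable_funB => //; apply: measurableT_comp.
Qed.

Lemma measurable_frame_y M e (f : T -> plane) : measurable_fun D f ->
  measurable_fun D (fun t => frame_y M e (f t)).
Proof.
by move=> mf; apply: measurable_funB; apply: measurable_funM => //;
  apply: measurable_funB => //; apply: measurableT_comp.
Qed.

Lemma measurable_arc_param M e l (f : T -> plane) : measurable_fun D f ->
  measurable_fun D (fun t => arc_param M e l (f t)).
Proof.
move=> mf; apply: measurable_fun_sqrt; apply: measurable_fun_sqrt.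
have mx := measurable_frame_x M e mf; have my := measurable_frame_y M e mf.
apply: measurable_funM; last apply: measurable_funV;
  apply: measurable_funD; apply: measurable_funX => //.
  exact: measurable_funB.
exact: measurable_funD.
Qed.

Lemma measurable_arc_weight M e l (f : T -> plane) : measurable_fun D f ->
  measurable_fun D (fun t => arc_weight M e l (f t)).
Proof.
move=> mf; apply: measurable_funM => //; apply: measurable_funD.
  exact: measurable_arc_param.
by apply: measurable_funV; exact: measurable_arc_param.
Qed.

End measurability.

Lemma measurable_arc M e l cg sg : measurable (arc M e l cg sg).
Proof.
have mx := measurable_frame_x M e (@measurable_id _ plane setT).
have my := measurable_frame_y M e (@measurable_id _ plane setT).
have mw := measurable_arc_param M e l (@measurable_id _ plane setT).
pose f x := sg * (frame_x M e x ^+ 2 + frame_y M e x ^+ 2 - l ^+ 2) +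
                 2 * l * cg * frame_x M e x.
have mf : measurable_fun [set: plane] f.
  apply: measurable_funD; apply: measurable_funM => //.
  by apply: measurable_funB => //; apply: measurable_funD; exact: measurable_funX.
pose g x := sg * frame_x M e x.
have mg : measurable_fun [set: plane] g by exact: measurable_funM.
rewrite (_ : arc M e l cg sg = f @^-1` [set 0] `&`
  (g @^-1` [set x | x < 0] `&` (arc_param M e l @^-1` (~` [set 1])))).
  apply: measurableI; first by rewrite -[X in measurable X]setTI; exact: mf.
  apply: measurableI; rewrite -[X in measurable X]setTI.
    apply: mg => //.
    rewrite (_ : [set x | x < 0] = `]-oo, 0[%classic); first exact: measurable_itv.
    by apply/seteqP; split => t /=; rewrite in_itv.
  by apply: mw => //; exact: measurableC.
apply/seteqP; split => y /=.
  by move=> [h1 h2 /eqP h3].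
by move=> [h1 [h2 /eqP h3]].
Qed.

Lemma arc_weight_ge0 M e l y : 0 <= arc_weight M e l y.
Proof. by rewrite divr_ge0// addr_ge0// ?invr_ge0 sqrtr_ge0. Qed.

Lemma continuous_eq_pos (f g : R -> R) w : 0 < w ->
  (forall x : R, 0 < x -> f x = g x) -> {for w, continuous g} -> {for w, continuous f}.
Proof.
move=> w0 fg; rewrite /prop_for /continuous_at fg//; apply: cvg_trans.
apply: near_eq_cvg; near=> x; rewrite fg//.
by near: x; exact: lt_nbhsr.
Unshelve. all: by end_near. Qed.

End poisson_arc.

Section poisson_arc_integrals.
Context {R : realType}.
Local Notation plane := (R * R)%type.
Variables (M e : plane) (l h r cg sg cg' sg' : R).
Hypothesis e1 : e.1 ^+ 2 + e.2 ^+ 2 = 1.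
Hypothesis l0 : 0 < l.
Hypothesis g1 : cg ^+ 2 + sg ^+ 2 = 1.
Hypothesis s0 : sg != 0.
Hypothesis g1' : cg' ^+ 2 + sg' ^+ 2 = 1.
Hypothesis s0' : sg' != 0.
Hypothesis rl : r ^+ 2 = h ^+ 2 + l ^+ 2.
Hypothesis r0 : 0 < r.
Hypothesis hE : h * sg' = - (l * cg').
Hypothesis rE : r * `|sg'| = l.

Let c : plane := (M.1 + h * e.1, M.2 + h * e.2).
Let k := cg * cg' + sg * sg'.
Let S := `|sg * cg' - cg * sg'|.
Hypothesis S0 : 0 < S.

Let kS : k ^+ 2 + S ^+ 2 = 1.
Proof.
have sE : sg ^+ 2 = 1 - cg ^+ 2 by rewrite -g1; ring.
have sE' : sg' ^+ 2 = 1 - cg' ^+ 2 by rewrite -g1'; ring.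
by rewrite /S real_normK ?num_real// /k; ring: (sE) (sE').
Qed.

Let kb : -1 < k < 1.
Proof.
have : 0 < S ^+ 2 by rewrite exprn_gt0.
by move: kS; move=> *; apply/andP; split; nra.
Qed.

Let qg x : 0 < x -> 0 < quartic cg 1 x.
Proof. by apply: quartic_gt0 => //; exact: arc_cos_bounds s0. Qed.

Let qg' x : 0 < x -> 0 < quartic cg' 1 x.
Proof. by apply: quartic_gt0 => //; exact: arc_cos_bounds s0'. Qed.

Let power_arc v : 0 < v ->
  r ^+ 2 - enorm (arc_pt M e l cg sg v - c) ^+ 2 =
  - (4 * l * v ^+ 2 / quartic cg 1 v * (l * cg + h * sg)).
Proof.
move=> v0; rewrite (enorm_frame M e1).
have [-> ->] := arc_pt_frame M l cg sg e1 v.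
have -> : frame_x M e c = h.
  by rewrite /frame_x /c /= -[RHS]mulr1 -e1; ring.
have -> : frame_y M e c = 0 by rewrite /frame_y /c /=; ring.
have q0 := qg v0; rewrite rl /arc_x /arc_y.
set q := quartic cg 1 v; rewrite -/q in q0.
transitivity ((l ^+ 2 * q ^+ 2 - (- 2 * l * v ^+ 2 * sg) ^+ 2 -
  (l * (1 - v ^+ 4)) ^+ 2 + 2 * h * (- 2 * l * v ^+ 2 * sg) * q) / q ^+ 2).
  by field; rewrite gt_eqF.
transitivity (- (4 * l * v ^+ 2 * q * (l * cg + h * sg)) / q ^+ 2); last first.
  by field; rewrite gt_eqF.
congr (_ / _).
have sE : sg ^+ 2 = 1 - cg ^+ 2 by rewrite -g1; ring.
by rewrite /q /quartic; ring: (sE).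
Qed.

(** Numerator and denominator of the kernel share the quartic of [v]. *)
Lemma pker_arc v w : 0 < v -> 0 < w ->
  pker c r (arc_pt M e l cg sg v) (arc_pt M e l cg' sg' w) =
  v ^+ 2 * S * quartic cg' 1 w / (2 * pi * l * quartic k w v).
Proof.
move=> v0 w0; rewrite /pker power_arc// arc_dist// -/k.
have q0 := qg v0; have q0' := qg' w0.
have qk : 0 < quartic k w v by exact: quartic_gt0.
have sn : 0 < `|sg'| by rewrite normr_gt0.
have -> : `|- (4 * l * v ^+ 2 / quartic cg 1 v * (l * cg + h * sg))| =
    4 * l * v ^+ 2 / quartic cg 1 v * (l * S / `|sg'|).
  rewrite normrN normrM ger0_norm; last first.
    by rewrite divr_ge0 ?mulr_ge0 ?sqr_ge0 ?ltW.
  congr (_ * _).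
  have -> : l * cg + h * sg = - (l * (sg * cg' - cg * sg') / sg').
    rewrite (_ : h = - (l * cg') / sg'); last by rewrite -hE mulfK.
    by field.
  by rewrite normrN !normrM normfV (gtr0_norm l0).
have rE' : r = l / `|sg'| by rewrite -rE mulfK ?gt_eqF.
rewrite rE'; move: (pi_gt0 R); set P := (pi : R); clearbody P => P0.
by field; rewrite !gt_eqF.
Qed.

Let mid := arc_weight M e l.

(** Along the arc the kernel times the weight times the speed is a multiple of [(w ^+ 2 + 1) / quartic],
    so that the weight is reproduced exactly up to a factor. *)
Lemma poisson_row v : 0 < v ->
  (\int[hausdorff1]_(y in arc M e l cg' sg')
     (pker c r (arc_pt M e l cg sg v) y * mid y)%:E <=
   (Num.sqrt ((1 + k) / 2) * mid (arc_pt M e l cg sg v))%:E)%E.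
Proof.
move=> v0; set x := arc_pt M e l cg sg v.
have /andP[k1 k2] := kb.
pose A := v ^+ 2 * S / pi.
pose F y := pker c r x y * mid y.
pose g w : R := v ^+ 2 * S * quartic cg' 1 w / (2 * pi * l * quartic k v w) *
  ((w + w^-1) / 2).
have FE w : 0 < w -> F (arc_pt M e l cg' sg' w) = g w.
  move=> w0; rewrite /F pker_arc// /mid arc_weight_pt// /g.
  by congr (_ / (_ * _) * _); rewrite /quartic; ring.
have [c1 c0] := quartic_prim_cvg 1 1 kb v0.
have -> : Num.sqrt ((1 + k) / 2) * mid x =
    A * (quartic_total 1 1 k v / 2) - A * - (quartic_total 1 1 k v / 2).
  rewrite /mid arc_weight_pt// /quartic_total /A.
  have K0 : 0 < Num.sqrt (2 - 2 * k) by rewrite sqrtr_gt0; lra.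
  have -> : Num.sqrt ((1 + k) / 2) = S / Num.sqrt (2 - 2 * k).
    have K2 : Num.sqrt (2 - 2 * k) ^+ 2 = 2 - 2 * k by rewrite sqr_sqrtr//; lra.
    have k2' : Num.sqrt ((1 + k) / 2) ^+ 2 = (1 + k) / 2 by rewrite sqr_sqrtr//; lra.
    apply/eqP; rewrite -(@eqrXn2 _ 2) ?divr_ge0 ?sqrtr_ge0 ?(ltW S0)//.
    rewrite expr_div_n K2 k2' eqr_div; [|by []|by rewrite gt_eqF//; lra].
    by have -> : S ^+ 2 = 1 - k ^+ 2 by [rewrite -kS; ring]; apply/eqP; ring.
  move: (pi_gt0 R); set P := (pi : R); clearbody P => P0.
  by field; rewrite !gt_eqF.
apply: (@curve_integral_le _ _ (arc_param M e l) (arc_pt M e l cg' sg') F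
  (A \*: quartic_prim 1 1 k v) (arc_speed l cg')).
- exact: measurable_arc.
- exact: (measurable_arc_param M e l (@measurable_id _ plane setT)).
- apply: measurable_funM.
    by apply: measurable_pker; [exact: measurable_cst|exact: measurable_id].
  exact: (measurable_arc_weight M e l (@measurable_id _ plane setT)).
- by move=> y; rewrite mulr_ge0 ?pker_ge0 ?arc_weight_ge0 ?ltW.
- by move=> y; exact: arc_param_pt.
- move=> w w0; apply: (continuous_eq_pos (g := g)) => //.
  apply: continuousM.
    apply: continuousM.
      by apply: continuousM; [exact: cst_continuous|exact: quartic_continuous].
    apply: continuousV; first by rewrite !mulf_neq0// ?gt_eqF ?pi_gt0// quartic_gt0.
    by apply: continuousM; [exact: cst_continuous|exact: quartic_continuous].
  apply: continuousM; last exact: cst_continuous.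
  apply: continuousD => //; apply: continuousV => //; by rewrite gt_eqF.
- by move=> w w0; rewrite divr_ge0 ?mulr_ge0 ?ltW// qg'.
- by move=> w eps w0 e0; exact: arc_pt_lipschitz.
- move=> w w0; have dd := is_deriveZ A (is_derive_quartic_prim 1 1 kb v0 w0).
  apply: is_derive_eq dd _; rewrite FE// /g /arc_speed /A /GRing.scale/=.
  have qk : 0 < quartic k v w by exact: quartic_gt0.
  have q0' := qg' w0.
  move: (pi_gt0 R); set P := (pi : R); clearbody P => P0.
  by field; rewrite !gt_eqF.
- by rewrite /GRing.scale/=; apply: cvgMl_tmp.
- by rewrite /GRing.scale/=; apply: cvgMl_tmp.
Qed.

(** The kernel and the speed bring two different quartics; their partial
    fraction decomposition has a pole only when both coincide, which needs
    [w = 1]. *)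
Lemma poisson_col (gg y sig C : R) w : 0 < gg -> 0 < y -> k = 1 - 2 * gg ^+ 2 ->
  cg = 1 - 2 * y ^+ 2 -> cg' = 2 * sig ^+ 2 - 1 -> 0 < w -> w != 1 ->
  C = (w + w^-1) / 2 ->
  (\int[hausdorff1]_(x in arc M e l cg sg)
     (pker c r x (arc_pt M e l cg' sg' w) * mid x)%:E <=
   (S / (2 * gg) * (C ^+ 2 - sig ^+ 2) * (C + gg / y) /
     (C ^+ 2 + 2 * C * gg * y + gg ^+ 2 + y ^+ 2 - 1))%:E)%E.
Proof.
move=> gg0 y0 kE cgE cgE' w0 w1 CE; set z := arc_pt M e l cg' sg' w.
have /andP[k1 k2] := kb.
have cgb := arc_cos_bounds g1 s0; have /andP[cg1 cg2] := cgb.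
have q0' := qg' w0.
pose F x := pker c r x z * mid x.
pose g v : R := v ^+ 2 * S * quartic cg' 1 w / (2 * pi * l * quartic k w v) *
  ((v + v^-1) / 2).
have FE v : 0 < v -> F (arc_pt M e l cg sg v) = g v.
  by move=> v0; rewrite /F pker_arc// /mid arc_weight_pt.
pose b := w ^+ 4; pose a := - 2 * k * w ^+ 2; pose c2 := - 2 * cg.
pose res := (b - 1) ^+ 2 + (a - c2) * (a - b * c2).
have res0 : 0 < res.
  have E2 : 2 * w ^+ 2 < w ^+ 4 + 1.
    rewrite -subr_gt0 (_ : _ - _ = ((w - 1) * (w + 1)) ^+ 2); last by ring.
    by rewrite exprn_even_gt0//= mulf_neq0 ?subr_eq0// gt_eqF//; lra.
  have w2 : 0 < w ^+ 2 by rewrite exprn_gt0.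
  have -> : res = (w ^+ 4 + 1 - 2 * k * cg * w ^+ 2) ^+ 2 -
      (2 * w ^+ 2) ^+ 2 * ((1 - k ^+ 2) * (1 - cg ^+ 2)).
    by rewrite /res /a /b /c2; ring.
  have h1 : 0 < 1 - k * cg by nra.
  have h2 : (1 - k ^+ 2) * (1 - cg ^+ 2) <= (1 - k * cg) ^+ 2.
    rewrite -subr_ge0 (_ : _ - _ = (k - cg) ^+ 2) ?sqr_ge0//; ring.
  have h3 : 2 * w ^+ 2 * (1 - k * cg) < w ^+ 4 + 1 - 2 * k * cg * w ^+ 2 by lra.
  rewrite subr_gt0; apply: (@le_lt_trans _ _ ((2 * w ^+ 2 * (1 - k * cg)) ^+ 2)).
    by rewrite [leRHS]exprMn ler_wpM2l ?sqr_ge0.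
  have h4 : 0 < 2 * w ^+ 2 * (1 - k * cg) by rewrite mulr_gt0// mulr_gt0.
  by rewrite ltr_sqr ?nnegrE ?(ltW h4)// ltW// (lt_trans h4).
pose al := (1 - b - a + b * c2) / res; pose be' := (1 - b - c2 + a) / res.
pose be := - b * be'.
have pfrac v : 0 < v -> (al * v ^+ 2 + be) / quartic k w v +
    (- al * v ^+ 2 + be') / quartic cg 1 v =
    v ^+ 2 * (v ^+ 2 + 1) / (quartic k w v * quartic cg 1 v).
  move=> v0; have q1 : 0 < quartic k w v by exact: quartic_gt0.
  have q2 := qg v0.
  transitivity (((al * v ^+ 2 + be) * quartic cg 1 v +
    (- al * v ^+ 2 + be') * quartic k w v) / (quartic k w v * quartic cg 1 v)).
    by field; rewrite !gt_eqF.
  congr (_ / _).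
  have qE1 : quartic k w v = v ^+ 4 + a * v ^+ 2 + b by rewrite /quartic /a /b; ring.
  have qE2 : quartic cg 1 v = v ^+ 4 + c2 * v ^+ 2 + 1 by rewrite /quartic /c2; ring.
  rewrite qE1 qE2 /be /al /be'.
  transitivity (v ^+ 2 * (v ^+ 2 + 1) * res / res); last by rewrite mulfK ?gt_eqF.
  transitivity ((((1 - b - a + b * c2) * v ^+ 2 - b * (1 - b - c2 + a)) *
    (v ^+ 4 + c2 * v ^+ 2 + 1) +
    (- (1 - b - a + b * c2) * v ^+ 2 + (1 - b - c2 + a)) *
    (v ^+ 4 + a * v ^+ 2 + b)) / res); first by ring.
  by congr (_ / _); rewrite /res; ring.
pose A := quartic cg' 1 w * S / pi.
have [p1 p0] := quartic_prim_cvg al be kb w0.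
have [p1' p0'] := quartic_prim_cvg (- al) be' cgb (@ltr01 R).
set T := quartic_total al be k w in p1 p0.
set T' := quartic_total (- al) be' cg 1 in p1' p0'.
pose Phi := A \*: (quartic_prim al be k w + quartic_prim (- al) be' cg 1).
have tot : A * (T / 2 + T' / 2) - A * (- (T / 2) + - (T' / 2)) =
    S / (2 * gg) * (C ^+ 2 - sig ^+ 2) * (C + gg / y) /
     (C ^+ 2 + 2 * C * gg * y + gg ^+ 2 + y ^+ 2 - 1).
  have K1 : Num.sqrt (2 - 2 * k) = 2 * gg.
    rewrite kE (_ : _ - _ = (2 * gg) ^+ 2); last by ring.
    by rewrite sqrtr_sqr ger0_norm// mulr_ge0// ltW.
  have K2 : Num.sqrt (2 - 2 * cg) = 2 * y.
    rewrite cgE (_ : _ - _ = (2 * y) ^+ 2); last by ring.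
    by rewrite sqrtr_sqr ger0_norm// mulr_ge0// ltW.
  have C1 : 1 <= C.
    rewrite CE -subr_ge0 (_ : _ - 1 = (w - 1) ^+ 2 / (2 * w)).
      by rewrite divr_ge0 ?sqr_ge0// mulr_ge0// ltW.
    by field; rewrite gt_eqF.
  have D0 : 0 < C ^+ 2 + 2 * C * gg * y + gg ^+ 2 + y ^+ 2 - 1.
    have : 0 < C * gg * y by rewrite !mulr_gt0//; lra.
    have := sqr_ge0 gg; have := sqr_ge0 y.
    by nra.
  rewrite /T /T' /quartic_total K1 K2 /A /be /al /be'.
  have q' : quartic cg' 1 w = 4 * w ^+ 2 * (C ^+ 2 - sig ^+ 2).
    by rewrite /quartic cgE' CE; field; rewrite gt_eqF.
  rewrite q' /b /a /c2.
  move: res0; rewrite /res /b /a /c2 kE cgE => res0.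
  move: (pi_gt0 R); set P := (pi : R); clearbody P => P0.
  move: D0; rewrite CE => D0.
  have D1 : 0 < (w ^+ 2 + 1) ^+ 2 + 4 * (w ^+ 2 + 1) * w * gg * y +
      4 * w ^+ 2 * (gg ^+ 2 + y ^+ 2 - 1).
    have -> : (w ^+ 2 + 1) ^+ 2 + 4 * (w ^+ 2 + 1) * w * gg * y +
      4 * w ^+ 2 * (gg ^+ 2 + y ^+ 2 - 1) = 4 * w ^+ 2 * (((w + w^-1) / 2) ^+ 2 +
        2 * ((w + w^-1) / 2) * gg * y + gg ^+ 2 + y ^+ 2 - 1).
      by field; rewrite gt_eqF.
    by rewrite mulr_gt0// mulr_gt0// exprn_gt0.
  have key : (w ^+ 4 - 1) ^+ 2 +
      (- 2 * (1 - 2 * gg ^+ 2) * w ^+ 2 - - 2 * (1 - 2 * y ^+ 2)) *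
      (- 2 * (1 - 2 * gg ^+ 2) * w ^+ 2 - w ^+ 4 * (- 2 * (1 - 2 * y ^+ 2))) != 0.
    by rewrite gt_eqF.
  by field; apply/and5P; split; rewrite ?gt_eqF//; lra.
have mono : (\int[hausdorff1]_(x in arc M e l cg sg) (F x)%:E <=
    (A * (T / 2 + T' / 2) - A * (- (T / 2) + - (T' / 2)))%:E)%E.
  apply: (@curve_integral_le _ _ (arc_param M e l) (arc_pt M e l cg sg) F
    Phi (arc_speed l cg)).
  - exact: measurable_arc.
  - exact: (measurable_arc_param M e l (@measurable_id _ plane setT)).
  - apply: measurable_funM.
      by apply: measurable_pker; [exact: measurable_id|exact: measurable_cst].
    exact: (measurable_arc_weight M e l (@measurable_id _ plane setT)).
  - by move=> x; rewrite mulr_ge0 ?pker_ge0 ?arc_weight_ge0 ?ltW.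
  - by move=> x; exact: arc_param_pt.
  - move=> v v0; apply: (continuous_eq_pos (g := g)) => //.
    apply: continuousM.
      apply: continuousM.
        apply: continuousM; last exact: cst_continuous.
        by apply: continuousM; [exact: exprn_continuous|exact: cst_continuous].
      apply: continuousV; first by rewrite !mulf_neq0// ?gt_eqF ?pi_gt0// quartic_gt0.
      by apply: continuousM; [exact: cst_continuous|exact: quartic_continuous].
    apply: continuousM; last exact: cst_continuous.
    by apply: continuousD => //; apply: continuousV => //; rewrite gt_eqF.
  - by move=> v v0; rewrite divr_ge0 ?mulr_ge0 ?ltW// qg.
  - by move=> v eps v0 e0; exact: arc_pt_lipschitz.
  - move=> v v0; have dd := is_deriveZ A (is_deriveD
      (is_derive_quartic_prim al be kb w0 v0)
      (is_derive_quartic_prim (- al) be' cgb ltr01 v0)).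
    apply: is_derive_eq dd _; rewrite FE// pfrac// /g /arc_speed /A /GRing.scale/=.
    have qk : 0 < quartic k w v by exact: quartic_gt0.
    have q0 := qg v0.
    move: (pi_gt0 R); set P := (pi : R); clearbody P => P0.
    by field; rewrite !gt_eqF.
  - by rewrite /GRing.scale/=; apply: cvgMl_tmp; exact: cvgD.
  - by rewrite /GRing.scale/=; apply: cvgMl_tmp; exact: cvgD.
by rewrite tot in mono.
Qed.

End poisson_arc_integrals.

(** * Cauchy-Schwarz and the Schur test *)

Section tonelli.
Local Open Scope ereal_scope.
Context d1 d2 (T1 : measurableType d1) (T2 : measurableType d2) (R : realType).

Lemma integral_mfrestr d (T : measurableType d) (mu : {measure set T -> \bar R})
    (D : set T) (mD : measurable D) (fD : mu D < +oo) (f : T -> \bar R) :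
  measurable_fun [set: T] f -> (forall x, 0 <= f x) ->
  \int[mfrestr mD fD]_x f x = \int[mu]_(x in D) f x.
Proof.
move=> mf f0; have mDC : measurable (~` D) by exact: measurableC.
rewrite -(setUv D) ge0_integral_setU//; last 2 first.
- by rewrite setUv.
- exact/disj_set2P/subsets_disjoint.
rewrite [X in _ + X]null_set_integral ?adde0//; last 2 first.
- exact: measurable_funTS.
- by change (mu (~` D `&` D) = 0); rewrite setICl measure0.
by apply: eq_measure_integral => A mA AD; change (mu (A `&` D) = mu A); rewrite setIidl.
Qed.

Variables (m1 : {measure set T1 -> \bar R}) (m2 : {measure set T2 -> \bar R}).
Variables (D1 : set T1) (D2 : set T2).
Hypotheses (mD1 : measurable D1) (mD2 : measurable D2).
Hypotheses (fD1 : m1 D1 < +oo) (fD2 : m2 D2 < +oo).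

Lemma measurable_section_integral (f : T1 * T2 -> \bar R) :
  measurable_fun [set: T1 * T2] f -> (forall z, 0 <= f z) ->
  measurable_fun [set: T1] (fun x => \int[m2]_(y in D2) f (x, y)).
Proof.
move=> mf f0.
have := measurable_fun_fubini_tonelli_F (m2 := mfrestr mD2 fD2) f mf f0.
apply: eq_measurable_fun => x _; rewrite /fubini_F integral_mfrestr//.
exact: (measurableT_comp mf).
Qed.

Lemma tonelli_sets (f : T1 * T2 -> \bar R) :
  measurable_fun [set: T1 * T2] f -> (forall z, 0 <= f z) ->
  \int[m1]_(x in D1) \int[m2]_(y in D2) f (x, y) =
  \int[m2]_(y in D2) \int[m1]_(x in D1) f (x, y).
Proof.
move=> mf f0.
have := fubini_tonelli (m1 := mfrestr mD1 fD1) (m2 := mfrestr mD2 fD2) f mf f0.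
have mfx x : measurable_fun [set: T2] (fun y => f (x, y)).
  exact: (measurableT_comp mf).
have mfy y : measurable_fun [set: T1] (fun x => f (x, y)).
  exact: (measurableT_comp mf).
have mF := measurable_fun_fubini_tonelli_F (m2 := mfrestr mD2 fD2) f mf f0.
have mG := measurable_fun_fubini_tonelli_G (m1 := mfrestr mD1 fD1) f mf f0.
rewrite !integral_mfrestr//; last 2 first.
- by move=> x; exact: integral_ge0.
- by move=> x; exact: integral_ge0.
move=> h; transitivity (\int[m1]_(x in D1) \int[mfrestr mD2 fD2]_y f (x, y)).
  by apply: eq_integral => x _; rewrite integral_mfrestr.
by rewrite h; apply: eq_integral => y _; rewrite integral_mfrestr.
Qed.

End tonelli.

(** The infimum over [t] of the right-hand side, without dividing by [a] or [b]. *)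
Lemma le_sqrt_amgm (R : realType) (i a b : R) : 0 <= a -> 0 <= b ->
  (forall t, 0 < t -> i <= (t * a + b / t) / 2) -> i <= Num.sqrt (a * b).
Proof.
move=> a0 b0 h; have [i0|i0] := leP i 0; first exact: le_trans i0 (sqrtr_ge0 _).
have [a0'|apos] := leP a 0.
  have aE : a = 0 by apply/eqP; rewrite eq_le a0 a0'.
  have t0 : 0 < b / i + 1 by rewrite ltr_wpDl// divr_ge0// ltW.
  have := h _ t0; rewrite aE mulr0 add0r.
  have : b / (b / i + 1) <= i.
    rewrite ler_pdivrMr// mulrDr mulr1 mulrCA divff ?gt_eqF// mulr1.
    by rewrite lerDl ltW.
  by lra.
have t0 : 0 < i / a by rewrite divr_gt0.
have := h _ t0; rewrite mulfVK ?gt_eqF// invf_div mulrA => hi.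
have : i * i <= a * b.
  rewrite -ler_pdivlMr// [a * b]mulrC; lra.
rewrite -expr2 => i2.
by rewrite -(@ler_pXn2r _ 2) ?nnegrE ?sqrtr_ge0 ?(ltW i0)// sqr_sqrtr// mulr_ge0.
Qed.

Lemma cauchy_schwarz_integral d (T : measurableType d) (R : realType)
    (mu : {measure set T -> \bar R}) (D : set T) (f g : T -> R) (a b : R) :
  measurable D -> measurable_fun D f -> measurable_fun D g ->
  (forall x, D x -> 0 <= f x) -> (forall x, D x -> 0 <= g x) -> 0 <= a -> 0 <= b ->
  (\int[mu]_(x in D) (f x ^+ 2)%:E <= a%:E)%E ->
  (\int[mu]_(x in D) (g x ^+ 2)%:E <= b%:E)%E ->
  (\int[mu]_(x in D) (f x * g x)%:E <= (Num.sqrt (a * b))%:E)%E.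
Proof.
move=> mD mf mg f0 g0 a0 b0 fa gb.
have mf2 : measurable_fun D (fun x => f x ^+ 2) by exact: measurable_funX.
have mg2 : measurable_fun D (fun x => g x ^+ 2) by exact: measurable_funX.
have key t : 0 < t -> (\int[mu]_(x in D) (f x * g x)%:E <=
    ((t * a + b / t) / 2)%:E)%E.
  move=> t0.
  have t2 : 0 <= t / 2 by rewrite divr_ge0// ltW.
  have t2' : 0 <= (2 * t)^-1 by rewrite invr_ge0 mulr_ge0// ltW.
  apply: (@le_trans _ _ (\int[mu]_(x in D)
      ((t / 2)%:E * (f x ^+ 2)%:E + (2 * t)^-1%:E * (g x ^+ 2)%:E))%E).
    apply: ge0_le_integral => //.
    - by move=> x Dx; rewrite lee_fin mulr_ge0 ?f0 ?g0.
    - by apply/measurable_EFinP; exact: measurable_funM.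
    - by apply: emeasurable_funD; apply/measurable_EFinP; exact: measurable_funM.
    - move=> x Dx; rewrite -!EFinM -EFinD lee_fin -subr_ge0.
      rewrite (_ : _ - _ = (t * f x - g x) ^+ 2 / (2 * t)).
        by rewrite divr_ge0 ?sqr_ge0// mulr_ge0// ltW.
      by field; rewrite gt_eqF.
  rewrite ge0_integralD//; last 4 first.
  - by move=> x Dx; rewrite -EFinM lee_fin mulr_ge0// sqr_ge0.
  - by apply/measurable_EFinP; exact: measurable_funM.
  - by move=> x Dx; rewrite -EFinM lee_fin mulr_ge0// sqr_ge0.
  - by apply/measurable_EFinP; exact: measurable_funM.
  have Z (c : R) (h : T -> R) : 0 <= c -> measurable_fun D (fun x => h x ^+ 2) ->
      (\int[mu]_(x in D) (c%:E * (h x ^+ 2)%:E) =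
       c%:E * \int[mu]_(x in D) (h x ^+ 2)%:E)%E.
    move=> c0 mh; apply: ge0_integralZl => //; first exact/measurable_EFinP.
    by move=> x Dx; rewrite lee_fin sqr_ge0.
  rewrite !Z//.
  apply: (@le_trans _ _ ((t / 2)%:E * a%:E + (2 * t)^-1%:E * b%:E)%E).
    by apply: leeD; apply: lee_wpmul2l => //; rewrite lee_fin.
  rewrite -!EFinM -EFinD lee_fin le_eqVlt; apply/orP; left; apply/eqP.
  by field; rewrite gt_eqF.
have I0 : (0 <= \int[mu]_(x in D) (f x * g x)%:E)%E.
  by apply: integral_ge0 => x Dx; rewrite lee_fin mulr_ge0 ?f0 ?g0.
move: key I0; case: (integral _ _ _) => [i| |]//= key I0.
  by rewrite lee_fin; apply: le_sqrt_amgm => // t /key; rewrite lee_fin.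
by have := key 1 ltr01; rewrite leye_eq.
Qed.

Section schur.
Local Open Scope ereal_scope.
Context d1 d2 (T1 : measurableType d1) (T2 : measurableType d2) (R : realType).
Variables (m1 : {measure set T1 -> \bar R}) (m2 : {measure set T2 -> \bar R}).
Variables (D1 : set T1) (D2 : set T2).
Hypotheses (mD1 : measurable D1) (mD2 : measurable D2).
Hypotheses (fD1 : m1 D1 < +oo) (fD2 : m2 D2 < +oo).
Variables (K : T1 * T2 -> R) (a : T1 -> R) (b : T2 -> R) (A A' : R).
Hypotheses (mK : measurable_fun [set: T1 * T2] K) (ma : measurable_fun [set: T1] a).
Hypothesis mb : measurable_fun [set: T2] b.
Hypotheses (K0 : forall z, (0 <= K z)%R) (a0 : forall x, (0 <= a x)%R).
Hypothesis b0 : forall y, (0 <= b y)%R.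
Hypotheses (ap : forall x, D1 x -> (0 < a x)%R) (bp : forall y, D2 y -> (0 < b y)%R).
Hypotheses (A0 : (0 < A)%R) (A0' : (0 <= A')%R).
Hypothesis row : forall x, D1 x ->
  \int[m2]_(y in D2) (K (x, y) * b y)%:E <= (A * a x)%:E.
Hypothesis col : forall y, D2 y ->
  \int[m1]_(x in D1) (K (x, y) * a x)%:E <= (A' * b y)%:E.

(** Cauchy-Schwarz with the weight [b] bounds [V x ^ 2] by
    [A * a x * \int K f ^ 2 / b]; integrate in [x] and exchange integrals. *)
Theorem schur_test (f : T2 -> R) (V : T1 -> R) :
  measurable_fun [set: T2] f -> (forall y, (0 <= f y)%R) ->
  measurable_fun D1 V -> (forall x, D1 x -> (0 <= V x)%R) ->
  (forall x, D1 x -> (V x)%:E <= \int[m2]_(y in D2) (K (x, y) * f y)%:E) ->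
  \int[m1]_(x in D1) (V x ^+ 2)%:E <=
  (A * A')%:E * \int[m2]_(y in D2) (f y ^+ 2)%:E.
Proof.
move=> mf f0 mV V0 VK; have A00 := ltW A0.
have mK1 x : measurable_fun [set: T2] (fun y => K (x, y)).
  exact: (measurableT_comp mK).
have mK2 y : measurable_fun [set: T1] (fun x => K (x, y)).
  exact: (measurableT_comp mK).
pose q y := (f y ^+ 2 / b y)%R.
have mq : measurable_fun [set: T2] q.
  by apply: measurable_funM; [exact: measurable_funX|exact: measurable_funV].
have q0 y : (0 <= q y)%R by rewrite divr_ge0 ?sqr_ge0.
pose F x := \int[m2]_(y in D2) (K (x, y) * q y)%:E.
have F0 x : 0 <= F x by apply: integral_ge0 => y _; rewrite lee_fin mulr_ge0.
have mKq : measurable_fun [set: T1 * T2] (fun z => (K z * q z.2)%:E).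
  apply/measurable_EFinP; apply: measurable_funM => //.
  exact: (measurableT_comp mq).
have Kq0 z : 0 <= (K z * q z.2)%:E by rewrite lee_fin mulr_ge0.
have mF : measurable_fun [set: T1] F.
  exact: (measurable_section_integral mD2 fD2 mKq Kq0).
have VF x : D1 x -> (V x ^+ 2)%:E <= (A * a x)%:E * F x.
  move=> Dx; have Aa : (0 < A * a x)%R by rewrite mulr_gt0 ?ap.
  case Fx : (F x) => [phi| |]; last first.
  - by have := F0 x; rewrite Fx.
  - by rewrite mulry gtr0_sg// mul1e leey.
  have phi0 : (0 <= phi)%R by have := F0 x; rewrite Fx lee_fin.
  have := @cauchy_schwarz_integral _ T2 R m2 D2
    (fun y => Num.sqrt (K (x, y) * b y)) (fun y => Num.sqrt (K (x, y) * q y))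
    (A * a x) phi mD2.
  have m1' : measurable_fun D2 (fun y => Num.sqrt (K (x, y) * b y)).
    apply: measurable_fun_sqrt; apply: measurable_funTS; exact: measurable_funM.
  have m2' : measurable_fun D2 (fun y => Num.sqrt (K (x, y) * q y)).
    apply: measurable_fun_sqrt; apply: measurable_funTS; exact: measurable_funM.
  move=> /(_ m1' m2' (fun _ _ => sqrtr_ge0 _) (fun _ _ => sqrtr_ge0 _) (ltW Aa) phi0).
  under eq_integral do rewrite sqr_sqrtr ?mulr_ge0//.
  under [X in (_ -> X <= _ -> _)]eq_integral do
    rewrite (sqr_sqrtr (mulr_ge0 (K0 _) (q0 _))).
  move=> /(_ (row Dx)); rewrite -/(F x) Fx => /(_ (lexx _)) h.
  have : (V x)%:E <= (Num.sqrt (A * a x * phi))%:E.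
    apply: le_trans h; apply: (le_trans (VK _ Dx)).
    apply: ge0_le_integral => //.
    - by move=> y _; rewrite lee_fin mulr_ge0.
    - apply/measurable_EFinP; apply: measurable_funTS; exact: measurable_funM.
    - by apply/measurable_EFinP; exact: measurable_funM.
    - move=> y Dy; rewrite lee_fin -sqrtrM ?mulr_ge0//.
      have -> : (K (x, y) * b y * (K (x, y) * q y) = (K (x, y) * f y) ^+ 2)%R.
        by rewrite /q; field; rewrite gt_eqF// bp.
      by rewrite sqrtr_sqr ler_norm.
  rewrite lee_fin => h2; rewrite -EFinM lee_fin.
  rewrite -[leRHS](sqr_sqrtr (mulr_ge0 (ltW Aa) phi0)).
  by rewrite ler_sqr ?nnegrE ?sqrtr_ge0// V0.
apply: (@le_trans _ _ (\int[m1]_(x in D1) ((A * a x)%:E * F x))).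
  apply: ge0_le_integral => //.
  - by move=> x _; rewrite lee_fin sqr_ge0.
  - by apply/measurable_EFinP; exact: measurable_funX.
  - apply: emeasurable_funM; last exact: measurable_funTS.
    by apply/measurable_EFinP; apply: measurable_funTS; exact: measurable_funM.
pose G z := ((A * a z.1 * (K z * q z.2))%R)%:E.
have mG : measurable_fun [set: T1 * T2] G.
  apply/measurable_EFinP; apply: measurable_funM.
    by apply: measurable_funM => //; exact: (measurableT_comp ma).
  by apply: measurable_funM => //; exact: (measurableT_comp mq).
have G0 z : 0 <= G z by rewrite lee_fin (mulr_ge0 (mulr_ge0 _ (a0 _)) (mulr_ge0 (K0 _) (q0 _))).
rewrite (eq_integral (fun x => \int[m2]_(y in D2) G (x, y))); last first.
  move=> x _; rewrite -ge0_integralZl//.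
  - apply: measurable_funTS; apply/measurable_EFinP; exact: measurable_funM.
  - by rewrite lee_fin (mulr_ge0 A00).
rewrite (tonelli_sets mD1 mD2 fD1 fD2 mG G0).
rewrite -ge0_integralZl//; last 3 first.
- by apply: measurable_funTS; apply/measurable_EFinP; exact: measurable_funX.
- by move=> y _; rewrite lee_fin sqr_ge0.
- by rewrite lee_fin (mulr_ge0 A00).
apply: ge0_le_integral => //.
- by move=> y _; exact: integral_ge0.
- have mG' : measurable_fun [set: T2 * T1] (fun z => G (z.2, z.1)).
    by apply: (measurableT_comp mG); exact: measurable_swap.
  apply: measurable_funTS.
  exact: (measurable_section_integral mD1 fD1 mG' (fun z => G0 (z.2, z.1))).
- apply: emeasurable_funM => //; apply: measurable_funTS.
  by apply/measurable_EFinP; exact: measurable_funX.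
move=> y Dy.
rewrite (eq_integral (fun x => ((A * q y)%:E * (K (x, y) * a x)%:E))); last first.
  by move=> x _; rewrite /G -EFinM; congr _%:E => /=; ring.
rewrite ge0_integralZl//; last 3 first.
- by apply: measurable_funTS; apply/measurable_EFinP; exact: measurable_funM.
- by move=> x _; rewrite lee_fin mulr_ge0.
- by rewrite lee_fin (mulr_ge0 A00).
apply: (@le_trans _ _ ((A * q y)%:E * (A' * b y)%:E)).
  by apply: lee_wpmul2l; [rewrite lee_fin (mulr_ge0 A00)|exact: col].
rewrite -!EFinM lee_fin le_eqVlt; apply/orP; left; apply/eqP.
by rewrite /q; field; rewrite gt_eqF// bp.
Qed.

End schur.

(** * Two overlapping disks *)

Section disk_boundaries.
Context {R : realType}.
Local Notation plane := (R * R)%type.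
Implicit Types (x y z c M e : plane) (r l h : R).

Lemma enorm_ge0 x : 0 <= enorm x.
Proof. exact: sqrtr_ge0. Qed.

Lemma enorm_distC x y : enorm (x - y) = enorm (y - x).
Proof. by rewrite /enorm /= -[x.1 - y.1]opprB -[x.2 - y.2]opprB !sqrrN. Qed.

Lemma enormD x y : enorm (x + y) <= enorm x + enorm y.
Proof.
rewrite -(@ler_pXn2r _ 2) ?nnegrE ?addr_ge0 ?enorm_ge0// sqrrD !enorm_sqr /=.
suff : x.1 * y.1 + x.2 * y.2 <= enorm x * enorm y by lra.
apply: le_trans (ler_norm _) _.
rewrite -(@ler_pXn2r _ 2) ?nnegrE ?mulr_ge0 ?enorm_ge0// exprMn !enorm_sqr real_normK ?num_real//.
by rewrite -subr_ge0; have := sqr_ge0 (x.1 * y.2 - x.2 * y.1); lra.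
Qed.

Lemma enorm_triangle x y z : enorm (x - z) <= enorm (x - y) + enorm (y - z).
Proof. by have := enormD (x - y) (y - z); rewrite addrA subrK. Qed.

Lemma enormZ (t : R) x : 0 <= t -> enorm (t * x.1, t * x.2) = t * enorm x.
Proof.
move=> t0; apply/eqP; rewrite -(@eqrXn2 _ 2) ?mulr_ge0 ?enorm_ge0//.
by rewrite exprMn !enorm_sqr /=; apply/eqP; ring.
Qed.

Lemma continuous_enorm c : continuous (fun x => enorm (x - c)).
Proof.
move=> x; apply: (@continuous_comp _ _ _ (fun x : plane => (x - c).1 ^+ 2 + (x - c).2 ^+ 2) Num.sqrt).
  apply: cvgD; rewrite /=; under eq_cvg do rewrite expr2.
    apply: cvgM; apply: cvgB => //; try exact: cvg_cst; exact: cvg_fst.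
  apply: cvgM; apply: cvgB => //; try exact: cvg_cst; exact: cvg_snd.
exact: sqrt_continuous.
Qed.

Lemma open_disk c r : open (disk c r).
Proof.
have -> : disk c r = (fun x => enorm (x - c)) @^-1` [set t | t < r] by [].
by apply: open_comp; [move=> x _; exact: continuous_enorm|exact: open_lt].
Qed.

Lemma open_disk_ext c r : open [set x | r < enorm (x - c)].
Proof.
have -> : [set x | r < enorm (x - c)] = (fun x => enorm (x - c)) @^-1` [set t | r < t] by [].
by apply: open_comp; [move=> x _; exact: continuous_enorm|exact: open_gt].
Qed.

Definition homothety c x (t : R) : plane := (c.1 + t * (x.1 - c.1), c.2 + t * (x.2 - c.2)).

Lemma enorm_homothety c x t : 0 <= t -> enorm (homothety c x t - c) = t * enorm (x - c).
Proof.
by move=> t0; rewrite -(enormZ _ t0); congr enorm; rewrite /homothety; congr pair; rewrite /=; ring.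
Qed.

Lemma homothety_near c x (A : set plane) : nbhs x A ->
  \forall t \near (1 : R), A (homothety c x t).
Proof.
have -> : nbhs x = nbhs (homothety c x 1).
  by congr nbhs; rewrite /homothety !mul1r !subrKC; case: x.
have : {for 1, continuous (homothety c x)}.
  have coord (a b : R) : (a + t * b) @[t --> (1 : R)] --> a + 1 * b.
    by apply: cvgD; [exact: cvg_cst|apply: cvgM; [exact: cvg_id|exact: cvg_cst]].
  exact: (cvg_pair (coord c.1 (x.1 - c.1)) (coord c.2 (x.2 - c.2))).
by move=> ct nA; exact: ct.
Qed.

(** A point of the circle is approached from inside along the ray from the centre. *)
Lemma circleE c r : 0 < r -> circle c r = [set x | enorm (x - c) = r].
Proof.
move=> r0; apply/seteqP; split=> x /=.
  move=> [clx nix]; apply/eqP; rewrite eq_le; apply/andP; split.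
    rewrite leNgt; apply/negP => rx.
    have /clx[y [yd]] : nbhs x [set x | r < enorm (x - c)].
      by apply: open_nbhs_nbhs; split => //; exact: open_disk_ext.
    by rewrite /= ltNge; move: yd; rewrite /disk /= => /ltW ->.
  rewrite leNgt; apply/negP => xr; apply: nix.
  by apply: open_nbhs_nbhs; split => //; exact: open_disk.
move=> xr; split.
  move=> A /(homothety_near c) nA.
  have [t [At /andP[t0 t1]]] : exists t, A (homothety c x t) /\ 0 < t < 1.
    have nA' : \forall t \near (1 : R)^'-, A (homothety c x t) by exact: cvg_within nA.
    have t1 : \forall t \near (1 : R)^'-, t < 1 by exact: nbhs_left_lt.
    have t0 : \forall t \near (1 : R)^'-, 0 < t by exact: nbhs_left_gt.
    have [t [At [t0' t1']]] :=
      @filter_ex _ _ (at_left_proper_filter 1) _ (filterI nA' (filterI t0 t1)).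
    by exists t; split => //; apply/andP.
  exists (homothety c x t); split => //.
  by rewrite /disk /= enorm_homothety ?(ltW t0)// xr gtr_pMl.
by move=> /interior_subset; rewrite /disk /= xr ltxx.
Qed.

(** Being inside the other disk makes a point interior to the union. *)
Lemma circle_intI c r c' r' x : 0 < r -> enorm (x - c) = r -> enorm (x - c') < r' ->
  circle_int c r c' r' x.
Proof.
move=> r0 xr xr'; split; first by rewrite circleE.
move=> [_ [_ ni]]; apply: ni.
apply: (@filterS _ _ _ (disk c' r')); first by move=> y; right.
by apply: open_nbhs_nbhs; split => //; exact: open_disk.
Qed.

(** A point of the circle strictly outside the other disk is a limit of points outside both. *)
Lemma circle_int_le c r c' r' x : 0 < r -> circle_int c r c' r' x ->
  enorm (x - c) = r /\ enorm (x - c') <= r'.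
Proof.
move=> r0 [xc nx]; have xr : enorm (x - c) = r by move: xc; rewrite circleE.
split => //; rewrite leNgt; apply/negP => rx; apply: nx; split => //; split.
  move: xc => [clx _] A /clx[y [yd Ay]]; exists y; split => //; by left.
move=> ni.
have nE : nbhs x [set y | r' < enorm (y - c')].
  by apply: open_nbhs_nbhs; split => //; exact: open_disk_ext.
have nI : nbhs x ((disk c r `|` disk c' r') `&` [set y | r' < enorm (y - c')]).
  exact: filterI.
have nA := homothety_near c nI.
have [t [[]]] : exists t, ((disk c r `|` disk c' r') (homothety c x t) /\
    r' < enorm (homothety c x t - c')) /\ 1 < t.
  have nA' : \forall t \near (1 : R)^'+, ((disk c r `|` disk c' r')
      `&` [set y | r' < enorm (y - c')]) (homothety c x t) by exact: cvg_within nA.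
  have t1 : \forall t \near (1 : R)^'+, 1 < t by exact: nbhs_right_gt.
  have [t [At t1']] := @filter_ex _ _ (at_right_proper_filter 1) _ (filterI nA' t1).
  by exists t; split.
have t0 : 1 < t -> 0 <= t by move=> t1; apply: le_trans (ltW t1).
move=> [|]; rewrite /disk /=.
  move=> + _ t1; rewrite enorm_homothety ?t0// xr ltNge => /negP; apply.
  by rewrite ler_peMl ?(ltW r0)// ltW.
by move=> lt1 lt2; have := lt_trans lt1 lt2; rewrite ltxx.
Qed.

End disk_boundaries.

Section lens.
Context {R : realType}.
Local Notation plane := (R * R)%type.
Implicit Types (x y z c M e : plane) (r l h : R).

Definition frame_pt M e (X Z : R) : plane :=
  (M.1 + X * e.1 - Z * e.2, M.2 + X * e.2 + Z * e.1).

(** [M] is the midpoint of the common chord, of half length [l], of two circles whose centres lie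
    on its perpendicular bisector, directed by [e], at the abscissas [h1 < h2]. *)
Definition lens_frame c1 r1 c2 r2 M e l h1 h2 :=
  [/\ e.1 ^+ 2 + e.2 ^+ 2 = 1, 0 < l, h1 < h2,
      c1 = frame_pt M e h1 0 /\ c2 = frame_pt M e h2 0 &
      r1 ^+ 2 = h1 ^+ 2 + l ^+ 2 /\ r2 ^+ 2 = h2 ^+ 2 + l ^+ 2].

Lemma lens_frame_sym c1 r1 c2 r2 M e l h1 h2 : lens_frame c1 r1 c2 r2 M e l h1 h2 ->
  lens_frame c2 r2 c1 r1 M (- e.1, - e.2) l (- h2) (- h1).
Proof.
move=> [e1 l0 h12 [-> ->] [rl1 rl2]]; split => //=; rewrite ?sqrrN ?ltrN2//.
by split; rewrite /frame_pt; congr pair; rewrite /=; ring.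
Qed.

(** The abscissas of the centres solve [r1 ^ 2 - h1 ^ 2 = r2 ^ 2 - h2 ^ 2] with [h2 - h1] the distance
    of the centres, and [l] is real because the disks meet and neither contains the other. *)
Lemma lens_frame_exists c1 r1 c2 r2 : 0 < r1 -> 0 < r2 ->
  disk c1 r1 `&` disk c2 r2 !=set0 ->
  ~ (disk c1 r1 `<=` disk c2 r2) -> ~ (disk c2 r2 `<=` disk c1 r1) ->
  exists M e l h1 h2, lens_frame c1 r1 c2 r2 M e l h1 h2.
Proof.
move=> r10 r20 [z [z1 z2]] n12 n21; set d := enorm (c2 - c1).
have d0 : 0 <= d by exact: enorm_ge0.
have dlt : d < r1 + r2.
  apply: le_lt_trans (enorm_triangle _ z _) _; rewrite addrC.
  by rewrite [enorm (c2 - z)]enorm_distC ltrD.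
have r12 : r2 - r1 < d.
  rewrite ltNge; apply/negP => le; apply: n12 => y; rewrite /disk /= => yc.
  apply: le_lt_trans (enorm_triangle _ c1 _) _; rewrite [enorm (c1 - c2)]enorm_distC -/d; lra.
have r21 : r1 - r2 < d.
  rewrite ltNge; apply/negP => le; apply: n21 => y; rewrite /disk /= => yc.
  by apply: le_lt_trans (enorm_triangle _ c2 _) _; rewrite -/d; lra.
have {}d0 : 0 < d by lra.
pose h1 := - ((r1 ^+ 2 + d ^+ 2 - r2 ^+ 2) / (2 * d)).
have h1E : 2 * d * h1 = r2 ^+ 2 - r1 ^+ 2 - d ^+ 2.
  by rewrite /h1 mulrN mulrC divfK ?mulf_neq0 ?gt_eqF//; ring.
have l20 : 0 < r1 ^+ 2 - h1 ^+ 2.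
  have -> : r1 ^+ 2 - h1 ^+ 2 = (r1 - h1) * (r1 + h1) by ring.
  have p1 : 0 < (2 * d) * (r1 - h1).
    have -> : (2 * d) * (r1 - h1) = (r1 + d - r2) * (r1 + d + r2).
      by rewrite mulrBr h1E; ring.
    by rewrite mulr_gt0//; lra.
  have p2 : 0 < (2 * d) * (r1 + h1).
    have -> : (2 * d) * (r1 + h1) = (r2 - r1 + d) * (r2 + r1 - d).
      by rewrite mulrDr h1E; ring.
    by rewrite mulr_gt0//; lra.
  have dd : 0 < 2 * d by lra.
  by apply: mulr_gt0; [rewrite -(pmulr_rgt0 _ dd)|rewrite -(pmulr_rgt0 _ dd)].
pose e : plane := ((c2.1 - c1.1) / d, (c2.2 - c1.2) / d).
exists (c1.1 - h1 * e.1, c1.2 - h1 * e.2), e, (Num.sqrt (r1 ^+ 2 - h1 ^+ 2)), h1, (h1 + d).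
have d2 : d ^+ 2 = (c2.1 - c1.1) ^+ 2 + (c2.2 - c1.2) ^+ 2 by rewrite /d enorm_sqr.
have dn : d != 0 by rewrite gt_eqF.
split; rewrite ?sqrtr_gt0//.
- by rewrite /= !expr_div_n -mulrDl -d2 divff// expf_neq0.
- lra.
- by split; rewrite /frame_pt [LHS]surjective_pairing; congr pair; rewrite /=; field.
- by rewrite sqr_sqrtr ?(ltW l20)//; split; [ring|lra].
Qed.

Lemma arc_flip M e l cg sg : arc M (- e.1, - e.2) l cg sg = arc M e l cg (- sg).
Proof.
have fx y : frame_x M (- e.1, - e.2) y = - frame_x M e y by rewrite /frame_x /=; ring.
have fy y : frame_y M (- e.1, - e.2) y = - frame_y M e y by rewrite /frame_y /=; ring.
have pe y : arc_param M (- e.1, - e.2) l y = (arc_param M e l y)^-1.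
  rewrite /arc_param fx fy -!sqrtrV ?sqrtr_ge0//; last by rewrite divr_ge0// addr_ge0// sqr_ge0.
  by rewrite invf_div; congr (Num.sqrt (Num.sqrt (_ / _))); ring.
apply/seteqP; split => y; rewrite /arc /= fx fy pe !sqrrN invr_eq1.
  by move=> [h1 h2 h3]; split => //; [rewrite -h1|]; lra.
by move=> [h1 h2 h3]; split => //; [rewrite -h1|]; lra.
Qed.

Section one_circle.
Variables (c1 : plane) (r1 : R) (c2 : plane) (r2 : R) (M e : plane) (l h1 h2 : R).
Hypothesis r10 : 0 < r1.
Hypothesis r20 : 0 < r2.
Hypothesis fr : lens_frame c1 r1 c2 r2 M e l h1 h2.

Let e1 : e.1 ^+ 2 + e.2 ^+ 2 = 1. Proof. by case: fr. Qed.
Let l0 : 0 < l. Proof. by case: fr. Qed.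
Let h12 : h1 < h2. Proof. by case: fr. Qed.
Let rl1 : r1 ^+ 2 = h1 ^+ 2 + l ^+ 2. Proof. by case: fr => _ _ _ _ []. Qed.
Let rl2 : r2 ^+ 2 = h2 ^+ 2 + l ^+ 2. Proof. by case: fr => _ _ _ _ []. Qed.

Lemma frame_ptK x : frame_pt M e (frame_x M e x) (frame_y M e x) = x.
Proof.
rewrite [RHS]surjective_pairing /frame_pt /frame_x /frame_y; congr pair.
  transitivity (M.1 + (x.1 - M.1) * (e.1 ^+ 2 + e.2 ^+ 2)); first by ring.
  by rewrite e1; ring.
transitivity (M.2 + (x.2 - M.2) * (e.1 ^+ 2 + e.2 ^+ 2)); first by ring.
by rewrite e1; ring.
Qed.

Lemma centre_dist h x : enorm (x - frame_pt M e h 0) ^+ 2 =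
  (frame_x M e x - h) ^+ 2 + frame_y M e x ^+ 2.
Proof.
have := enorm_frame M e1 x (frame_pt M e h 0) => ->.
rewrite /frame_x /frame_y /frame_pt /= !mul0r subr0 addr0.
have -> : (M.1 + h * e.1 - M.1) * e.1 + (M.2 + h * e.2 - M.2) * e.2 = h.
  by transitivity (h * (e.1 ^+ 2 + e.2 ^+ 2)); [ring|rewrite e1 mulr1].
have -> : (M.2 + h * e.2 - M.2) * e.1 - (M.1 + h * e.1 - M.1) * e.2 = 0 by ring.
by rewrite subr0.
Qed.

Let cE1 : c1 = frame_pt M e h1 0. Proof. by case: fr => _ _ _ []. Qed.
Let cE2 : c2 = frame_pt M e h2 0. Proof. by case: fr => _ _ _ []. Qed.

Definition arc_int := arc M e l (h1 / r1) (- (l / r1)).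
Definition arc_ext := arc M e l (- (h1 / r1)) (l / r1).

Let circ x : circle c1 r1 x <->
  frame_x M e x ^+ 2 + frame_y M e x ^+ 2 - l ^+ 2 = 2 * h1 * frame_x M e x.
Proof.
have eqv : (enorm (x - c1) = r1) <-> (enorm (x - c1) ^+ 2 = r1 ^+ 2).
  split => [->//|/eqP]; rewrite eqrXn2 ?enorm_ge0 ?(ltW r10)// => /eqP //.
rewrite circleE//= (propext eqv) cE1 centre_dist rl1; split => h; lra.
Qed.

Let lr0 : 0 < l / r1. Proof. by rewrite divr_gt0. Qed.

Let arc_int_eq x : arc_int x <->
  [/\ circle c1 r1 x, 0 < frame_x M e x & arc_param M e l x != 1].
Proof.
have rn : r1 != 0 by rewrite gt_eqF.
rewrite (propext (circ x)) /arc_int /arc /=.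
set X := frame_x M e x; set Z := frame_y M e x; set p := arc_param _ _ _ _.
have eqE : - (l / r1) * (X ^+ 2 + Z ^+ 2 - l ^+ 2) + 2 * l * (h1 / r1) * X =
  (l / r1) * (2 * h1 * X - (X ^+ 2 + Z ^+ 2 - l ^+ 2)) by ring.
split => -[h h' h'']; split => //.
- by move: h; rewrite eqE => /eqP; rewrite mulf_eq0 gt_eqF//= subr_eq0 => /eqP.
- by move: h'; rewrite mulNr oppr_lt0 pmulr_rgt0.
- by rewrite eqE h subrr mulr0.
- by rewrite mulNr oppr_lt0 pmulr_rgt0.
Qed.

Let arc_ext_eq x : arc_ext x <->
  [/\ circle c1 r1 x, frame_x M e x < 0 & arc_param M e l x != 1].
Proof.
have rn : r1 != 0 by rewrite gt_eqF.
rewrite (propext (circ x)) /arc_ext /arc /=.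
set X := frame_x M e x; set Z := frame_y M e x; set p := arc_param _ _ _ _.
have eqE : (l / r1) * (X ^+ 2 + Z ^+ 2 - l ^+ 2) + 2 * l * (- (h1 / r1)) * X =
  (l / r1) * (X ^+ 2 + Z ^+ 2 - l ^+ 2 - 2 * h1 * X) by ring.
split => -[h h' h'']; split => //.
- by move: h; rewrite eqE => /eqP; rewrite mulf_eq0 gt_eqF//= subr_eq0 => /eqP.
- by move: h'; rewrite pmulr_rlt0.
- by rewrite eqE h subrr mulr0.
- by rewrite pmulr_rlt0.
Qed.

Lemma arc_int_circle : arc_int `<=` circle c1 r1.
Proof. by move=> x /arc_int_eq[]. Qed.

Lemma arc_ext_circle : arc_ext `<=` circle c1 r1.
Proof. by move=> x /arc_ext_eq[]. Qed.

Let other_dist x : circle c1 r1 x ->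
  enorm (x - c2) ^+ 2 = r2 ^+ 2 - 2 * (h2 - h1) * frame_x M e x.
Proof.
by move=> /circ h; rewrite cE2 centre_dist rl2; lra.
Qed.

Lemma arc_int_sub : arc_int `<=` circle_int c1 r1 c2 r2.
Proof.
move=> x /arc_int_eq[cx X0 _]; apply: circle_intI => //; first by move: cx; rewrite circleE.
rewrite -(@ltr_pXn2r _ 2) ?nnegrE ?enorm_ge0 ?(ltW r20)// (other_dist cx) ltrBlDr ltrDl.
by rewrite !mulr_gt0// subr_gt0.
Qed.

Lemma arc_ext_disj x : arc_ext x -> ~ circle_int c1 r1 c2 r2 x.
Proof.
move=> /arc_ext_eq[cx X0 _] /circle_int_le[]// _.
apply/negP; rewrite -ltNge.
rewrite -(@ltr_pXn2r _ 2) ?nnegrE ?enorm_ge0 ?(ltW r20)// (other_dist cx) ltrDl -mulrN.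
by rewrite !mulr_gt0 ?subr_gt0// oppr_gt0.
Qed.

(** The two common points, and the two points on the line of centres, which [arc] leaves out. *)
Definition lens_exceptional : set plane :=
  [set frame_pt M e 0 l; frame_pt M e 0 (- l); frame_pt M e (h1 + r1) 0; frame_pt M e (h1 - r1) 0].

Lemma circle_arcs x : circle c1 r1 x -> [\/ arc_int x, arc_ext x | lens_exceptional x].
Proof.
move=> cx; rewrite (propext (arc_int_eq x)) (propext (arc_ext_eq x)).
have [p1|p1] := eqVneq (arc_param M e l x) 1; last first.
  have [X0|X0|X0] := ltgtP (frame_x M e x) 0; [by constructor 2|by constructor 1|].
  constructor 3; have /circ := cx; rewrite X0 => h.
  have : (frame_y M e x - l) * (frame_y M e x + l) = 0 by lra.
  move=> /eqP; rewrite mulf_eq0 subr_eq0 addr_eq0 => /orP[] /eqP Z.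
    by left; left; left; rewrite -[x]frame_ptK X0 Z.
  by left; left; right; rewrite -[x]frame_ptK X0 Z.
constructor 3.
have Z : frame_y M e x = 0.
  move: p1; rewrite /arc_param; set a := _ + _; set b := _ + _ => p1.
  have ab0 : 0 <= a / b by rewrite divr_ge0// addr_ge0// sqr_ge0.
  have ab : a / b = 1.
    by rewrite -(sqr_sqrtr ab0) -(sqr_sqrtr (sqrtr_ge0 (a / b))) p1 !expr1n.
  have bn : b != 0 by apply/eqP => b0; move: ab; rewrite b0 invr0 mulr0 => /esym/eqP; rewrite oner_eq0.
  have : a = b by rewrite -[b]mul1r -ab divfK.
  rewrite /a /b => abE; have : l * frame_y M e x = 0 by lra.
  by move/eqP; rewrite mulf_eq0 gt_eqF//= => /eqP.
have /circ := cx; rewrite Z => h.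
have : (frame_x M e x - (h1 + r1)) * (frame_x M e x - (h1 - r1)) = 0 by have := rl1; lra.
move=> /eqP; rewrite mulf_eq0 !subr_eq0 => /orP[] /eqP X.
  by left; right; rewrite -[x]frame_ptK X Z.
by right; rewrite -[x]frame_ptK X Z.
Qed.

Lemma measurable_plane_point x : measurable [set x].
Proof.
have -> : [set x] = [set x.1] `*` [set x.2].
  apply/seteqP; split => y /=; first by move=> ->.
  by case: y x => [a b] [a' b'] /= [-> ->].
by apply: measurableX; exact: measurable_set1.
Qed.

Lemma exceptional_null : hausdorff1 lens_exceptional = 0.
Proof.
have nullU (A B : set plane) : hausdorff1 A = 0 -> hausdorff1 B = 0 -> hausdorff1 (A `|` B) = 0.
  move=> A0 B0; apply/eqP; rewrite eq_le hausdorff1_ge0 andbT.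
  by have := @outer_measureU2 _ _ hausdorff1 A B; rewrite /= A0 B0 adde0.
by apply: (nullU _ _ (nullU _ _ (nullU _ _ _ _) _) _); exact: hausdorff1_point.
Qed.

Lemma measurable_circle_int : measurable (circle_int c1 r1 c2 r2).
Proof.
pose F := circle_int c1 r1 c2 r2 `&` lens_exceptional.
have -> : circle_int c1 r1 c2 r2 = arc_int `|` F.
  apply/seteqP; split => x; last by move=> [/arc_int_sub//|[]].
  move=> ix; have /circle_arcs[|/arc_ext_disj//|] : circle c1 r1 x by case: ix.
    by left.
  by right.
apply: measurableU; first exact: measurable_arc.
have fF : finite_set F.
  apply: (@sub_finite_set _ _ lens_exceptional); first by move=> x [].
  by do 3!(rewrite finite_setU; split; last exact: finite_set1); exact: finite_set1.
have -> : F = \bigcup_(x in F) [set x] by rewrite bigcup_imset1 image_id.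
by apply: fin_bigcup_measurable => // x _; exact: measurable_plane_point.
Qed.

Lemma measurable_circle : measurable (circle c1 r1).
Proof.
have -> : circle c1 r1 = arc_int `|` arc_ext `|` (circle c1 r1 `&` lens_exceptional).
  apply/seteqP; split => x; last by move=> [[/arc_int_circle|/arc_ext_circle]|[]].
  by move=> cx; case: (circle_arcs cx); [left; left|left; right|right].
apply: measurableU; first by apply: measurableU; exact: measurable_arc.
set F := _ `&` _.
have fF : finite_set F.
  apply: (@sub_finite_set _ _ lens_exceptional); first by move=> x [].
  by do 3!(rewrite finite_setU; split; last exact: finite_set1); exact: finite_set1.
have -> : F = \bigcup_(x in F) [set x] by rewrite bigcup_imset1 image_id.
by apply: fin_bigcup_measurable => // x _; exact: measurable_plane_point.
Qed.

Lemma null_diff_integral (A B : set plane) (f : plane -> \bar R) :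
  measurable A -> measurable B -> A `<=` B -> B `\` A `<=` lens_exceptional ->
  measurable_fun B f -> (forall x, B x -> (0 <= f x)%E) ->
  (\int[hausdorff1]_(x in B) f x = \int[hausdorff1]_(x in A) f x)%E.
Proof.
move=> mA mB AB BA mf f0.
have mD : measurable (B `\` A) by exact: measurableD.
have D0 : hausdorff1 (B `\` A) = 0.
  apply/eqP; rewrite eq_le hausdorff1_ge0 andbT -exceptional_null.
  exact: le_hausdorff1.
rewrite (ge0_negligible_integral mD mB mf f0 D0); congr (integral _ _ _).
by rewrite setDD setIidr.
Qed.

Lemma integral_arc_int (f : plane -> \bar R) : measurable_fun [set: plane] f ->
  (forall x, (0 <= f x)%E) ->
  (\int[hausdorff1]_(x in circle_int c1 r1 c2 r2) f x = \int[hausdorff1]_(x in arc_int) f x)%E.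
Proof.
move=> mf f0; apply: null_diff_integral => //.
- exact: measurable_arc.
- exact: measurable_circle_int.
- exact: arc_int_sub.
- move=> x [ix nx]; have /circle_arcs[//|/arc_ext_disj//|//] : circle c1 r1 x by case: ix.
- exact: measurable_funTS.
Qed.

Lemma integral_arc_ext (f : plane -> \bar R) : measurable_fun [set: plane] f ->
  (forall x, (0 <= f x)%E) ->
  (\int[hausdorff1]_(x in circle c1 r1 `\` circle_int c1 r1 c2 r2) f x =
   \int[hausdorff1]_(x in arc_ext) f x)%E.
Proof.
move=> mf f0; apply: null_diff_integral => //.
- exact: measurable_arc.
- by apply: measurableD; [exact: measurable_circle|exact: measurable_circle_int].
- by move=> x ex; split; [exact: arc_ext_circle|exact: arc_ext_disj].
- by move=> x [[cx ix] nx]; case: (circle_arcs cx) => // /arc_int_sub.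
- exact: measurable_funTS.
Qed.

End one_circle.
End lens.

(** * Square integrable functions *)

Section square_integrable.
Context d (T : measurableType d) (R : realType) (mu : {measure set T -> \bar R}).
Variables (D : set T) (mD : measurable D).
Implicit Types f g h : T -> R.

Definition sqint f := measurable_fun D f /\ (\int[mu]_(x in D) (f x ^+ 2)%:E < +oo)%E.

Definition rdot f g : R := \int[mu]_(x in D) (f x * g x).

Lemma sqint_integrable f : sqint f -> mu.-integrable D (EFin \o (fun x => f x ^+ 2)).
Proof.
move=> [mf ff]; apply/integrableP; split.
  by apply/measurable_EFinP; exact: measurable_funX.
by under eq_integral do rewrite /= ger0_norm ?sqr_ge0//.
Qed.

Lemma sqint_mul f g : sqint f -> sqint g -> mu.-integrable D (EFin \o (fun x => f x * g x)).
Proof.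
move=> sf sg; have ifg := integrableD mD (sqint_integrable sf) (sqint_integrable sg).
apply: le_integrable ifg => //.
  by apply/measurable_EFinP; apply: measurable_funM; [case: sf|case: sg].
move=> x _ /=; rewrite lee_fin [leRHS]ger0_norm ?addr_ge0 ?sqr_ge0// normrM.
rewrite -[f x ^+ 2]real_normK ?num_real// -[g x ^+ 2]real_normK ?num_real//.
have := sqr_ge0 (`|f x| - `|g x|); have := sqr_ge0 `|f x|; have := sqr_ge0 `|g x|.
lra.
Qed.

Lemma sqintD f g : sqint f -> sqint g -> sqint (fun x => f x + g x).
Proof.
move=> sf sg; split; first by apply: measurable_funD; [case: sf|case: sg].
have i1 := integrableD mD (sqint_integrable sf) (sqint_integrable sg).
have i2 := sqint_mul sf sg.
have i3 := integrableD mD i1 (integrableD mD i2 i2).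
have [_] := integrableP _ _ _ i3; apply: le_lt_trans.
apply: ge0_le_integral => //.
- by move=> x _; rewrite lee_fin sqr_ge0.
- by apply/measurable_EFinP; apply: measurable_funX; apply: measurable_funD; [case: sf|case: sg].
- by apply: measurableT_comp => //; case/integrableP : i3.
- move=> x _ /=; rewrite lee_fin; apply: le_trans (ler_norm _); lra.
Qed.

Lemma sqintZ (a : R) f : sqint f -> sqint (fun x => a * f x).
Proof.
move=> sf; split; first by apply: measurable_funM => //; case: sf.
under eq_integral do rewrite exprMn EFinM.
rewrite ge0_integralZl//.
- by rewrite lte_mul_pinfty// ?lee_fin ?sqr_ge0//; case: sf.
- by apply/measurable_EFinP; apply: measurable_funX; case: sf.
- by move=> x _; rewrite lee_fin sqr_ge0.
- by rewrite lee_fin sqr_ge0.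
Qed.

Lemma rdotC f g : rdot f g = rdot g f.
Proof. by apply: eq_Rintegral => x _; rewrite mulrC. Qed.

Lemma rdotDl f g h : sqint f -> sqint g -> sqint h ->
  rdot (fun x => f x + g x) h = rdot f h + rdot g h.
Proof.
move=> sf sg sh; rewrite -RintegralD//; [|exact: sqint_mul..].
by apply: eq_Rintegral => x _; rewrite mulrDl.
Qed.

Lemma rdotZl (a : R) f h : sqint f -> sqint h -> rdot (fun x => a * f x) h = a * rdot f h.
Proof.
move=> sf sh; rewrite -RintegralZl//; last exact: sqint_mul.
by apply: eq_Rintegral => x _; rewrite mulrA.
Qed.


End square_integrable.

Section complex_square_integrable.
Context {R : realType}.
Local Notation plane := (R * R)%type.
Variables (D : set plane) (mD : measurable D).
Implicit Types u v w : plane -> R[i].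
Local Notation Re := complex.Re.
Local Notation Im := complex.Im.
Let m : {measure set plane -> \bar R} := hausdorff1.

Lemma L2_sqint u : L2 D u <-> sqint m D (fun x => Re (u x)) /\ sqint m D (fun x => Im (u x)).
Proof.
split.
  move=> [mr mi fin]; split; split => //; apply: le_lt_trans fin; apply: ge0_le_integral => //.
  - by move=> x _; rewrite lee_fin sqr_ge0.
  - by apply/measurable_EFinP; exact: measurable_funX.
  - by apply/measurable_EFinP; apply: measurable_funD; exact: measurable_funX.
  - by move=> x _; rewrite lee_fin lerDl sqr_ge0.
  - by move=> x _; rewrite lee_fin sqr_ge0.
  - by apply/measurable_EFinP; exact: measurable_funX.
  - by apply/measurable_EFinP; apply: measurable_funD; exact: measurable_funX.
  - by move=> x _; rewrite lee_fin lerDr sqr_ge0.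
move=> [[mr fr] [mi fi]]; split => //.
under eq_integral do rewrite EFinD.
rewrite ge0_integralD//.
- by rewrite lte_add_pinfty.
- by move=> x _; rewrite lee_fin sqr_ge0.
- by apply/measurable_EFinP; exact: measurable_funX.
- by move=> x _; rewrite lee_fin sqr_ge0.
- by apply/measurable_EFinP; exact: measurable_funX.
Qed.

Lemma L2_subset (D' : set plane) u : measurable D' -> D' `<=` D -> L2 D u -> L2 D' u.
Proof.
move=> mD' sub [mr mi fin]; split; [exact: measurable_funS mr|exact: measurable_funS mi|].
apply: le_lt_trans fin; apply: ge0_subset_integral => //.
  by apply/measurable_EFinP; apply: measurable_funD; exact: measurable_funX.
by move=> x _; rewrite lee_fin addr_ge0 ?sqr_ge0.
Qed.

Lemma ReD (a b : R[i]) : Re (a + b) = Re a + Re b. Proof. by case: a; case: b. Qed.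
Lemma ImD (a b : R[i]) : Im (a + b) = Im a + Im b. Proof. by case: a; case: b. Qed.
Lemma ReM (a b : R[i]) : Re (a * b) = Re a * Re b - Im a * Im b. Proof. by case: a; case: b. Qed.
Lemma ImM (a b : R[i]) : Im (a * b) = Re a * Im b + Im a * Re b. Proof. by case: a; case: b. Qed.

Lemma L2D u v : L2 D u -> L2 D v -> L2 D (fun x => u x + v x).
Proof.
move=> /L2_sqint[ur ui] /L2_sqint[vr vi]; apply/L2_sqint.
have -> : (fun x => Re (u x + v x)) = (fun x => Re (u x) + Re (v x)) by apply/funext => x; rewrite ReD.
have -> : (fun x => Im (u x + v x)) = (fun x => Im (u x) + Im (v x)) by apply/funext => x; rewrite ImD.
by split; exact: sqintD.
Qed.

Lemma L2Z (a : R[i]) u : L2 D u -> L2 D (fun x => a * u x).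
Proof.
move=> /L2_sqint[ur ui]; apply/L2_sqint.
have -> : (fun x => Re (a * u x)) = (fun x => Re a * Re (u x) + - Im a * Im (u x)).
  by apply/funext => x; rewrite ReM mulNr.
have -> : (fun x => Im (a * u x)) = (fun x => Re a * Im (u x) + Im a * Re (u x)).
  by apply/funext => x; rewrite ImM.
by split; apply: sqintD => //; exact: sqintZ.
Qed.

Lemma L20 : L2 D (fun=> 0).
Proof.
by split => //=; rewrite integral0_eq// => x _; rewrite expr0n/= addr0.
Qed.

Let rd := rdot m D.

Local Open Scope complex_scope.
Lemma dotL2E u v : L2 D u -> L2 D v -> dotL2 D u v =
  (rd (fun x => Re (u x)) (fun x => Re (v x)) + rd (fun x => Im (u x)) (fun x => Im (v x))) +i*
  (rd (fun x => Im (u x)) (fun x => Re (v x)) - rd (fun x => Re (u x)) (fun x => Im (v x))).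
Proof.
move=> /L2_sqint[ur ui] /L2_sqint[vr vi]; rewrite /dotL2 /cintegral; congr Complex.
  rewrite -RintegralD//; [|exact: sqint_mul..].
  apply: eq_Rintegral => x _; case: (u x) (v x) => a b [a' b'] /=; ring.
rewrite -RintegralB//; [|exact: sqint_mul..].
apply: eq_Rintegral => x _; case: (u x) (v x) => a b [a' b'] /=; ring.
Qed.

Lemma dotL2Dl u v w : L2 D u -> L2 D v -> L2 D w ->
  dotL2 D (fun x => u x + v x) w = dotL2 D u w + dotL2 D v w.
Proof.
move=> Lu Lv Lw; have Luv := L2D Lu Lv; rewrite !dotL2E//.
move: Lu Lv Lw => /L2_sqint[ur ui] /L2_sqint[vr vi] /L2_sqint[wr wi].
have -> : (fun x => Re (u x + v x)) = (fun x => Re (u x) + Re (v x)) by apply/funext => x; rewrite ReD.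
have -> : (fun x => Im (u x + v x)) = (fun x => Im (u x) + Im (v x)) by apply/funext => x; rewrite ImD.
by rewrite /rd !rdotDl//; congr Complex; ring.
Qed.

Lemma dotL2Zl (a : R[i]) u w : L2 D u -> L2 D w ->
  dotL2 D (fun x => a * u x) w = a * dotL2 D u w.
Proof.
move=> Lu Lw; have Lau := L2Z a Lu; rewrite !dotL2E//.
move: Lu Lw => /L2_sqint[ur ui] /L2_sqint[wr wi].
have -> : (fun x => Re (a * u x)) = (fun x => Re a * Re (u x) + - Im a * Im (u x)).
  by apply/funext => x; rewrite ReM mulNr.
have -> : (fun x => Im (a * u x)) = (fun x => Re a * Im (u x) + Im a * Re (u x)).
  by apply/funext => x; rewrite ImM.
rewrite /rd !rdotDl//; try exact: sqintZ.
rewrite !rdotZl//; case: a Lau => a b _ /=; congr Complex => /=; ring.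
Qed.

Lemma dotL2C u v : L2 D u -> L2 D v -> dotL2 D v u = (dotL2 D u v)^*.
Proof.
move=> Lu Lv; rewrite !dotL2E//= /rd; congr Complex; rewrite !(rdotC _ _ (fun x => _ (v x)) (fun x => _ (u x))) //.
by rewrite opprB.
Qed.

Lemma ReL2 u : L2 D u -> dotL2 D u u = (\int[m]_(x in D) (Re (u x) ^+ 2 + Im (u x) ^+ 2))%:C.
Proof.
move=> Lu; rewrite dotL2E//; move: Lu => /L2_sqint[ur ui]; congr Complex; last first.
  by rewrite /rd rdotC subrr.
by rewrite /rd /rdot -RintegralD//; exact: sqint_mul.
Qed.

Lemma measurable_Re_dot u v : L2 D u -> L2 D v ->
  measurable_fun D (fun x => Re (u x * (v x)^*) : R) /\
  measurable_fun D (fun x => Im (u x * (v x)^*) : R).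
Proof.
move=> [mur mui _] [mvr mvi _]; split.
  have -> : (fun x => Re (u x * (v x)^*)) = (fun x => Re (u x) * Re (v x) + Im (u x) * Im (v x)).
    by apply/funext => x; case: (u x) (v x) => a b [a' b'] /=; ring.
  by apply: measurable_funD; exact: measurable_funM.
have -> : (fun x => Im (u x * (v x)^*)) = (fun x => Im (u x) * Re (v x) - Re (u x) * Im (v x)).
  by apply/funext => x; case: (u x) (v x) => a b [a' b'] /=; ring.
by apply: measurable_funB; exact: measurable_funM.
Qed.

Lemma dotL2_ae u u' v v' : L2 D u -> L2 D u' -> L2 D v -> L2 D v' ->
  eqL2 D u u' -> eqL2 D v v' -> dotL2 D u v = dotL2 D u' v'.
Proof.
move=> Lu Lu' Lv Lv' eu ev.
have [m1 m2] := measurable_Re_dot Lu Lv; have [m3 m4] := measurable_Re_dot Lu' Lv'.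
rewrite /dotL2 /cintegral /Rintegral; congr (Complex (fine _) (fine _)).
  apply: ae_eq_integral => //; [exact/measurable_EFinP..|].
  by apply: filterS2 eu ev => x ux vx Dx; rewrite ux// vx.
apply: ae_eq_integral => //; [exact/measurable_EFinP..|].
by apply: filterS2 eu ev => x ux vx Dx; rewrite ux// vx.
Qed.

Definition sqnorm D' u : R := \int[m]_(x in D') (Re (u x) ^+ 2 + Im (u x) ^+ 2).

Lemma L2_fin u : L2 D u -> (\int[m]_(x in D) (Re (u x) ^+ 2 + Im (u x) ^+ 2)%:E = (sqnorm D u)%:E)%E.
Proof.
move=> [_ _ fin]; rewrite /sqnorm /Rintegral fineK// ge0_fin_numE//.
by apply: integral_ge0 => x _; rewrite lee_fin addr_ge0 ?sqr_ge0.
Qed.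

Lemma measurable_sqnorm u : L2 D u -> measurable_fun D (fun x => Re (u x) ^+ 2 + Im (u x) ^+ 2).
Proof. by move=> [mr mi _]; apply: measurable_funD; exact: measurable_funX. Qed.

Lemma dotL2_eq0 u : L2 D u -> dotL2 D u u = 0 -> eqL2 D u (fun=> 0).
Proof.
move=> Lu; rewrite ReL2// => -[h0].
have mE : measurable_fun D (EFin \o (fun x => Re (u x) ^+ 2 + Im (u x) ^+ 2)).
  by apply/measurable_EFinP; exact: measurable_sqnorm.
have /(ae_eq_integral_abs m mD mE) : (\int[m]_(x in D) `|(Re (u x) ^+ 2 + Im (u x) ^+ 2)%:E| = 0)%E.
  under eq_integral do rewrite /= ger0_norm ?addr_ge0 ?sqr_ge0//.
  by rewrite L2_fin// /sqnorm h0.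
apply: filterS => x /[apply] /= -[] /eqP; rewrite paddr_eq0 ?sqr_ge0// !sqrf_eq0.
by case: (u x) => a b /= /andP[/eqP -> /eqP ->].
Qed.

End complex_square_integrable.

(** * The constants of the Schur test *)

(** The Bernstein basis of an interval, up to normalisation: a polynomial positive on a short enough
    interval is a nonnegative combination of these products, which linear arithmetic finds. *)
Lemma bernstein_products (R : realDomainType) (x y : R) n : 0 <= x -> 0 <= y ->
  forall i, (i <= n)%N -> 0 <= x ^+ i * y ^+ (n - i).
Proof. by move=> x0 y0 i _; rewrite mulr_ge0// exprn_ge0. Qed.

(** The case of a long interior arc in [arc_form_bound], squared to get rid of its root, with [d]
    a lower bound for [1 + sqrt 2 * s]. *)
Lemma excess_polynomial_pos (R : realFieldType) (s d : R) : 0 <= s -> s <= 71/100 ->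
  d = 1 + 1414 / 1000 * s ->
  s * (348 / 100 * d) ^+ 2 < (1 + s - 3 / 5 * s ^+ 2) * (4 * (87 / 100) ^+ 2 * d - 2 * (1 - s ^+ 2)) ^+ 2.
Proof.
move=> s0 sb ->.
case: (lerP s (7/20)) => sm.
- have a0 : 0 <= 7/20 - s by lra.
  have B := @bernstein_products _ s _ 6 s0 a0.
  move: (B 0 isT) (B 1 isT) (B 2 isT) (B 3 isT) (B 4 isT) (B 5 isT) (B 6 isT).
  clear B; rewrite /=.
  lra.
- have a0 : 0 <= s - 7/20 by lra.
  have b0 : 0 <= 71/100 - s by lra.
  have B := @bernstein_products _ _ _ 6 a0 b0.
  move: (B 0 isT) (B 1 isT) (B 2 isT) (B 3 isT) (B 4 isT) (B 5 isT) (B 6 isT).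
  clear B; rewrite /=.
  lra.
Qed.

(** The half angles [rho] and [eta] at the two centres enter through [cr = cos rho], [sr = sin rho],
    [ce = cos eta] and [se = sin eta]; then [s = cos (rho + eta)] and [c = sin (rho + eta)] are
    [sin (theta / 2)] and [cos (theta / 2)]. *)
Section direction_constants.
Context {R : realType}.
Variables (cr sr ce se s c : R).
Hypothesis cr0 : 0 < cr.
Hypothesis sr0 : 0 < sr.
Hypothesis ce0 : 0 < ce.
Hypothesis se0 : 0 < se.
Hypothesis r1 : cr ^+ 2 + sr ^+ 2 = 1.
Hypothesis e1 : ce ^+ 2 + se ^+ 2 = 1.
Hypothesis sE : s = cr * ce - sr * se.
Hypothesis cE : c = sr * ce + cr * se.
Hypothesis s0 : 0 < s.

Let c0 : 0 < c. Proof. by rewrite cE addr_gt0 ?mulr_gt0. Qed.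

Let sc1 : s ^+ 2 + c ^+ 2 = 1.
Proof.
have -> : s ^+ 2 + c ^+ 2 = (cr ^+ 2 + sr ^+ 2) * (ce ^+ 2 + se ^+ 2) by rewrite sE cE; ring.
by rewrite r1 e1 mulr1.
Qed.

Lemma lt_unit (x y : R) : 0 < y -> x ^+ 2 + y ^+ 2 = 1 -> x < 1.
Proof. by move=> y0 h; rewrite ltNge; apply/negP => x1; nra. Qed.

Lemma sin_sum_identity : c ^+ 2 + ce ^+ 2 - 1 + sr ^+ 2 = 2 * c * ce * sr.
Proof.
apply/eqP; rewrite -subr_eq0; apply/eqP.
transitivity (cr ^+ 2 * se ^+ 2 - (1 - ce ^+ 2) * (1 - sr ^+ 2)); first by rewrite cE; ring.
have -> : 1 - ce ^+ 2 = se ^+ 2 by rewrite -e1; ring.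
by rewrite -r1; ring. Qed.

Lemma cos_sum_identity : s ^+ 2 + ce ^+ 2 - 1 + cr ^+ 2 = 2 * s * ce * cr.
Proof.
apply/eqP; rewrite -subr_eq0; apply/eqP.
transitivity (sr ^+ 2 * se ^+ 2 - (1 - ce ^+ 2) * (1 - cr ^+ 2)); first by rewrite sE; ring.
have -> : 1 - ce ^+ 2 = se ^+ 2 by rewrite -e1; ring.
by rewrite -r1; ring. Qed.

(** The column factors of the Schur test from the interior and the exterior arc of the first circle
    to the interior arc of the second one, and the resulting bound. The first alternative is that
    the interior arc of the second circle exceeds a half circle. *)
Definition int_factor := if ce ^+ 2 < 1 / 2 then (s + c)^-1 else s.
Definition ext_factor := if ce ^+ 2 < 1 / 2 then c * (2 / (1 + Num.sqrt 2 * s)) else c.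
Definition arc_bound := if ce ^+ 2 < 1 / 2 then 87 / 100 else (1 + s) / 2.

(** The column integral of [poisson_col], whose denominator factors over [sig], compared with the
    weight [C]. *)
Lemma col_form (pf gg y sig C kap : R) : 0 < y -> 0 < gg -> sig < 1 -> 1 <= C -> 0 < sig -> 0 <= pf ->
  gg ^+ 2 + y ^+ 2 - 1 + sig ^+ 2 = 2 * gg * y * sig ->
  gg / y * (C * (1 - 2 * y ^+ 2) - sig) <= (kap - 1) * C * (C - sig + 2 * gg * y) ->
  pf * (C ^+ 2 - sig ^+ 2) * (C + gg / y) /
     (C ^+ 2 + 2 * C * gg * y + gg ^+ 2 + y ^+ 2 - 1) <= pf * kap * C.
Proof.
move=> y0 gg0 sig1 C1 sig0 pf0 idt ex.
have -> : C ^+ 2 + 2 * C * gg * y + gg ^+ 2 + y ^+ 2 - 1 = (C + sig) * (C - sig + 2 * gg * y).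
  by have -> : gg ^+ 2 = 2 * gg * y * sig - y ^+ 2 + 1 - sig ^+ 2 by [rewrite -idt; ring]; ring.
have gy : 0 < gg * y by rewrite mulr_gt0.
rewrite ler_pdivrMr; last by rewrite mulr_gt0//; lra.
set q := gg / y in ex *.
have qE : gg = q * y by rewrite /q divfK// gt_eqF.
have : (C - sig) * (C + q) <= kap * C * (C - sig + 2 * gg * y).
  move: ex; have -> : q * (C * (1 - 2 * y ^+ 2) - sig) = q * C - 2 * C * (q * y) * y - q * sig by ring.
  by rewrite -qE; lra.
have Cs0 : 0 <= pf * (C + sig) by rewrite mulr_ge0//; lra.
by move=> /(ler_wpM2l Cs0); lra.
Qed.

Let sr1 : sr < 1. Proof. exact: (lt_unit cr0 (etrans (addrC _ _) r1)). Qed.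
Let cr1 : cr < 1. Proof. exact: (lt_unit sr0 r1). Qed.
Let ce1 : ce < 1. Proof. exact: (lt_unit se0 e1). Qed.
Let se1 : se < 1. Proof. exact: (lt_unit ce0 (etrans (addrC _ _) e1)). Qed.
Let s_ce : s <= ce.
Proof.
rewrite sE; have h1 : cr * ce <= ce by rewrite ler_piMl ?ltW.
by have := mulr_gt0 sr0 se0; lra. Qed.

(** At most one of the two interior arcs exceeds a half circle. *)
Lemma cr_ge_se : se ^+ 2 < cr ^+ 2.
Proof.
have : (sr * se) ^+ 2 < (cr * ce) ^+ 2.
  by rewrite ltr_pXn2r ?nnegrE ?mulr_ge0 ?ltW//; have := s0; rewrite sE; lra.
rewrite !exprMn.
by have := r1; have := e1; nra.
Qed.

Lemma int_col (C : R) : 1 <= C ->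
  s * (C ^+ 2 - sr ^+ 2) * (C + c / ce) /
     (C ^+ 2 + 2 * C * c * ce + c ^+ 2 + ce ^+ 2 - 1) <= int_factor * C.
Proof.
move=> C1.
have -> : int_factor = s * (if ce ^+ 2 < 1 / 2 then (s * (s + c))^-1 else 1).
  rewrite /int_factor; case: ifP => _; last by rewrite mulr1.
  by rewrite invfM mulrA divff ?mul1r// gt_eqF.
apply: col_form => //; first exact: ltW; first exact: sin_sum_identity.
case: ifPn => [bad|]; last first.
  rewrite -leNgt => good; rewrite subrr !mul0r pmulr_rle0; last by rewrite divr_gt0.
  have : C * (1 - 2 * ce ^+ 2) <= 0 by rewrite mulr_ge0_le0//; lra.
  by have := sr0; lra.
have h1 : ce ^+ 2 * se ^+ 2 >= s ^+ 2 * c ^+ 2.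
  have -> : c ^+ 2 = 1 - s ^+ 2 by have := sc1; lra.
  have -> : se ^+ 2 = 1 - ce ^+ 2 by have := e1; lra.
  have sce2 : s ^+ 2 <= ce ^+ 2 by rewrite ler_pXn2r ?nnegrE//; exact: ltW.
  by nra.
have h2 : s * c <= ce * se.
  by rewrite -(@ler_pXn2r _ 2) ?nnegrE; [rewrite !exprMn| |rewrite mulr_ge0 ?(ltW s0) ?(ltW c0)|rewrite mulr_ge0 ?(ltW ce0) ?(ltW se0)].
have h3 : 2 * c * ce - sr = c * ce + s * se.
  by transitivity (2 * c * ce - sr * (ce ^+ 2 + se ^+ 2)); [rewrite e1 mulr1|rewrite sE cE; ring].
have h4 : s * (s + c) ^+ 2 <= ce * (1 + (2 * c * ce - sr)).
  rewrite h3; have -> : s * (s + c) ^+ 2 = s + c * s ^+ 2 + s * (s * c).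
    by transitivity (s * (s ^+ 2 + c ^+ 2) + c * s ^+ 2 + s * (s * c)); [ring|rewrite sc1 mulr1].
  have p1 : c * s ^+ 2 <= c * ce ^+ 2 by rewrite ler_wpM2l ?(ltW c0)// ler_pXn2r ?nnegrE//; exact: ltW.
  have p2 : s * (s * c) <= s * (ce * se) by rewrite ler_wpM2l ?(ltW s0).
  by have := s_ce; lra.
have q1 : 1 - 2 * ce ^+ 2 <= (c - s) * (c + s).
  have : s ^+ 2 <= ce ^+ 2 by rewrite ler_pXn2r ?nnegrE//; exact: ltW.
  by have := sc1; lra.
have h5 : 0 <= c - s.
  by rewrite -(pmulr_lge0 _ (addr_gt0 c0 s0)); apply: le_trans q1; lra.
have -> : (s * (s + c))^-1 - 1 = c * (c - s) / (s * (s + c)).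
  have scn : s * (s + c) != 0 by rewrite mulf_neq0 ?gt_eqF ?addr_gt0.
  apply: (mulIf scn); rewrite mulrBl mulVf// divfK//.
  by have := sc1; lra.
set T := 2 * c * ce - sr in h4.
have -> : C - sr + 2 * c * ce = C + T by rewrite /T; ring.
apply: (@le_trans _ _ (c / ce * (C * ((c - s) * (c + s))))).
  rewrite ler_wpM2l ?divr_ge0 ?(ltW c0) ?(ltW ce0)//.
  have := @ler_wpM2l _ C _ _ _ q1; have := sr0; lra.
rewrite (_ : c / ce * (C * ((c - s) * (c + s))) = c * C * (c - s) * ((c + s) / ce)); last by ring.
rewrite (_ : c * (c - s) / (s * (s + c)) * C * (C + T) = c * C * (c - s) * ((C + T) / (s * (s + c)))); last by ring.
rewrite ler_wpM2l ?mulr_ge0 ?(ltW c0)//; first lra.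
rewrite ler_pdivrMr// mulrAC ler_pdivlMr ?mulr_gt0 ?addr_gt0//.
by have := ce0; nra.
Qed.

Lemma ext_col (C : R) : 1 <= C ->
  c * (C ^+ 2 - cr ^+ 2) * (C + s / ce) /
     (C ^+ 2 + 2 * C * s * ce + s ^+ 2 + ce ^+ 2 - 1) <= ext_factor * C.
Proof.
move=> C1; pose r : R := Num.sqrt 2.
have r2 : r ^+ 2 = 2 by rewrite sqr_sqrtr.
have r0 : 0 <= r by exact: sqrtr_ge0.
have d0 : 0 < 1 + r * s by rewrite ltr_pwDl// mulr_ge0// ltW.
have -> : ext_factor = c * (if ce ^+ 2 < 1 / 2 then 2 / (1 + r * s) else 1).
  by rewrite /ext_factor; case: ifP => _; rewrite ?mulr1.
apply: col_form => //; first exact: ltW; first exact: cos_sum_identity.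
case: ifPn => [bad|]; last first.
  rewrite -leNgt => good; rewrite subrr !mul0r pmulr_rle0; last by rewrite divr_gt0.
  have : C * (1 - 2 * ce ^+ 2) <= 0 by rewrite mulr_ge0_le0//; lra.
  by have := cr0; lra.
set q := 1 - 2 * ce ^+ 2.
have q0 : 0 < q by rewrite /q; lra.
have qs : q <= 1 - 2 * s ^+ 2.
  have : s ^+ 2 <= ce ^+ 2 by rewrite ler_pXn2r ?nnegrE//; exact: ltW.
  by rewrite /q; lra.
have qc : q <= cr.
  have : se < cr by rewrite -(@ltr_pXn2r _ 2) ?nnegrE ?(ltW cr0) ?(ltW se0)//; exact: cr_ge_se.
  have : q <= se ^+ 2 by rewrite /q; have := e1; have := sqr_ge0 ce; lra.
  have : se ^+ 2 <= se by rewrite expr2 ler_piMl ?(ltW se1) ?(ltW se0).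
  lra.
have -> : 2 / (1 + r * s) - 1 = (1 - 2 * s ^+ 2) / (1 + r * s) ^+ 2.
  have dn : (1 + r * s) ^+ 2 != 0 by rewrite expf_neq0// gt_eqF.
  apply: (mulIf dn); rewrite divfK// mulrBl [X in _ * X]expr2 mulrA divfK ?gt_eqF//.
  by have -> : 2 * s ^+ 2 = (r * s) ^+ 2 by [rewrite exprMn r2]; ring.
apply: (@le_trans _ _ (s / ce * (q * (C - 1)))).
  rewrite ler_wpM2l ?divr_ge0 ?(ltW s0) ?(ltW ce0)//; lra.
have C10 : 0 <= C - 1 by lra.
apply: (@le_trans _ _ ((1 - 2 * s ^+ 2) * (C - 1))).
  rewrite -[leRHS]mul1r ler_pM ?mulr_ge0 ?divr_ge0 ?invr_ge0 ?(ltW q0) ?(ltW ce0) ?(ltW s0)//.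
  - by rewrite ler_pdivrMr// mul1r.
  - by rewrite ler_wpM2r.
rewrite -!mulrA ler_wpM2l; [|lra|].
  done.
rewrite -ler_pdivrMl ?invr_gt0 ?exprn_gt0// invrK.
have low : C - 1 + 2 * s ^+ 2 <= C - cr + 2 * s * ce.
  by have := cr1; have := ler_wpM2l (ltW s0) s_ce; lra.
apply: (@le_trans _ _ (C * (C - 1 + 2 * s ^+ 2))); last by rewrite ler_wpM2l//; lra.
rewrite -subr_ge0; have -> : 2 * s ^+ 2 = (r * s) ^+ 2 by rewrite exprMn r2.
have -> : C * (C - 1 + (r * s) ^+ 2) - (1 + r * s) ^+ 2 * (C - 1) = (C - 1 - r * s) ^+ 2 by ring.
exact: sqr_ge0.
Qed.

(** If the factors are [s] and [c], the form is [s x ^ 2 + c x y], whose largest eigenvalue is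
    [(1 + s) / 2] since [s ^ 2 + c ^ 2 = 1]. *)
Lemma arc_form_bound (x y : R) : 0 <= x -> 0 <= y ->
  (Num.sqrt (s * int_factor) * x + Num.sqrt (c * ext_factor) * y) * x <=
  arc_bound * (x ^+ 2 + y ^+ 2).
Proof.
move=> x0 y0.
suff [sl lam] : Num.sqrt (s * int_factor) < arc_bound /\
    c * ext_factor <= 4 * arc_bound * (arc_bound - Num.sqrt (s * int_factor)).
  set A := Num.sqrt _ in sl lam *; set B := Num.sqrt _; set L := arc_bound in sl lam *.
  have L0 : 0 < L by apply: le_lt_trans sl; exact: sqrtr_ge0.
  have B2 : B ^+ 2 <= 4 * L * (L - A).
    have [h|h] := lerP 0 (c * ext_factor); first by rewrite sqr_sqrtr.
    by rewrite /B ltr0_sqrtr// expr0n/=; rewrite !mulr_ge0//; lra.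
  rewrite -subr_ge0 -(pmulr_lge0 _ L0); set E := (X in 0 <= X).
  have -> : E = (L * y - B * x / 2) ^+ 2 + x ^+ 2 * (4 * L * (L - A) - B ^+ 2) / 4.
    by rewrite /E; field.
  by rewrite addr_ge0 ?sqr_ge0// divr_ge0// mulr_ge0 ?sqr_ge0// subr_ge0.
rewrite /int_factor /ext_factor /arc_bound; case: ifPn => [bad|_]; last first.
  rewrite -expr2 sqrtr_sqr ger0_norm ?(ltW s0)//; split.
    by have := sc1; have := sqr_ge0 c; have := c0; have := s0; nra.
  by have := sc1; lra.
have s2 : s ^+ 2 <= 1 / 2.
  have : s ^+ 2 <= ce ^+ 2 by rewrite ler_pXn2r ?nnegrE//; exact: ltW.
  lra.
have s71 : s <= 71 / 100 by have := s0; nra.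
have clow : 1 - 3 / 5 * s ^+ 2 <= c.
  rewrite -(@ler_pXn2r _ 2) ?nnegrE ?(ltW c0)//; last lra.
  by have := sc1; have := sqr_ge0 s; nra.
pose r : R := Num.sqrt 2.
have r0 : 0 <= r by exact: sqrtr_ge0.
have r2 : r ^+ 2 = 2 by rewrite sqr_sqrtr.
have rl : 1414 / 1000 <= r by nra.
pose d := 1 + 1414 / 1000 * s.
have d0 : 0 < d by rewrite /d; have := s0; lra.
have dr : d <= 1 + r * s by rewrite lerD2l ler_wpM2r ?(ltW s0).
have sc_low : 1 + s - 3 / 5 * s ^+ 2 <= s + c by lra.
pose A := 4 * (87 / 100) ^+ 2 * d - 2 * (1 - s ^+ 2).
have A0 : 0 < A.
  by rewrite /A /d; have := s0; have := sqr_ge0 s; lra.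
have scn : 0 < s + c by rewrite addr_gt0.
set q := Num.sqrt (s * (s + c)^-1).
have q0 : 0 <= q by exact: sqrtr_ge0.
have qA : 348 / 100 * q * d <= A.
  have l0 : 0 <= 348 / 100 * q * d.
    by apply: mulr_ge0 (ltW d0); apply: mulr_ge0 q0; apply: divr_ge0; exact: ler0n.
  have l1 : 348 / 100 * q * d \is Num.nneg by rewrite nnegrE.
  have A1 : A \is Num.nneg by rewrite nnegrE (ltW A0).
  rewrite -(ler_pXn2r (ltn0Sn 1) l1 A1).
  have -> : (348 / 100 * q * d) ^+ 2 = s * (348 / 100 * d) ^+ 2 / (s + c).
    by rewrite !exprMn sqr_sqrtr ?divr_ge0 ?(ltW s0) ?(ltW scn)//; ring.
  rewrite ler_pdivrMr//; apply: le_trans (ltW (excess_polynomial_pos (ltW s0) s71 (erefl d))) _.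
  by rewrite mulrC ler_wpM2l ?sqr_ge0.
have qA' : 348 / 100 * q <= A / d by rewrite ler_pdivlMr.
have AdE : A / d = 4 * (87 / 100) ^+ 2 - 2 * (1 - s ^+ 2) / d.
  by rewrite /A mulrBl mulfK ?gt_eqF.
have cE2 : c ^+ 2 = 1 - s ^+ 2 by rewrite -sc1; ring.
have n0 : 0 < 2 * (1 - s ^+ 2) by rewrite -cE2 mulr_gt0// exprn_gt0.
have p0 : 0 < 2 * (1 - s ^+ 2) / d by rewrite divr_gt0.
have le2 : c * (c * (2 / (1 + r * s))) <= 2 * (1 - s ^+ 2) / d.
  have -> : c * (c * (2 / (1 + r * s))) = 2 * c ^+ 2 / (1 + r * s) by ring.
  by rewrite cE2 ler_pM2l// lef_pV2 ?posrE//; apply: lt_le_trans dr.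
move: AdE p0 le2 qA'; set w := A / d; set v := 2 * _ / d; set u := c * _.
move=> AdE p0 le2 qA'; split; first by lra.
by apply: le_trans le2 _; lra.
Qed.

End direction_constants.

(** * The Poisson operator between the two circles *)

Section arc_measure.
Context {R : realType}.
Local Notation plane := (R * R)%type.
Implicit Types (x y z c M e : plane) (r l h : R).

Lemma arc_weight_ge1 M e l cg sg y : e.1 ^+ 2 + e.2 ^+ 2 = 1 -> 0 < l ->
  cg ^+ 2 + sg ^+ 2 = 1 -> sg != 0 -> arc M e l cg sg y -> 1 <= arc_weight M e l y.
Proof.
move=> e1 l0 g1 s0 /(arc_param_pt e1 l0 g1 s0)[w0 _]; rewrite /arc_weight.
set w := arc_param M e l y in w0 *.
rewrite ler_pdivlMr// mul1r -subr_ge0.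
have -> : w + w^-1 - 2 = (w - 1) ^+ 2 / w by field; rewrite gt_eqF.
by rewrite divr_ge0 ?sqr_ge0 ?ltW.
Qed.

Lemma pker_arc_gt0 M e l h r cg sg cg' sg' v w : e.1 ^+ 2 + e.2 ^+ 2 = 1 -> 0 < l ->
  cg ^+ 2 + sg ^+ 2 = 1 -> sg != 0 -> cg' ^+ 2 + sg' ^+ 2 = 1 -> sg' != 0 ->
  r ^+ 2 = h ^+ 2 + l ^+ 2 -> 0 < r -> h * sg' = - (l * cg') -> r * `|sg'| = l ->
  0 < `|sg * cg' - cg * sg'| -> 0 < v :> R -> 0 < w :> R ->
  0 < pker (frame_pt M e h 0) r (arc_pt M e l cg sg v) (arc_pt M e l cg' sg' w).
Proof.
move=> e1 l0 g1 s0 g1' s0' rl r0 hE rE S0 v0 w0.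
rewrite /frame_pt !mul0r subr0 addr0 (pker_arc M e1 l0 g1 s0 g1' s0' rl hE rE S0 v0 w0).
have kS : (cg * cg' + sg * sg') ^+ 2 + `|sg * cg' - cg * sg'| ^+ 2 = 1.
  rewrite real_normK ?num_real//.
  transitivity ((cg ^+ 2 + sg ^+ 2) * (cg' ^+ 2 + sg' ^+ 2)); first by ring.
  by rewrite g1 g1' mulr1.
rewrite divr_gt0 ?mulr_gt0 ?exprn_gt0 ?pi_gt0//.
  by apply: quartic_gt0 => //; exact: arc_cos_bounds s0'.
apply: quartic_gt0 => //; move: kS; move: S0; set k := _ + _; set S := `|_|.
by move=> S0 kS; apply/andP; split; nra.
Qed.

(** Seen from a fixed point of the other arc, the kernel is bounded below along the circle, so that
    the finite row integral bounds the length. *)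
Lemma arc_finite M e l h r cg sg cg' sg' : e.1 ^+ 2 + e.2 ^+ 2 = 1 -> 0 < l ->
  cg ^+ 2 + sg ^+ 2 = 1 -> sg != 0 -> cg' ^+ 2 + sg' ^+ 2 = 1 -> sg' != 0 ->
  r ^+ 2 = h ^+ 2 + l ^+ 2 -> 0 < r -> h * sg' = - (l * cg') -> r * `|sg'| = l ->
  0 < `|sg * cg' - cg * sg'| ->
  arc M e l cg' sg' `<=` [set y | enorm (y - frame_pt M e h 0) = r] ->
  (hausdorff1 (arc M e l cg' sg') < +oo)%E.
Proof.
move=> e1 l0 g1 s0 g1' s0' rl r0 hE rE S0 sub.
set c := frame_pt M e h 0 in sub.
have cE : c = (M.1 + h * e.1, M.2 + h * e.2) by rewrite /c /frame_pt !mul0r subr0 addr0.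
have row := poisson_row M e1 l0 g1 s0 g1' s0' rl r0 hE rE S0 (@ltr01 R).
rewrite -cE in row; set x := arc_pt M e l cg sg 1 in row.
set A := arc M e l cg' sg' in sub row *.
have mA : measurable A by exact: measurable_arc.
pose del := `|r ^+ 2 - enorm (x - c) ^+ 2| / (r * (enorm (x - c) + r) ^+ 2) / (2 * pi).
have pos w : 0 < w -> 0 < pker c r x (arc_pt M e l cg' sg' w).
  by move=> w0; apply: pker_arc_gt0.
have n0 : r ^+ 2 - enorm (x - c) ^+ 2 != 0.
  by apply/eqP => n0; have := pos 1 ltr01; rewrite /pker n0 normr0 !mul0r ltxx.
have P0 : 0 < 2 * pi :> R by rewrite mulr_gt0 ?pi_gt0.
have c0 : 0 < enorm (x - c) + r by rewrite ltr_wpDl ?enorm_ge0.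
have del0 : 0 < del.
  by rewrite divr_gt0// divr_gt0 ?normr_gt0// mulr_gt0// exprn_gt0.
have : (del%:E * hausdorff1 A <= (Num.sqrt ((1 + (cg * cg' + sg * sg')) / 2) * arc_weight M e l x)%:E)%E.
  apply: le_trans row; rewrite -integral_cst//; apply: ge0_le_integral => //.
  - by move=> y _; rewrite lee_fin ltW.
  - apply/measurable_EFinP; apply: measurable_funM.
      by apply: measurable_pker; [exact: measurable_cst|exact: measurable_id].
    exact: measurable_arc_weight.
  - move=> y Ay; rewrite lee_fin -[leLHS]mulr1; apply: ler_pM => //; first exact: ltW.
      rewrite /pker /del ler_pM2r ?invr_gt0// ler_pM2l ?normr_gt0//.
      have xy : 0 < enorm (x - y).
        rewrite lt_neqAle enorm_ge0 andbT; apply/eqP => xy0.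
        have [w0 yE] := arc_param_pt e1 l0 g1' s0' Ay.
        have := pos _ w0; rewrite yE /pker -xy0 expr0n/= mulr0 invr0 mulr0 mul0r.
        by rewrite ltxx.
      have le1 : enorm (x - y) <= enorm (x - c) + r.
        by apply: le_trans (enorm_triangle _ c _) _; rewrite lerD2l enorm_distC (sub y Ay).
      rewrite lef_pV2 ?posrE ?mulr_gt0 ?exprn_gt0// ler_pM2l// ler_pXn2r ?nnegrE ?enorm_ge0//.
      exact: ltW.
    exact: (arc_weight_ge1 e1 l0 g1' s0').
move=> h1; rewrite ltNge; apply/negP; rewrite leye_eq => /eqP h2.
by move: h1; rewrite h2 mulry gtr0_sg// mul1e leye_eq.
Qed.

End arc_measure.

Section direction.
Context {R : realType}.
Local Notation plane := (R * R)%type.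
Variables (c1 : plane) (r1 : R) (c2 : plane) (r2 : R) (M e : plane) (l h1 h2 : R).
Hypothesis r10 : 0 < r1.
Hypothesis r20 : 0 < r2.
Hypothesis fr : lens_frame c1 r1 c2 r2 M e l h1 h2.
Variables (cr sr ce se : R).
Hypothesis cr0 : 0 < cr.
Hypothesis sr0 : 0 < sr.
Hypothesis ce0 : 0 < ce.
Hypothesis se0 : 0 < se.
Hypothesis rr1 : cr ^+ 2 + sr ^+ 2 = 1.
Hypothesis ee1 : ce ^+ 2 + se ^+ 2 = 1.
Hypothesis h1E : h1 / r1 = sr ^+ 2 - cr ^+ 2.
Hypothesis l1E : l / r1 = 2 * sr * cr.
Hypothesis h2E : h2 / r2 = ce ^+ 2 - se ^+ 2.
Hypothesis l2E : l / r2 = 2 * se * ce.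
Let s := cr * ce - sr * se.
Let c := sr * ce + cr * se.
Hypothesis s0 : 0 < s.

Let e1 : e.1 ^+ 2 + e.2 ^+ 2 = 1. Proof. by case: fr. Qed.
Let l0 : 0 < l. Proof. by case: fr. Qed.
Let rl1 : r1 ^+ 2 = h1 ^+ 2 + l ^+ 2. Proof. by case: fr => _ _ _ _ []. Qed.
Let rl2 : r2 ^+ 2 = h2 ^+ 2 + l ^+ 2. Proof. by case: fr => _ _ _ _ []. Qed.
Let cE1 : c1 = (M.1 + h1 * e.1, M.2 + h1 * e.2).
Proof. by case: fr => _ _ _ [-> _] _; rewrite /frame_pt !mul0r subr0 addr0. Qed.

Let c0 : 0 < c. Proof. by rewrite addr_gt0 ?mulr_gt0. Qed.

Let sc1 : s ^+ 2 + c ^+ 2 = 1.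
Proof.
have -> : s ^+ 2 + c ^+ 2 = (cr ^+ 2 + sr ^+ 2) * (ce ^+ 2 + se ^+ 2) by rewrite /s /c; ring.
by rewrite rr1 ee1 mulr1.
Qed.

Let A1 := arc_int r1 M e l h1.
Let E1 := arc_ext r1 M e l h1.
Let A2 := arc M e l (- (h2 / r2)) (l / r2).

Let g2 : (- (h2 / r2)) ^+ 2 + (l / r2) ^+ 2 = 1.
Proof. by rewrite sqrrN !expr_div_n -mulrDl -rl2 divff// expf_neq0// gt_eqF. Qed.
Let g1i : (h1 / r1) ^+ 2 + (- (l / r1)) ^+ 2 = 1.
Proof. by rewrite sqrrN !expr_div_n -mulrDl -rl1 divff// expf_neq0// gt_eqF. Qed.
Let g1e : (- (h1 / r1)) ^+ 2 + (l / r1) ^+ 2 = 1.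
Proof. by rewrite sqrrN !expr_div_n -mulrDl -rl1 divff// expf_neq0// gt_eqF. Qed.
Let s2 : l / r2 != 0. Proof. by rewrite mulf_neq0 ?invr_eq0 ?gt_eqF. Qed.
Let s1e : l / r1 != 0. Proof. by rewrite mulf_neq0 ?invr_eq0 ?gt_eqF. Qed.
Let s1i : - (l / r1) != 0. Proof. by rewrite oppr_eq0. Qed.
Let lr10 : 0 < l / r1. Proof. by rewrite divr_gt0. Qed.
Let hi : h1 * - (l / r1) = - (l * (h1 / r1)). Proof. by ring. Qed.
Let he : h1 * (l / r1) = - (l * - (h1 / r1)). Proof. by ring. Qed.
Let ri : r1 * `|- (l / r1)| = l.
Proof. by rewrite normrN ger0_norm ?(ltW lr10)// mulrC divfK// gt_eqF. Qed.
Let re : r1 * `|l / r1| = l.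
Proof. by rewrite ger0_norm ?(ltW lr10)// mulrC divfK// gt_eqF. Qed.

Let ki : - (h2 / r2) * (h1 / r1) + l / r2 * - (l / r1) = 1 - 2 * c ^+ 2.
Proof.
have -> : 1 - 2 * c ^+ 2 = s ^+ 2 - c ^+ 2 by have := sc1; lra.
by rewrite h1E h2E l1E l2E /s /c; ring.
Qed.
Let ke : - (h2 / r2) * - (h1 / r1) + l / r2 * (l / r1) = 1 - 2 * s ^+ 2.
Proof.
have -> : 1 - 2 * s ^+ 2 = c ^+ 2 - s ^+ 2 by have := sc1; lra.
by rewrite h1E h2E l1E l2E /s /c; ring.
Qed.
Let Si : `|l / r2 * (h1 / r1) - - (h2 / r2) * - (l / r1)| = 2 * s * c.
Proof.
have -> : l / r2 * (h1 / r1) - - (h2 / r2) * - (l / r1) = - (2 * s * c).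
  by rewrite h1E h2E l1E l2E /s /c; ring.
by rewrite normrN ger0_norm// !mulr_ge0// ltW.
Qed.
Let Se : `|l / r2 * - (h1 / r1) - - (h2 / r2) * (l / r1)| = 2 * s * c.
Proof.
have -> : l / r2 * - (h1 / r1) - - (h2 / r2) * (l / r1) = 2 * s * c.
  by rewrite h1E h2E l1E l2E /s /c; ring.
by rewrite ger0_norm// !mulr_ge0// ltW.
Qed.
Let Si0 : 0 < `|l / r2 * (h1 / r1) - - (h2 / r2) * - (l / r1)|.
Proof. by rewrite Si !mulr_gt0. Qed.
Let Se0 : 0 < `|l / r2 * - (h1 / r1) - - (h2 / r2) * (l / r1)|.
Proof. by rewrite Se !mulr_gt0. Qed.

Let wt := arc_weight M e l.

Let A2E : A2 = arc_int r2 M (- e.1, - e.2) l (- h2).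
Proof. by rewrite /arc_int arc_flip opprK mulNr. Qed.

Let A2_circle : A2 `<=` circle c2 r2.
Proof. by rewrite A2E; apply: (@arc_int_circle R c2 r2 c1 r1 M _ l (- h2) (- h1)) => //; exact: lens_frame_sym. Qed.

Let A2_finite : (hausdorff1 A2 < +oo)%E.
Proof.
apply: (@arc_finite R M e l h2 r2 (h1 / r1) (- (l / r1))) => //.
- by ring.
- by rewrite ger0_norm ?divr_ge0 ?ltW// mulrC divfK// gt_eqF.
- by rewrite distrC; move: Si0; rewrite [_ * (h1 / r1)]mulrC [- (h2 / r2) * _]mulrC.
- by move=> x /A2_circle; rewrite circleE//; case: fr => _ _ _ [_ ->].
Qed.

Let wt_gt0 cg sg y : cg ^+ 2 + sg ^+ 2 = 1 -> sg != 0 -> arc M e l cg sg y -> 0 < wt y.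
Proof. by move=> g s' /(arc_weight_ge1 e1 l0 g s'); apply: lt_le_trans. Qed.

Let ce2E : - (h2 / r2) = 1 - 2 * ce ^+ 2. Proof. by have := ee1; rewrite h2E; lra. Qed.

(** Both arcs of the first circle are treated alike: they differ by the sign of [sg'] and by which of
    [s] and [c] is the sine of half the angle between the two arcs. *)
Lemma arc_schur (cg' sg' gg pf sig fac : R) (f V : plane -> R) :
  cg' ^+ 2 + sg' ^+ 2 = 1 -> sg' != 0 -> h1 * sg' = - (l * cg') -> r1 * `|sg'| = l ->
  - (h2 / r2) * cg' + l / r2 * sg' = 1 - 2 * gg ^+ 2 ->
  `|l / r2 * cg' - - (h2 / r2) * sg'| = 2 * gg * pf ->
  0 < gg -> 0 < pf -> gg ^+ 2 + pf ^+ 2 = 1 -> cg' = 2 * sig ^+ 2 - 1 -> 0 <= fac ->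
  (forall C, 1 <= C -> pf * (C ^+ 2 - sig ^+ 2) * (C + gg / ce) /
     (C ^+ 2 + 2 * C * gg * ce + gg ^+ 2 + ce ^+ 2 - 1) <= fac * C) ->
  arc M e l cg' sg' `<=` circle c1 r1 ->
  measurable_fun [set: plane] f -> (forall y, 0 <= f y) ->
  measurable_fun A2 V -> (forall x, A2 x -> 0 <= V x) ->
  (forall x, A2 x ->
    ((V x)%:E <= \int[hausdorff1]_(y in arc M e l cg' sg') (pker c1 r1 x y * f y)%:E)%E) ->
  (\int[hausdorff1]_(x in A2) (V x ^+ 2)%:E <=
   (pf * fac)%:E * \int[hausdorff1]_(y in arc M e l cg' sg') (f y ^+ 2)%:E)%E.
Proof.
move=> g' s' hE rE kE SE gg0 pf0 gp sigE fac0 col sub mf f0 mV V0 VK.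
have S0 : 0 < `|l / r2 * cg' - - (h2 / r2) * sg'| by rewrite SE !mulr_gt0.
have fin : (hausdorff1 (arc M e l cg' sg') < +oo)%E.
  apply: (arc_finite e1 l0 g2 s2 g' s' rl1 r10 hE rE S0) => y /sub.
  by rewrite circleE//; case: fr => _ _ _ [-> _].
have mpk : measurable_fun [set: plane * plane] (fun z => pker c1 r1 z.1 z.2).
  by apply: measurable_pker; [exact: measurable_fst|exact: measurable_snd].
apply: (schur_test (measurable_arc _ _ _ _ _) (measurable_arc _ _ _ _ _) A2_finite fin
  (K := fun z => pker c1 r1 z.1 z.2) (a := wt) (b := wt)) => //=.
- by apply: measurable_arc_weight; exact: measurable_id.
- by apply: measurable_arc_weight; exact: measurable_id.
- by move=> z; exact: pker_ge0 (ltW r10).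
- by move=> x; exact: arc_weight_ge0.
- by move=> x; exact: arc_weight_ge0.
- by move=> x; exact: wt_gt0.
- by move=> x; exact: wt_gt0.
- move=> x Ax; have [v0 <-] := arc_param_pt e1 l0 g2 s2 Ax.
  have := poisson_row M e1 l0 g2 s2 g' s' rl1 r10 hE rE S0 v0.
  rewrite -cE1 kE; have -> : (1 + (1 - 2 * gg ^+ 2)) / 2 = pf ^+ 2 by lra.
  by rewrite sqrtr_sqr gtr0_norm.
- move=> y Ay; have [w0 yE] := arc_param_pt e1 l0 g' s' Ay.
  have w1 : arc_param M e l y != 1 by case: Ay.
  have := poisson_col M e1 l0 g2 s2 g' s' rl1 r10 hE rE S0 gg0 ce0 kE ce2E sigE w0 w1 (erefl _).
  rewrite yE -cE1 SE => /le_trans; apply; rewrite lee_fin.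
  have -> : 2 * gg * pf / (2 * gg) = pf by field; rewrite gt_eqF.
  by apply: col; exact: (arc_weight_ge1 e1 l0 g' s').
Qed.

Lemma int_schur (f V : plane -> R) :
  measurable_fun [set: plane] f -> (forall y, 0 <= f y) ->
  measurable_fun A2 V -> (forall x, A2 x -> 0 <= V x) ->
  (forall x, A2 x -> ((V x)%:E <= \int[hausdorff1]_(y in A1) (pker c1 r1 x y * f y)%:E)%E) ->
  (\int[hausdorff1]_(x in A2) (V x ^+ 2)%:E <=
   (s * int_factor ce s c)%:E * \int[hausdorff1]_(y in A1) (f y ^+ 2)%:E)%E.
Proof.
apply: (arc_schur (gg := c) (sig := sr)) => //.
- by rewrite Si; ring.
- by rewrite addrC.
- by have := rr1; rewrite h1E; lra.
- by rewrite /int_factor; case: ifP => _; [rewrite invr_ge0 ltW// addr_gt0|exact: ltW].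
- by move=> C C1; exact: (int_col cr0 sr0 ce0 se0 rr1 ee1).
- exact: (arc_int_circle r10 fr).
Qed.

Lemma ext_schur (f V : plane -> R) :
  measurable_fun [set: plane] f -> (forall y, 0 <= f y) ->
  measurable_fun A2 V -> (forall x, A2 x -> 0 <= V x) ->
  (forall x, A2 x -> ((V x)%:E <= \int[hausdorff1]_(y in E1) (pker c1 r1 x y * f y)%:E)%E) ->
  (\int[hausdorff1]_(x in A2) (V x ^+ 2)%:E <=
   (c * ext_factor ce s c)%:E * \int[hausdorff1]_(y in E1) (f y ^+ 2)%:E)%E.
Proof.
apply: (arc_schur (gg := s) (sig := cr)) => //.
- by have := rr1; rewrite h1E; lra.
- rewrite /ext_factor; case: ifP => _; last exact: ltW.
  by rewrite mulr_ge0 ?(ltW c0)// divr_ge0// addr_ge0// mulr_ge0 ?sqrtr_ge0 ?(ltW s0).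
- by move=> C C1; exact: (ext_col cr0 sr0 ce0 se0 rr1 ee1).
- exact: (arc_ext_circle r10 fr).
Qed.


Local Open Scope complex_scope.
Local Notation Re := complex.Re.
Local Notation Im := complex.Im.
Let m : {measure set plane -> \bar R} := hausdorff1.
Let C1 := circle c1 r1.
Let C2 := circle c2 r2.
Let I1 := circle_int c1 r1 c2 r2.
Let I2 := circle_int c2 r2 c1 r1.
Let X1 := C1 `\` I1.
Let fr' : lens_frame c2 r2 c1 r1 M (- e.1, - e.2) l (- h2) (- h1) := lens_frame_sym fr.

Let mC1 : measurable C1. Proof. exact: (measurable_circle r10 fr). Qed.
Let mC2 : measurable C2. Proof. exact: (measurable_circle r20 fr'). Qed.
Let mI1 : measurable I1. Proof. exact: (measurable_circle_int r10 r20 fr). Qed.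
Let mI2 : measurable I2. Proof. exact: (measurable_circle_int r20 r10 fr'). Qed.
Let mX1 : measurable X1. Proof. exact: measurableD. Qed.
Let IC1 : I1 `<=` C1. Proof. by move=> x []. Qed.
Let IC2 : I2 `<=` C2. Proof. by move=> x []. Qed.

Let circle_fin : (m C1 < +oo)%E.
Proof.
have cov : C1 `<=` A1 `|` E1 `|` lens_exceptional r1 M e l h1.
  by move=> x cx; case: (circle_arcs r10 fr cx); [left; left|left; right|right].
have finA : (hausdorff1 A1 < +oo)%E.
  apply: (arc_finite e1 l0 g2 s2 g1i s1i rl1 r10 hi ri Si0) => y /(arc_int_circle r10 fr).
  by rewrite circleE//; case: fr => _ _ _ [-> _].
have finE : (hausdorff1 E1 < +oo)%E.
  apply: (arc_finite e1 l0 g2 s2 g1e s1e rl1 r10 he re Se0) => y /(arc_ext_circle r10 fr).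
  by rewrite circleE//; case: fr => _ _ _ [-> _].
apply: le_lt_trans (le_hausdorff1 cov) _.
have := @outer_measureU2 _ _ hausdorff1 (A1 `|` E1) (lens_exceptional r1 M e l h1).
move=> /le_lt_trans; apply; rewrite /= exceptional_null adde0.
have := @outer_measureU2 _ _ hausdorff1 A1 E1.
by move=> /le_lt_trans; apply; rewrite lte_add_pinfty.
Qed.

Let I1_fin : (m I1 < +oo)%E.
Proof. by apply: le_lt_trans circle_fin; exact: le_hausdorff1. Qed.
Let X1_fin : (m X1 < +oo)%E.
Proof. by apply: le_lt_trans circle_fin; apply: le_hausdorff1 => x []. Qed.

Let pk := pker c1 r1.
Let pk0 x y : 0 <= pk x y. Proof. exact: pker_ge0 (ltW r10). Qed.
Let mpk : measurable_fun [set: plane * plane] (fun z => pk z.1 z.2).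
Proof. by apply: measurable_pker; [exact: measurable_fst|exact: measurable_snd]. Qed.
Let mpkx x : measurable_fun [set: plane] (pk x).
Proof. by apply: measurable_pker; [exact: measurable_cst|exact: measurable_id]. Qed.

Let pk_sqint x : enorm (x - c1) <= r1 -> sqint m C1 (pk x).
Proof.
rewrite le_eqVlt => /orP[/eqP xr|xr]; split; try exact: measurable_funTS.
  by rewrite integral0_eq// => y _; rewrite /pk /pker xr subrr normr0 !mul0r expr0n.
pose K := `|r1 ^+ 2 - enorm (x - c1) ^+ 2| / (r1 * (r1 - enorm (x - c1)) ^+ 2) / (2 * pi).
have P0 : 0 < 2 * pi :> R by rewrite mulr_gt0 ?pi_gt0.
apply: (@le_lt_trans _ _ (\int[m]_(y in C1) (K ^+ 2)%:E)%E).
  apply: ge0_le_integral => //.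
  - by move=> y _; rewrite lee_fin sqr_ge0.
  - by apply/measurable_EFinP; apply: measurable_funX; exact: measurable_funTS.
  - move=> y Cy; have {}Cy : enorm (y - c1) = r1 by move: Cy; rewrite /C1 circleE.
    have xy : 0 < r1 - enorm (x - c1) by rewrite subr_gt0.
    have le1 : r1 - enorm (x - c1) <= enorm (x - y).
      by have := enorm_triangle y x c1; rewrite Cy [enorm (y - x)]enorm_distC; lra.
    rewrite lee_fin ler_pXn2r ?nnegrE//; last first.
      by rewrite divr_ge0 ?(ltW P0)// divr_ge0// mulr_ge0 ?(ltW r10)// sqr_ge0.
    rewrite /pk /pker /K ler_pM2r ?invr_gt0// ler_wpM2l//.
    have xy' := lt_le_trans xy le1.
    rewrite lef_pV2 ?posrE ?mulr_gt0 ?exprn_gt0// ler_pM2l// ler_pXn2r ?nnegrE ?enorm_ge0//.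
    exact: ltW.
by rewrite integral_cst// lte_mul_pinfty// lee_fin sqr_ge0.
Qed.

Let I2_closed x : I2 x -> enorm (x - c1) <= r1.
Proof. by move=> /(circle_int_le r20)[]. Qed.

Let pk_integrable x g : I2 x -> sqint m C1 g ->
  m.-integrable C1 (EFin \o (fun y => pk x y * g y)).
Proof. by move=> /I2_closed/pk_sqint sx sg; exact: sqint_mul. Qed.

Let poissonE u x : L2 C1 u -> I2 x ->
  poisson c1 r1 u x = (\int[m]_(y in C1) (pk x y * Re (u y))) +i*
                      (\int[m]_(y in C1) (pk x y * Im (u y))).
Proof.
move=> /(L2_sqint mC1)[ur ui] Ix; have xr := I2_closed Ix.
have pkE y : pk x y = (2 * pi)^-1 * ((r1 ^+ 2 - enorm (x - c1) ^+ 2) / (r1 * enorm (x - y) ^+ 2)).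
  rewrite /pk /pker ger0_norm; first by rewrite mulrC.
  by rewrite subr_ge0 ler_pXn2r ?nnegrE ?enorm_ge0 ?(ltW r10).
have P0 : (2 * pi : R) != 0 by rewrite mulf_neq0 ?gt_eqF ?pi_gt0.
have kint g : sqint m C1 g -> (2 * pi)^-1 * \int[m]_(y in C1)
     ((r1 ^+ 2 - enorm (x - c1) ^+ 2) / (r1 * enorm (x - y) ^+ 2) * g y) =
     \int[m]_(y in C1) (pk x y * g y).
  move=> sg; rewrite -RintegralZl//.
    by apply: eq_Rintegral => y _; rewrite pkE mulrA.
  have := integrableZl mC1 (2 * pi) (pk_integrable Ix sg); apply: eq_integrable => // y _.
  by rewrite /= -EFinM pkE mulrA mulVKf.
rewrite /poisson /cintegral -(kint _ ur) -(kint _ ui).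
have reM (a b : R) (z : R[i]) : Re (a%:C * z) = a * Re z by case: z => z1 z2 /=; rewrite mul0r subr0.
have imM (a b : R) (z : R[i]) : Im (a%:C * z) = a * Im z by case: z => z1 z2 /=; rewrite mul0r addr0.
apply/eqP; rewrite eq_complex /= !mul0r subr0 addr0.
by apply/andP; split; apply/eqP; congr (_ * _); apply: eq_Rintegral => y _; rewrite ?reM ?imM.
Qed.

Let modf (D : set plane) (u : plane -> R[i]) : plane -> R :=
  (fun y => Num.sqrt (Re (u y) ^+ 2 + Im (u y) ^+ 2)) \_ D.

Let modf_measurable D u : measurable D -> L2 D u -> measurable_fun [set: plane] (modf D u).
Proof.
move=> mD Lu; apply: (proj1 (measurable_restrictT _ mD)).
by apply: measurable_fun_sqrt; exact: measurable_sqnorm.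
Qed.

Let modf_ge0 D u y : 0 <= modf D u y.
Proof. by rewrite /modf patchE; case: ifP => // _; exact: sqrtr_ge0. Qed.

Let modf_sqr D u y : D y -> modf D u y ^+ 2 = Re (u y) ^+ 2 + Im (u y) ^+ 2.
Proof. by move=> Dy; rewrite /modf patchE mem_set// sqr_sqrtr// addr_ge0// sqr_ge0. Qed.

Let modf_sqint u : L2 C1 u -> sqint m C1 (modf C1 u).
Proof.
move=> Lu; split; first by apply: measurable_funTS; exact: modf_measurable.
case: (Lu) => _ _; apply: le_lt_trans; rewrite le_eqVlt; apply/orP; left; apply/eqP.
by apply: eq_integral => y /set_mem Cy; rewrite modf_sqr.
Qed.

Let pot (D : set plane) (f : plane -> R) (x : plane) : R := \int[m]_(y in D) (pk x y * f y).

Let pot_measurable D f : measurable D -> (m D < +oo)%E -> measurable_fun [set: plane] (f : plane -> R) ->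
  (forall y, 0 <= f y) -> measurable_fun [set: plane] (pot D f).
Proof.
move=> mD finD mf f0; rewrite /pot /Rintegral; apply: measurableT_comp => //.
apply: (measurable_section_integral mD finD (f := fun z => (pk z.1 z.2 * f z.2)%:E)).
  by apply/measurable_EFinP; apply: measurable_funM => //; exact: measurableT_comp.
by move=> z; rewrite lee_fin mulr_ge0.
Qed.

Let pot_ge0 D f x : (forall y, 0 <= f y) -> 0 <= pot D f x.
Proof. by move=> f0; apply: Rintegral_ge0 => y _; rewrite mulr_ge0. Qed.

(* Tonelli's theorem applies to the positive and the negative part, whose potentials are finite on [I2]
   and can be subtracted. *)
Let signed_pot_measurable g : sqint m C1 g ->
  measurable_fun I2 (fun x => \int[m]_(y in C1) (pk x y * g y)).
Proof.
move=> sg; have [mg fg] := sg.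
pose gp := (fun y => Num.max (g y) 0) \_ C1; pose gn := (fun y => Num.max (- g y) 0) \_ C1.
have mgp : measurable_fun [set: plane] gp.
  by apply: (proj1 (measurable_restrictT _ mC1)); exact: measurable_maxr.
have mgn : measurable_fun [set: plane] gn.
  by apply: (proj1 (measurable_restrictT _ mC1)); apply: measurable_maxr => //; exact: measurableT_comp.
have gp0 y : 0 <= gp y by rewrite /gp patchE; case: ifP => // _; rewrite le_max lexx orbT.
have gn0 y : 0 <= gn y by rewrite /gn patchE; case: ifP => // _; rewrite le_max lexx orbT.
have bnd (f : plane -> R) : measurable_fun [set: plane] f -> (forall y, C1 y -> `|f y| <= `|g y|) ->
    sqint m C1 f.
  move=> mf le; split; first exact: measurable_funTS.
  apply: le_lt_trans fg; apply: ge0_le_integral => //.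
  - by move=> y _; rewrite lee_fin sqr_ge0.
  - by apply/measurable_EFinP; apply: measurable_funX; exact: measurable_funTS.
  - by apply/measurable_EFinP; exact: measurable_funX.
  - by move=> y Cy; rewrite lee_fin -real_normK ?num_real// -[g y ^+ 2]real_normK ?num_real// ler_pXn2r ?nnegrE ?le.
have sp : sqint m C1 gp.
  apply: bnd => // y Cy; rewrite /gp patchE mem_set// ger0_norm ?le_max ?lexx ?orbT//.
  by rewrite ge_max ler_norm normr_ge0.
have sn : sqint m C1 gn.
  apply: bnd => // y Cy; rewrite /gn patchE mem_set// ger0_norm ?le_max ?lexx ?orbT//.
  by rewrite ge_max normr_ge0 andbT -normrN ler_norm.
apply: (@eq_measurable_fun _ _ _ _ _ (fun x => pot C1 gp x - pot C1 gn x)).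
  move=> x /set_mem Ix; rewrite /pot -RintegralB//; [|exact: pk_integrable..].
  apply: eq_Rintegral => y /= Cy; rewrite -mulrBr; congr (_ * _).
  by rewrite /gp /gn !patchE Cy; case: (lerP (g y) 0) => h; case: (lerP (- g y) 0) => h'; lra.
by apply: measurable_funB; apply: measurable_funTS; exact: pot_measurable.
Qed.

Let gammaE u x : gamma c1 r1 c2 r2 u x = if x \in I2 then poisson c1 r1 u x else 0.
Proof. by []. Qed.

Let mod_gamma u x : L2 C1 u ->
  Num.sqrt (Re (gamma c1 r1 c2 r2 u x) ^+ 2 + Im (gamma c1 r1 c2 r2 u x) ^+ 2) <=
  ((fun x => pot I1 (modf C1 u) x + pot X1 (modf C1 u) x) \_ I2) x.
Proof.
move=> Lu; rewrite gammaE patchE; case: ifPn => [/set_mem Ix|_]; last first.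
  by rewrite /= expr0n/= addr0 sqrtr0.
rewrite poissonE//=; set a := \int[m]_(y in C1) _; set b := \int[m]_(y in C1) _.
have iu := pk_integrable Ix (modf_sqint Lu).
have -> : pot I1 (modf C1 u) x + pot X1 (modf C1 u) x = \int[m]_(y in C1) (pk x y * modf C1 u y).
  rewrite -Rintegral_setU//.
  - by rewrite setDUK.
  - by rewrite setDUK.
  - by apply/disj_setPS => y [? []].
have [ur ui] := (L2_sqint mC1 u).1 Lu.
set r := Num.sqrt _; have r0 : 0 <= r by exact: sqrtr_ge0.
have r2E : r ^+ 2 = a ^+ 2 + b ^+ 2 by rewrite sqr_sqrtr// addr_ge0// sqr_ge0.
have [->|rn] := eqVneq r 0; first by apply: Rintegral_ge0 => y _; rewrite mulr_ge0.
have {}r0 : 0 < r by rewrite lt_neqAle eq_sym rn.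
have -> : r = a / r * a + b / r * b.
  have -> : a / r * a + b / r * b = (a ^+ 2 + b ^+ 2) / r by rewrite mulrDl !expr2 ![_ / r * _]mulrAC.
  by rewrite -r2E expr2 mulfK.
rewrite /a /b -!RintegralZl//; [|exact: pk_integrable..].
have i1 : m.-integrable C1 (EFin \o (fun y => a / r * (pk x y * Re (u y)))).
  exact: (integrableZl mC1 (a / r) (pk_integrable Ix ur)).
have i2 : m.-integrable C1 (EFin \o (fun y => b / r * (pk x y * Im (u y)))).
  exact: (integrableZl mC1 (b / r) (pk_integrable Ix ui)).
rewrite -/a -/b -RintegralD//; apply: le_Rintegral => //; first exact: (integrableD mC1 i1 i2).
move=> y Cy /=; rewrite (mulrCA (a / r)) (mulrCA (b / r)) -mulrDr ler_wpM2l//.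
apply: le_trans (ler_norm _) _.
rewrite -(@ler_pXn2r _ 2) ?nnegrE// modf_sqr// real_normK ?num_real//.
set p := Re _; set q := Im _; rewrite -subr_ge0.
have -> : p ^+ 2 + q ^+ 2 - (a / r * p + b / r * q) ^+ 2 = (a / r * q - b / r * p) ^+ 2.
  have h : (a / r) ^+ 2 + (b / r) ^+ 2 = 1 by rewrite !expr_div_n -mulrDl -r2E divff ?expf_neq0.
  by rewrite -[p ^+ 2 + q ^+ 2]mul1r -h; ring.
exact: sqr_ge0.
Qed.

Let sigma := s * int_factor ce s c.
Let tau := c * ext_factor ce s c.

Let sigma0 : 0 <= sigma.
Proof.
rewrite mulr_ge0 ?(ltW s0)//; rewrite /int_factor; case: ifP => _; last exact: ltW.
by rewrite invr_ge0 ltW// addr_gt0.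
Qed.

Let tau0 : 0 <= tau.
Proof.
rewrite mulr_ge0 ?(ltW c0)//; rewrite /ext_factor; case: ifP => _; last exact: ltW.
by rewrite mulr_ge0 ?(ltW c0)// divr_ge0// addr_ge0// mulr_ge0 ?sqrtr_ge0 ?(ltW s0).
Qed.

Let A2_sub : A2 `<=` I2.
Proof. by rewrite A2E; exact: (arc_int_sub r20 r10 fr'). Qed.

Let mA2 : measurable A2. Proof. exact: measurable_arc. Qed.

Let integral_I2 (f : plane -> \bar R) : measurable_fun [set: plane] f -> (forall x, (0 <= f x)%E) ->
  (\int[m]_(x in I2) f x = \int[m]_(x in A2) f x)%E.
Proof. by move=> mf f0; rewrite A2E; exact: (integral_arc_int r20 r10 fr'). Qed.

Let pot_schur (D A : set plane) (fac : R) u : measurable D -> (m D < +oo)%E -> D `<=` C1 -> 0 <= fac ->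
  (forall f : plane -> \bar R, measurable_fun [set: plane] f -> (forall x, (0 <= f x)%E) ->
    (\int[m]_(x in D) f x = \int[m]_(x in A) f x)%E) ->
  (forall f V : plane -> R, measurable_fun [set: plane] f -> (forall y, 0 <= f y) ->
    measurable_fun A2 V -> (forall x, A2 x -> 0 <= V x) ->
    (forall x, A2 x -> ((V x)%:E <= \int[m]_(y in A) (pk x y * f y)%:E)%E) ->
    (\int[m]_(x in A2) (V x ^+ 2)%:E <= fac%:E * \int[m]_(y in A) (f y ^+ 2)%:E)%E) ->
  L2 C1 u ->
  (\int[m]_(x in I2) (pot D (modf C1 u) x ^+ 2)%:E <= (fac * sqnorm D u)%:E)%E.
Proof.
move=> mD finD DC fac0 DA sch Lu; have mf := modf_measurable mC1 Lu; have f0 := modf_ge0 C1 u.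
have LD : L2 D u by exact: L2_subset Lu.
have mV := pot_measurable mD finD mf f0.
rewrite integral_I2; [|by apply/measurable_EFinP; exact: measurable_funX|by move=> x; rewrite lee_fin sqr_ge0].
apply: (le_trans (sch _ _ mf f0 (measurable_funTS mV) (fun x _ => pot_ge0 _ _ f0) _)).
  move=> x Ax; rewrite -DA; last 2 first.
  - by apply/measurable_EFinP; exact: measurable_funM.
  - by move=> y; rewrite lee_fin mulr_ge0.
  rewrite /pot /Rintegral fineK//; apply: integral_fune_fin_num => //.
  apply: integrableS (pk_integrable (A2_sub Ax) (modf_sqint Lu)) => //.
rewrite EFinM -L2_fin// lee_wpmul2l// -DA; last 2 first.
- by apply/measurable_EFinP; exact: measurable_funX.
- by move=> y; rewrite lee_fin sqr_ge0.
rewrite le_eqVlt; apply/orP; left; apply/eqP.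
by apply: eq_integral => y /set_mem Dy; rewrite modf_sqr//; exact: DC.
Qed.

Let pot_int u : L2 C1 u ->
  (\int[m]_(x in I2) (pot I1 (modf C1 u) x ^+ 2)%:E <= (sigma * sqnorm I1 u)%:E)%E.
Proof.
apply: (pot_schur mI1 I1_fin IC1 sigma0); first exact: (integral_arc_int r10 r20 fr).
exact: int_schur.
Qed.

Let pot_ext u : L2 C1 u ->
  (\int[m]_(x in I2) (pot X1 (modf C1 u) x ^+ 2)%:E <= (tau * sqnorm X1 u)%:E)%E.
Proof.
apply: (pot_schur mX1 X1_fin _ tau0); first by move=> x [].
  exact: (integral_arc_ext r10 r20 fr).
exact: ext_schur.
Qed.

Let pot_sqint D f : measurable D -> (m D < +oo)%E -> measurable_fun [set: plane] (f : plane -> R) ->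
  (forall y, 0 <= f y) -> (\int[m]_(x in I2) (pot D f x ^+ 2)%:E < +oo)%E -> sqint m I2 (pot D f).
Proof. by move=> mD fD mf f0 fin; split => //; apply: measurable_funTS; exact: pot_measurable. Qed.

Let pots u : L2 C1 u -> sqint m I2 (pot I1 (modf C1 u)) /\ sqint m I2 (pot X1 (modf C1 u)).
Proof.
move=> Lu; have mf := modf_measurable mC1 Lu; have f0 := modf_ge0 C1 u; split.
  by apply: pot_sqint => //; apply: le_lt_trans (pot_int Lu) _; rewrite ltry.
by apply: pot_sqint => //; apply: le_lt_trans (pot_ext Lu) _; rewrite ltry.
Qed.

Lemma gamma_L2 u : L2 C1 u -> L2 C2 (gamma c1 r1 c2 r2 u).
Proof.
move=> Lu; have [ur ui] := (L2_sqint mC1 u).1 Lu.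
have mre : measurable_fun C2 (fun x => Re (gamma c1 r1 c2 r2 u x) : R).
  apply: measurable_funTS.
  have -> : (fun x => Re (gamma c1 r1 c2 r2 u x)) =
    (fun x => \int[m]_(y in C1) (pk x y * Re (u y))) \_ I2.
    apply/funext => x; rewrite gammaE patchE; case: ifPn => // /set_mem Ix.
    by rewrite poissonE.
  by apply: (proj1 (measurable_restrictT _ mI2)); exact: signed_pot_measurable.
have mim : measurable_fun C2 (fun x => Im (gamma c1 r1 c2 r2 u x) : R).
  apply: measurable_funTS.
  have -> : (fun x => Im (gamma c1 r1 c2 r2 u x)) =
    (fun x => \int[m]_(y in C1) (pk x y * Im (u y))) \_ I2.
    apply/funext => x; rewrite gammaE patchE; case: ifPn => // /set_mem Ix.
    by rewrite poissonE.
  by apply: (proj1 (measurable_restrictT _ mI2)); exact: signed_pot_measurable.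
split => //; have [p1 p2] := pots Lu; have [mp fp] := sqintD mI2 p1 p2.
pose P := (fun x => pot I1 (modf C1 u) x + pot X1 (modf C1 u) x) \_ I2.
have mP : measurable_fun [set: plane] P by apply: (proj1 (measurable_restrictT _ mI2)).
apply: (@le_lt_trans _ _ (\int[m]_(x in C2) (P x ^+ 2)%:E)%E).
  apply: ge0_le_integral => //.
  - by move=> x _; rewrite lee_fin addr_ge0 ?sqr_ge0.
  - by apply/measurable_EFinP; apply: measurable_funD; exact: measurable_funX.
  - by apply/measurable_EFinP; apply: measurable_funX; exact: measurable_funTS.
  - move=> x _; rewrite lee_fin; have := mod_gamma x Lu; rewrite -/P => le.
    rewrite -(sqr_sqrtr (addr_ge0 (sqr_ge0 _) (sqr_ge0 _))).
    by rewrite ler_pXn2r ?nnegrE ?sqrtr_ge0//; apply: le_trans le; exact: sqrtr_ge0.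
have -> : (fun x => (P x ^+ 2)%:E) =
   ((fun x => ((pot I1 (modf C1 u) x + pot X1 (modf C1 u) x) ^+ 2)%:E) \_ I2).
  by apply/funext => x; rewrite /P !patchE; case: ifP => //; rewrite expr0n.
by rewrite -integral_mkcondr setIidr.
Qed.

(** [gamma u] vanishes off the interior arc, so only the norm of [w] on that arc appears; the two
    potentials that dominate [gamma u] there are bounded by the Schur tests. *)
Lemma gamma_form_bound u w : L2 C1 u -> L2 C2 w ->
  Re (dotL2 C2 (gamma c1 r1 c2 r2 u) w) <=
  (Num.sqrt sigma * Num.sqrt (sqnorm I1 u) + Num.sqrt tau * Num.sqrt (sqnorm X1 u)) *
  Num.sqrt (sqnorm I2 w).
Proof.
move=> Lu Lw; have LG := gamma_L2 Lu; have [p1 p2] := pots Lu.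
set Vi := pot I1 _ in p1; set Ve := pot X1 _ in p2.
pose f := modf C2 w.
have mf : measurable_fun [set: plane] f := modf_measurable mC2 Lw.
have f0 y : 0 <= f y by exact: modf_ge0.
have LwI : L2 I2 w by exact: L2_subset Lw.
have f2 : (\int[m]_(x in I2) (f x ^+ 2)%:E = (sqnorm I2 w)%:E)%E.
  rewrite -L2_fin//; apply: eq_integral => x /set_mem Ix.
  by rewrite /f modf_sqr//; exact: IC2.
have sf : sqint m I2 f by split; [exact: measurable_funTS|rewrite f2 ltry].
have cs V (q : R) : sqint m I2 V -> (forall x, 0 <= V x) -> 0 <= q ->
    (\int[m]_(x in I2) (V x ^+ 2)%:E <= q%:E)%E -> \int[m]_(x in I2) (V x * f x) <= Num.sqrt q * Num.sqrt (sqnorm I2 w).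
  move=> sV V0 q0 Vq; rewrite -sqrtrM// -lee_fin.
  have iV := sqint_mul mI2 sV sf.
  rewrite /Rintegral fineK; last exact: integral_fune_fin_num.
  apply: cauchy_schwarz_integral => //; [by case: sV|by case: sf|by apply: Rintegral_ge0 => x _; rewrite addr_ge0 ?sqr_ge0|by rewrite f2].
have f0' := modf_ge0 C1 u.
have n0 (D : set plane) : 0 <= sqnorm D u by apply: Rintegral_ge0 => x _; rewrite addr_ge0 ?sqr_ge0.
have b1 := cs Vi _ p1 (fun x => pot_ge0 I1 x f0') (mulr_ge0 sigma0 (n0 I1)) (pot_int Lu).
have b2 := cs Ve _ p2 (fun x => pot_ge0 X1 x f0') (mulr_ge0 tau0 (n0 X1)) (pot_ext Lu).
rewrite -!sqrtrM// mulrDl; apply: le_trans (lerD b1 b2).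
rewrite -RintegralD//; [|exact: sqint_mul..].
rewrite /dotL2 /cintegral /=.
set G := gamma _ _ _ _ u in LG *.
have [iG1 iG2] := (L2_sqint mC2 G).1 LG; have [iw1 iw2] := (L2_sqint mC2 w).1 Lw.
have reE x : Re (G x * (w x)^*) = Re (G x) * Re (w x) + Im (G x) * Im (w x).
  by case: (G x) (w x) => a b [a' b'] /=; ring.
have GI : \int[m]_(x in C2) Re (G x * (w x)^*) = \int[m]_(x in I2) Re (G x * (w x)^*).
  rewrite /Rintegral; congr fine.
  rewrite -[in RHS](setIidr IC2) [RHS]integral_mkcondr; apply: eq_integral => x _.
  by rewrite patchE; case: ifPn => // nI; rewrite reE /G gammaE (negbTE nI)/= !mul0r addr0.
rewrite GI; apply: le_Rintegral => //.
- apply: (@integrableS _ _ _ _ C2) => //.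
  have := integrableD mC2 (sqint_mul mC2 iG1 iw1) (sqint_mul mC2 iG2 iw2).
  by apply: eq_integrable => // x _; rewrite /= reE.
- exact: (integrableD mI2 (sqint_mul mI2 p1 sf) (sqint_mul mI2 p2 sf)).
move=> x Ix; have := mod_gamma x Lu; rewrite -/G patchE mem_set// -/Vi -/Ve => le.
rewrite -mulrDl; apply: le_trans (ler_wpM2r (f0 x) le).
rewrite /f /modf patchE mem_set; last exact: IC2.
rewrite -sqrtrM ?addr_ge0 ?sqr_ge0//; apply: le_trans (ler_norm _) _.
rewrite -sqrtr_sqr ler_wsqrtr// reE -subr_ge0.
set a := Re (G x); set b := Im (G x); set a' := Re (w x); set b' := Im (w x).
have -> : (a ^+ 2 + b ^+ 2) * (a' ^+ 2 + b' ^+ 2) - (a * a' + b * b') ^+ 2 = (a * b' - b * a') ^+ 2 by ring.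
exact: sqr_ge0.
Qed.

Let poisson_lin (a : R[i]) u v x : L2 C1 u -> L2 C1 v -> I2 x ->
  poisson c1 r1 (fun y => a * u y + v y) x = a * poisson c1 r1 u x + poisson c1 r1 v x.
Proof.
move=> Lu Lv Ix; have Luv := L2D mC1 (L2Z mC1 a Lu) Lv; rewrite !poissonE//.
move: (Lu) (Lv) => /(L2_sqint mC1)[ur ui] /(L2_sqint mC1)[vr vi].
have iZ (k : R) g : sqint m C1 g -> m.-integrable C1 (EFin \o (fun y => k * (pk x y * g y))).
  by move=> sg; exact: (integrableZl mC1 k (pk_integrable Ix sg)).
have combE (k k' : R) (g g' g'' : plane -> R) : sqint m C1 g -> sqint m C1 g' -> sqint m C1 g'' ->
    \int[m]_(y in C1) (pk x y * (k * g y + k' * g' y + g'' y)) =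
    k * \int[m]_(y in C1) (pk x y * g y) + k' * \int[m]_(y in C1) (pk x y * g' y) +
    \int[m]_(y in C1) (pk x y * g'' y).
  move=> sg sg' sg''; have i1 := iZ k _ sg; have i2 := iZ k' _ sg'; have i3 := pk_integrable Ix sg''.
  rewrite -!RintegralZl//; try exact: pk_integrable.
  rewrite -RintegralD// -RintegralD//; last exact: (integrableD mC1 i1 i2).
  by apply: eq_Rintegral => y _; ring.
have -> : \int[m]_(y in C1) (pk x y * Re (a * u y + v y)) =
    \int[m]_(y in C1) (pk x y * (Re a * Re (u y) + - Im a * Im (u y) + Re (v y))).
  by apply: eq_Rintegral => y _; rewrite ReD ReM mulNr.
have -> : \int[m]_(y in C1) (pk x y * Im (a * u y + v y)) =
    \int[m]_(y in C1) (pk x y * (Re a * Im (u y) + Im a * Re (u y) + Im (v y))).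
  by apply: eq_Rintegral => y _; rewrite ImD ImM.
rewrite !combE//; case: a Luv => a1 a2 _ /=.
by apply/eqP; rewrite eq_complex /=; apply/andP; split; apply/eqP; ring.
Qed.

Lemma gamma_lin (a : R[i]) u v : L2 C1 u -> L2 C1 v ->
  gamma c1 r1 c2 r2 (fun y => a * u y + v y) =
  (fun x => a * gamma c1 r1 c2 r2 u x + gamma c1 r1 c2 r2 v x).
Proof.
move=> Lu Lv; apply/funext => x; rewrite !gammaE; case: ifPn => [/set_mem Ix|_].
  exact: poisson_lin.
by rewrite mulr0 addr0.
Qed.

Lemma gamma_ae u v : L2 C1 u -> L2 C1 v -> eqL2 C1 u v ->
  gamma c1 r1 c2 r2 u = gamma c1 r1 c2 r2 v.
Proof.
move=> Lu Lv uv; apply/funext => x; rewrite !gammaE; case: ifPn => // /set_mem Ix.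
rewrite !poissonE//; move: (Lu) (Lv) => [ur ui _] [vr vi _].
have mx : measurable_fun C1 (pk x) by exact: measurable_funTS.
rewrite /Rintegral; congr (Complex (fine _) (fine _)); apply: ae_eq_integral => //;
  try by (apply/measurable_EFinP; exact: measurable_funM).
- by apply: filterS uv => y /[apply] ->.
- by apply: filterS uv => y /[apply] ->.
Qed.

Lemma circle_finite : (hausdorff1 (circle c1 r1) < +oo)%E.
Proof. exact: circle_fin. Qed.

Lemma sqnorm_split u : L2 C1 u -> sqnorm C1 u = sqnorm I1 u + sqnorm X1 u.
Proof.
move=> Lu; rewrite /sqnorm -Rintegral_setU//.
- by rewrite setDUK.
- rewrite setDUK//; have [ur ui] := (L2_sqint mC1 u).1 Lu.
  exact: (integrableD mC1 (sqint_integrable ur) (sqint_integrable ui)).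
- by apply/disj_setPS => y [? []].
Qed.

End direction.

Section coupling.
Context {R : realType}.
Local Notation plane := (R * R)%type.
Local Notation Re := complex.Re.
Implicit Types (c : plane) (r : R).

(** All that the iteration needs to know about the Poisson operator from one circle to the other. The
    number [Lam] bounds the product of the weighted norm that controls the form and the norm on the
    interior arc. *)
Record coupled c1 r1 c2 r2 (Lam : R) : Prop := Coupled {
  coupled_meas : measurable (circle c1 r1);
  coupled_finite : (hausdorff1 (circle c1 r1) < +oo)%E;
  coupled_L2 : forall u, L2 (circle c1 r1) u -> L2 (circle c2 r2) (gamma c1 r1 c2 r2 u);
  coupled_lin : forall (a : R[i]) u v, L2 (circle c1 r1) u -> L2 (circle c1 r1) v ->
    gamma c1 r1 c2 r2 (fun y => a * u y + v y) =
    (fun x => a * gamma c1 r1 c2 r2 u x + gamma c1 r1 c2 r2 v x);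
  coupled_ae : forall u v, L2 (circle c1 r1) u -> L2 (circle c1 r1) v -> eqL2 (circle c1 r1) u v ->
    gamma c1 r1 c2 r2 u = gamma c1 r1 c2 r2 v;
  coupled_split : forall u, L2 (circle c1 r1) u -> sqnorm (circle c1 r1) u =
    sqnorm (circle_int c1 r1 c2 r2) u + sqnorm (circle c1 r1 `\` circle_int c1 r1 c2 r2) u;
  coupled_form : exists sg ta : R, [/\ 0 <= sg, 0 <= ta,
    (forall u w, L2 (circle c1 r1) u -> L2 (circle c2 r2) w ->
      Re (dotL2 (circle c2 r2) (gamma c1 r1 c2 r2 u) w) <=
      (sg * Num.sqrt (sqnorm (circle_int c1 r1 c2 r2) u) +
       ta * Num.sqrt (sqnorm (circle c1 r1 `\` circle_int c1 r1 c2 r2) u)) *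
      Num.sqrt (sqnorm (circle_int c2 r2 c1 r1) w)) &
    (forall x y, 0 <= x -> 0 <= y -> (sg * x + ta * y) * x <= Lam * (x ^+ 2 + y ^+ 2))] }.

(** The angles of the triangle formed by the two centres and an intersection point: [2 rho] at the
    first centre, [2 eta] at the second, in terms of the cosines and sines of [rho] and [eta]. *)
Lemma half_angles c1 r1 c2 r2 M e l h1 h2 : 0 < r1 -> 0 < r2 -> lens_frame c1 r1 c2 r2 M e l h1 h2 ->
  exists cr sr ce se : R, [/\ [/\ 0 < cr, 0 < sr, 0 < ce & 0 < se],
    cr ^+ 2 + sr ^+ 2 = 1 /\ ce ^+ 2 + se ^+ 2 = 1,
    h1 / r1 = sr ^+ 2 - cr ^+ 2 /\ l / r1 = 2 * sr * cr,
    h2 / r2 = ce ^+ 2 - se ^+ 2 /\ l / r2 = 2 * se * ce &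
    0 < cr * ce - sr * se /\
    1 - 2 * (cr * ce - sr * se) ^+ 2 = (h1 * h2 + l ^+ 2) / (r1 * r2)].
Proof.
move=> r10 r20 [e1 l0 h12 _ [rl1 rl2]].
have half h r : 0 < r -> r ^+ 2 = h ^+ 2 + l ^+ 2 -> exists a b : R,
    [/\ 0 < a, 0 < b, a ^+ 2 + b ^+ 2 = 1, h / r = a ^+ 2 - b ^+ 2 & l / r = 2 * a * b].
  move=> r0 rl; have t2 : (h / r) ^+ 2 + (l / r) ^+ 2 = 1.
    by rewrite !expr_div_n -mulrDl -rl divff// expf_neq0// gt_eqF.
  have lr : 0 < l / r by rewrite divr_gt0.
  set t := h / r in t2 *; set q := l / r in t2 lr *.
  have tb : -1 < t < 1 by apply/andP; split; nra.
  have [t1 t1'] := andP tb.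
  have a2 : Num.sqrt ((1 + t) / 2) ^+ 2 = (1 + t) / 2 by rewrite sqr_sqrtr//; lra.
  have b2 : Num.sqrt ((1 - t) / 2) ^+ 2 = (1 - t) / 2 by rewrite sqr_sqrtr//; lra.
  exists (Num.sqrt ((1 + t) / 2)), (Num.sqrt ((1 - t) / 2)); split.
  - by rewrite sqrtr_gt0; lra.
  - by rewrite sqrtr_gt0; lra.
  - by rewrite a2 b2; lra.
  - by rewrite a2 b2; lra.
  apply/eqP; rewrite -(@eqrXn2 _ 2) ?(ltW lr) ?mulr_ge0 ?sqrtr_ge0//.
  have ring2 (a b : R) : (2 * a * b) ^+ 2 = 4 * a ^+ 2 * b ^+ 2 by ring.
  by rewrite ring2 a2 b2; apply/eqP; lra.
have [sr [cr [sr0 cr0 rr1 h1E l1E]]] := half _ _ r10 rl1.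
have [ce [se [ce0 se0 ee1 h2E l2E]]] := half _ _ r20 rl2.
have sc : 2 * (cr * ce - sr * se) * (sr * ce + cr * se) = l * (h2 - h1) / (r1 * r2).
  have -> : l * (h2 - h1) / (r1 * r2) = (h2 / r2) * (l / r1) - (h1 / r1) * (l / r2).
    by field; rewrite !gt_eqF.
  by rewrite h1E h2E l1E l2E; ring.
have cc0 : 0 < sr * ce + cr * se by rewrite addr_gt0 ?mulr_gt0.
exists cr, sr, ce, se; split => //; split => //.
- by rewrite addrC.
- by rewrite l2E; ring.
- rewrite -(pmulr_lgt0 _ cc0) -(@pmulr_rgt0 _ 2)// mulrA sc.
  by rewrite divr_gt0 ?mulr_gt0// subr_gt0.
have -> : (h1 * h2 + l ^+ 2) / (r1 * r2) = (h1 / r1) * (h2 / r2) + (l / r1) * (l / r2).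
  by field; rewrite !gt_eqF.
rewrite h1E h2E l1E l2E.
have one : 1 = (cr ^+ 2 + sr ^+ 2) * (ce ^+ 2 + se ^+ 2) by rewrite ee1 addrC rr1 mulr1.
by rewrite [X in X - _]one; ring.
Qed.

Lemma lens_coupled c1 r1 c2 r2 M e l h1 h2 (cr sr ce se : R) : 0 < r1 -> 0 < r2 ->
  lens_frame c1 r1 c2 r2 M e l h1 h2 ->
  [/\ 0 < cr, 0 < sr, 0 < ce & 0 < se] ->
  cr ^+ 2 + sr ^+ 2 = 1 /\ ce ^+ 2 + se ^+ 2 = 1 ->
  h1 / r1 = sr ^+ 2 - cr ^+ 2 /\ l / r1 = 2 * sr * cr ->
  h2 / r2 = ce ^+ 2 - se ^+ 2 /\ l / r2 = 2 * se * ce ->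
  0 < cr * ce - sr * se ->
  coupled c1 r1 c2 r2 (arc_bound ce (cr * ce - sr * se)).
Proof.
move=> r10 r20 fr [cr0 sr0 ce0 se0] [rr1 ee1] [h1E l1E] [h2E l2E] s0.
set s := cr * ce - sr * se; pose c := sr * ce + cr * se.
split.
- exact: (measurable_circle r10 fr).
- exact: (circle_finite r10 r20 fr cr0 sr0 ce0 se0 h1E l1E h2E l2E s0).
- exact: (gamma_L2 r10 r20 fr cr0 sr0 ce0 se0 rr1 ee1 h1E l1E h2E l2E s0).
- move=> a u v; exact: (gamma_lin r10 r20 fr cr0 sr0 ce0 se0 h1E l1E h2E l2E s0).
- move=> u v; exact: (gamma_ae r10 r20 fr cr0 sr0 ce0 se0 h1E l1E h2E l2E s0).
- exact: (sqnorm_split r10 r20 fr).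
exists (Num.sqrt (s * int_factor ce s c)), (Num.sqrt (c * ext_factor ce s c)).
split; rewrite ?sqrtr_ge0//.
  move=> u w Lu Lw.
  exact: (gamma_form_bound r10 r20 fr cr0 sr0 ce0 se0 rr1 ee1 h1E l1E h2E l2E s0).
by move=> x y x0 y0; exact: (@arc_form_bound _ cr sr ce se s c cr0 sr0 ce0 se0 rr1 ee1 erefl erefl s0).
Qed.

End coupling.

(** * Projection and solvability in finite dimension *)

Section gram.
Context (C : numClosedFieldType) (V : lmodType C) (dot : V -> V -> C) (S : V -> Prop).
Hypothesis SD : forall u v, S u -> S v -> S (u + v).
Hypothesis SZ : forall a u, S u -> S (a *: u).
Hypothesis S0 : S 0.
Hypothesis dotDl : forall u v w, S u -> S v -> S w -> dot (u + v) w = dot u w + dot v w.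
Hypothesis dotZl : forall a u w, S u -> S w -> dot (a *: u) w = a * dot u w.
Hypothesis dotC : forall u v, S u -> S v -> dot v u = (dot u v)^*.
Hypothesis dot_ge0 : forall u, S u -> 0 <= dot u u.
Variables (I : finType) (b : I -> V).
Hypothesis Sb : forall i, S (b i).
Implicit Types (u v w : V) (x y : I -> C).

Definition comb x : V := \sum_i x i *: b i.

Lemma comb_in x : S (comb x).
Proof. by apply: (big_ind S) => // i _; exact: SZ. Qed.

Lemma dot0l w : S w -> dot 0 w = 0.
Proof. by move=> Sw; rewrite -(scale0r 0) dotZl// mul0r. Qed.

Lemma dot_suml (F : I -> V) w : S w -> (forall i, S (F i)) ->
  dot (\sum_i F i) w = \sum_i dot (F i) w.
Proof.
move=> Sw SF; have : S (\sum_i F i) /\ dot (\sum_i F i) w = \sum_i dot (F i) w.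
  apply: (big_ind2 (fun v z => S v /\ dot v w = z)).
  - by split => //; exact: dot0l.
  - by move=> v z v' z' [Sv <-] [Sv' <-]; split; [exact: SD|exact: dotDl].
  - by move=> i _; split.
by case.
Qed.

Lemma dot_combl x w : S w -> dot (comb x) w = \sum_i x i * dot (b i) w.
Proof.
by move=> Sw; rewrite dot_suml// => [|i]; [apply: eq_bigr => i _; rewrite dotZl|exact: SZ].
Qed.

Lemma dot_combr u y : S u -> dot u (comb y) = \sum_i (y i)^* * dot u (b i).
Proof.
move=> Su; rewrite dotC ?dot_combl//; last exact: comb_in.
rewrite rmorph_sum; apply: eq_bigr => i _.
by rewrite rmorphM /= [in RHS]dotC.
Qed.

Let SN u : S u -> S (- u). Proof. by rewrite -scaleN1r; exact: SZ. Qed.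
Let SB u v : S u -> S v -> S (u - v). Proof. by move=> Su Sv; apply: SD => //; exact: SN. Qed.

Lemma dotBl u v w : S u -> S v -> S w -> dot (u - v) w = dot u w - dot v w.
Proof. by move=> Su Sv Sw; rewrite dotDl//; [rewrite -scaleN1r dotZl// mulN1r|exact: SN]. Qed.

(** Cauchy-Schwarz for a degenerate form: otherwise a large multiple of [u], rotated by the phase of
    [dot u v] and added to [v], would have a negative square. *)
Lemma dot_null u v : S u -> S v -> dot u u = 0 -> dot u v = 0.
Proof.
move=> Su Sv u0; set z := dot u v; have [//|z0] := eqVneq z 0; exfalso.
have zn : z * z^* != 0 by rewrite mulf_neq0 ?conjC_eq0.
pose p := (dot v v + 1) / (2 * (z * z^*)).
have zz0 : 0 <= z * z^* by exact: mul_conjC_ge0.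
have vv0 := dot_ge0 Sv.
have p0 : 0 <= p by rewrite divr_ge0 ?addr_ge0// mulr_ge0.
have pr : p^* = p by apply: conj_Creal; exact: ger0_real.
pose a := - (p * z^*).
have Sw : S (v + a *: u) by apply: SD => //; exact: SZ.
have vu : dot v u = z^* by rewrite dotC.
have uw : dot u (v + a *: u) = z.
  rewrite dotC// dotDl// ?dotZl// ?u0 ?mulr0 ?addr0 ?vu ?conjCK//; exact: SZ.
have vw : dot v (v + a *: u) = dot v v - p * (z * z^*).
  rewrite dotC// dotDl// ?dotZl//; last exact: SZ.
  rewrite rmorphD rmorphM /= -dotC// -/z /a rmorphN rmorphM /= pr conjCK.
  by rewrite mulNr -mulrA.
have := dot_ge0 Sw; rewrite dotDl// ?dotZl// ?uw ?vw; last exact: SZ.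
have -> : dot v v - p * (z * z^*) + a * z = dot v v - p * (2 * (z * z^*)) by rewrite /a; ring.
rewrite /p divfK; last by rewrite mulf_neq0 ?pnatr_eq0.
by rewrite opprD addNKr oppr_ge0 ler10.
Qed.

Let n := #|I|.
Let bb (k : 'I_n) := b (enum_val k).
Let G : 'M[C]_n := \matrix_(k, j) dot (bb k) (bb j).

Let row_of x : 'rV[C]_n := \row_k x (enum_val k).
Let of_row (z : 'rV[C]_n) (i : I) := z 0 (enum_rank i).

Let sum_enum (F : I -> C) : \sum_i F i = \sum_(k < n) F (enum_val k).
Proof. by rewrite (reindex_onto enum_val enum_rank)//= => [|i _]; [apply: eq_bigl => k; rewrite enum_valK eqxx|rewrite enum_rankK]. Qed.

Let of_rowK z k : of_row z (enum_val k) = z 0 k. Proof. by rewrite /of_row enum_valK. Qed.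

Let mulG x : row_of x *m G = \row_j dot (comb x) (bb j).
Proof.
apply/rowP => j; rewrite !mxE dot_combl//; last exact: Sb.
by rewrite sum_enum; apply: eq_bigr => k _; rewrite !mxE.
Qed.

Let in_gram u : S u -> (\row_j dot u (bb j) <= G)%MS.
Proof.
move=> Su; rewrite submxE; apply/eqP/rowP => j; rewrite mxE [RHS]mxE.
pose y i := (cokermx G (enum_rank i) j)^*.
transitivity (dot u (comb y)).
  rewrite dot_combr// sum_enum; apply: eq_bigr => k _.
  by rewrite /y enum_valK conjCK mxE mulrC.
have Sy := comb_in y.
rewrite dotC// dot_null ?rmorph0//.
rewrite dot_combl//.
rewrite sum_enum big1// => k _; rewrite dot_combr//.
have : (G *m cokermx G) k j = 0 by rewrite mulmx_coker mxE.
rewrite mxE => h; rewrite sum_enum -[RHS](mulr0 (y (enum_val k))); congr (_ * _).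
rewrite -[RHS]h; apply: eq_bigr => i _; rewrite /y enum_valK conjCK mulrC; congr (_ * _).
by rewrite mxE.
Qed.

(** The family [b] may be linearly dependent modulo null vectors, but [dot u b] is orthogonal to the
    kernel of the Gram matrix, hence in its row space. *)
Lemma gram_projection u : S u -> exists x, forall i, dot (u - comb x) (b i) = 0.
Proof.
move=> Su; have /submxP[z zE] := in_gram Su.
exists (of_row z) => i; rewrite dotBl//; last exact: comb_in.
have : (\row_j dot u (bb j)) 0 (enum_rank i) = (row_of (of_row z) *m G) 0 (enum_rank i).
  by rewrite zE; congr ((_ *m _) _ _); apply/rowP => k; rewrite mxE of_rowK.
by rewrite mulG !mxE /bb enum_rankK => ->; rewrite subrr.
Qed.

(** Injectivity modulo null vectors says that the matrix of [1 - T] has the kernel, hence the row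
    space, of the Gram matrix. *)
Lemma gram_solve (T : V -> V) : (forall u, S u -> S (T u)) ->
  (forall x w, S w -> dot (T (comb x)) w = \sum_i x i * dot (T (b i)) w) ->
  (forall x, (forall i, dot (comb x - T (comb x)) (b i) = 0) -> dot (comb x) (comb x) = 0) ->
  forall g, S g -> exists x, forall i, dot (comb x - T (comb x) - g) (b i) = 0.
Proof.
move=> ST Tl inj g Sg.
pose N : 'M[C]_n := \matrix_(k, j) dot (bb k - T (bb k)) (bb j).
have mulN x : row_of x *m N = \row_j dot (comb x - T (comb x)) (bb j).
  apply/rowP => j; rewrite !mxE dotBl ?Tl ?dot_combl//; try exact: Sb; try exact: comb_in; try exact/ST/comb_in.
  rewrite !sum_enum -sumrB; apply: eq_bigr => k _; rewrite !mxE dotBl ?mulrBr//; try exact: Sb.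
  exact/ST/Sb.
have rowK z : row_of (of_row z) = z by apply/rowP => k; rewrite mxE of_rowK.
have NG : (N <= G)%MS.
  apply/row_subP => k; have -> : row k N = \row_j dot (bb k - T (bb k)) (bb j).
    by apply/rowP => j; rewrite !mxE.
  by apply: in_gram; apply: SB; [exact: Sb|exact/ST/Sb].
have GN : (kermx N <= kermx G)%MS.
  apply/rV_subP => z /sub_kermxP zN; apply/sub_kermxP.
  have h : dot (comb (of_row z)) (comb (of_row z)) = 0.
    apply: inj => i; have := mulN (of_row z); rewrite rowK zN => /rowP/(_ (enum_rank i)).
    by rewrite !mxE /bb enum_rankK.
  rewrite -[z]rowK mulG; apply/rowP => j; rewrite !mxE dot_null//; first exact: comb_in.
  exact: Sb.
have rk : \rank G = \rank N.
  have := mxrankS GN; rewrite !mxrank_ker => h; apply/eqP; rewrite eqn_leq (mxrankS NG) andbT.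
  by have := leq_sub2l n h; rewrite !subKn ?rank_leq_row.
have /submxP[z zE] : (\row_j dot g (bb j) <= N)%MS.
  apply: submx_trans (in_gram Sg) _.
  by have [_ /esym] := mxrank_leqif_sup NG; rewrite rk eqxx.
exists (of_row z) => i; rewrite dotBl//; try exact: Sb; last first.
  by apply: SB; [exact: comb_in|exact/ST/comb_in].
have := mulN (of_row z); rewrite rowK -zE => /rowP/(_ (enum_rank i)).
by rewrite !mxE /bb enum_rankK => ->; rewrite subrr.
Qed.

End gram.

(** The iteration in a space [H] with a semidefinite form: everything follows from the decay along
    sequences whose next term is, against the test space [HL], the image of the current one. *)
Section projected_iteration.
Context {R : realType} (V : lmodType R[i]) (dot : V -> V -> R[i]) (H : V -> Prop).
Local Notation Re := complex.Re.
Local Open Scope complex_scope.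
Hypothesis HD : forall u v, H u -> H v -> H (u + v).
Hypothesis HZ : forall a u, H u -> H (a *: u).
Hypothesis H0 : H 0.
Hypothesis dotDl : forall u v w, H u -> H v -> H w -> dot (u + v) w = dot u w + dot v w.
Hypothesis dotZl : forall a u w, H u -> H w -> dot (a *: u) w = a * dot u w.
Hypothesis dotC : forall u v, H u -> H v -> dot v u = (dot u v)^*%R.
Hypothesis dot_ge0 : forall u, H u -> 0 <= dot u u.
Variables (I : finType) (b : I -> V).
Hypothesis bH : forall i, H (b i).
Variable eqHH : V -> V -> Prop.
Hypothesis eqH_refl : forall u, eqHH u u.
Hypothesis eqHD : forall u u' v v', eqHH u u' -> eqHH v v' -> eqHH (u + v) (u' + v').
Hypothesis eqHZ : forall a u u', eqHH u u' -> eqHH (a *: u) (a *: u').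
Hypothesis dot_eq : forall u u' v v', H u -> H u' -> H v -> H v' -> eqHH u u' -> eqHH v v' ->
  dot u v = dot u' v'.
Hypothesis dot_eq0 : forall u, H u -> dot u u = 0 -> eqHH u 0.
Variable HL : V -> Prop.
Hypothesis HLP : forall u, HL u <-> H u /\ exists x, eqHH u (comb b x).
Variable PL : V -> V.
Hypothesis PL_proj : forall u v, HL v -> (forall w, HL w -> dot (u - v) w = 0) ->
  HL (PL u) /\ (forall w, HL w -> dot (u - PL u) w = 0).

Definition sqdot u : R := Re (dot u u).
Local Notation sq := sqdot.

Let dotE u : H u -> dot u u = (sq u)%:C.
Proof.
by move=> /dot_ge0; rewrite lecE /= => /andP[/eqP i0 _]; rewrite /sq; case: (dot u u) i0 => x y /= ->.
Qed.
Let sq_ge0 u : H u -> 0 <= sq u.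
Proof. by move=> /dot_ge0; rewrite lecE /= => /andP[]. Qed.
Let sq_eq0 u : H u -> sq u = 0 -> eqHH u 0.
Proof. by move=> Hu s0; apply: dot_eq0; rewrite // dotE// s0. Qed.

Let HLH u : HL u -> H u. Proof. by case/HLP. Qed.
Let combH x : H (comb b x). Proof. exact: (comb_in HD HZ H0 bH). Qed.
Let combHL x : HL (comb b x). Proof. by apply/HLP; split => //; exists x; exact: eqH_refl. Qed.
Let HLD u v : HL u -> HL v -> HL (u + v).
Proof.
move=> /HLP[Hu [x Ex]] /HLP[Hv [y Ey]]; apply/HLP; split; first exact: HD.
exists (fun i => x i + y i); have -> : comb b (fun i => x i + y i) = comb b x + comb b y.
  by rewrite /comb -big_split; apply: eq_bigr => i _; rewrite scalerDl.
exact: eqHD.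
Qed.
Let HLZ a u : HL u -> HL (a *: u).
Proof.
move=> /HLP[Hu [x Ex]]; apply/HLP; split; first exact: HZ.
exists (fun i => a * x i); have -> : comb b (fun i => a * x i) = a *: comb b x.
  by rewrite /comb scaler_sumr; apply: eq_bigr => i _; rewrite scalerA.
exact: eqHZ.
Qed.
Let HLB u v : HL u -> HL v -> HL (u - v).
Proof. by move=> Hu Hv; rewrite -scaleN1r; apply: HLD => //; exact: HLZ. Qed.
Let HB u v : H u -> H v -> H (u - v).
Proof. by move=> Hu Hv; rewrite -scaleN1r; apply: HD => //; exact: HZ. Qed.
Let dotB (u v w : V) : H u -> H v -> H w -> dot (u - v) w = dot u w - dot v w.
Proof. exact: (dotBl HZ dotDl dotZl). Qed.

Let PLP u : H u -> HL (PL u) /\ forall w, HL w -> dot (PL u) w = dot u w.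
Proof.
move=> Hu; have [x ux] := gram_projection HD HZ H0 dotDl dotZl dotC dot_ge0 bH Hu.
have [|h1 h2] := PL_proj (combHL x) (u := u).
  move=> w /HLP[Hw [y Ey]]; have Huc : H (u - comb b x) by exact: HB.
  rewrite (dot_eq Huc Huc Hw (combH y) (eqH_refl _) Ey).
  by rewrite (dot_combr HD HZ H0 dotDl dotZl dotC bH _ Huc) big1// => i _; rewrite ux mulr0.
split => // w Hw; apply/eqP; rewrite eq_sym -subr_eq0 -dotB//; [|exact: HLH..].
by apply/eqP; exact: h2.
Qed.

Let HL_null u : HL u -> (forall w, HL w -> dot u w = 0) -> sq u = 0.
Proof.
move=> Hu /(_ u Hu); rewrite dotE; last exact: HLH.
by move=> /eqP; rewrite eq_complex /= => /andP[/eqP].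
Qed.

Let HL_eq u v : HL u -> HL v -> (forall w, HL w -> dot u w = dot v w) -> eqHH u v.
Proof.
move=> Hu Hv uv.
have : eqHH (u - v) 0.
  apply: sq_eq0; first exact/HLH/HLB; apply: HL_null; first exact: HLB.
  by move=> w Hw; rewrite dotB ?uv ?subrr//; exact: HLH.
by move=> /eqHD/(_ (eqH_refl v)); rewrite subrK add0r.
Qed.

Let sq_eqH u v : H u -> H v -> eqHH u v -> sq u = sq v.
Proof.
move=> Hu Hv uv; have := dot_eq Hu Hv Hu Hv uv uv; rewrite !dotE//.
by move=> /eqP; rewrite eq_complex /= => /andP[/eqP].
Qed.

Let PL_sq u : H u -> sq (PL u) <= sq u.
Proof.
move=> Hu; have [Pu Pw] := PLP Hu; have HP := HLH Pu.
have h : dot (u - PL u) (PL u) = 0 by rewrite dotB// Pw// subrr.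
have := dot_ge0 (HB Hu HP); rewrite dotB//; last exact: HB.
have -> : dot (PL u) (u - PL u) = 0 by rewrite dotC ?h ?rmorph0//; exact: HB.
rewrite subr0 dotC ?dotB//; last exact: HB.
have -> : dot (PL u) u = dot (PL u) (PL u).
  by rewrite dotC// -(Pw _ Pu) -dotC.
by rewrite conjC_ge0 !dotE// subr_ge0 lecR.
Qed.

Variables (B : V -> V) (rho : R).
Hypothesis BH : forall u, H u -> H (B u).
Hypothesis B_eq : forall u v, H u -> H v -> eqHH u v -> B u = B v.
Hypothesis B_lin : forall a u v, H u -> H v -> B (a *: u + v) = a *: B u + B v.
Hypothesis rho0 : 0 < rho.
Hypothesis iteration_decay : exists2 C : R, 0 < C & forall v : nat -> V,
  (forall n, HL (v n)) -> (forall n h, HL h -> dot (v n.+1) h = dot (B (v n)) h) ->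
  forall n, Num.sqrt (sq (v n.+1)) <= C * rho ^+ n * Num.sqrt (sq (v 0%N)).

Let norm u := Num.sqrt (sq u).

(* A fixed point gives a constant sequence, which can only decay if it vanishes. *)
Let rec_null u : rho < 1 -> HL u -> (forall h, HL h -> dot u h = dot (B u) h) -> sq u = 0.
Proof.
move=> rho1 Hu eu; have [C C0 dec] := iteration_decay.
have {}dec n : Num.sqrt (sq u) <= C * rho ^+ n * Num.sqrt (sq u) by exact: (dec (fun=> u)).
have s0' := sq_ge0 (HLH Hu); apply/eqP; rewrite eq_le s0' andbT leNgt; apply/negP => s0.
have sp : 0 < Num.sqrt (sq u) by rewrite sqrtr_gt0.
have rn : (C * rho ^+ n) @[n --> \oo] --> C * 0.
  by apply: cvgMr; apply: cvg_expr; rewrite ger0_norm// ltW.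
have /cvgrPdist_lt/(_ 1 ltr01)[N _ /(_ N (leqnn N))] := rn.
rewrite mulr0 sub0r normrN ger0_norm; last by rewrite mulr_ge0 ?exprn_ge0 ?ltW.
by rewrite ltNge -(ler_pM2r sp) mul1r dec.
Qed.

(** The factor [C / rho] is absorbed by [(1 + eps / rho) ^ n]. *)
Lemma iterates_bound (f : R) : rho <= f -> forall eps : R, 0 < eps ->
  \forall n \near \oo, forall e0, H e0 ->
    norm (iter n (fun e => PL (B (PL e))) e0) <= (f + eps) ^+ n * norm e0.
Proof.
move=> rf eps eps0; have [C C0 dec] := iteration_decay.
have q1 : 0 < rho / (rho + eps) < 1.
  by rewrite divr_gt0 ?addr_gt0//= ltr_pdivrMr ?addr_gt0// mul1r ltrDl.
have [q0 q1'] := andP q1.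
have rn : (C / (rho + eps) * (rho / (rho + eps)) ^+ n) @[n --> \oo] --> C / (rho + eps) * 0.
  by apply: cvgMr; apply: cvg_expr; rewrite ger0_norm// ltW.
have /cvgrPdist_lt/(_ 1 ltr01)[N _ hN] := rn.
have decay (e : nat -> V) n : H (e 0%N) -> (forall k, e k.+1 = PL (B (PL (e k)))) ->
    Num.sqrt (sq (e n.+1)) <= C * rho ^+ n * Num.sqrt (sq (e 0%N)).
  move=> e0H eS.
  have eH k : H (e k).
    elim: k => [//|k ih]; rewrite eS; have [h _] := PLP ih; have [h' _] := PLP (BH (HLH h)).
    exact: HLH h'.
  have pH k : HL (PL (e k)) by have [] := PLP (eH k).
  have eHL k : HL (e k.+1) by rewrite eS; have [] := PLP (BH (HLH (pH k))).
  have w k h : HL h -> dot (PL (e k.+1)) h = dot (B (PL (e k))) h.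
    move=> Hh; have [_ ->//] := PLP (eH k.+1); rewrite eS.
    by have [_ ->] := PLP (BH (HLH (pH k))).
  have le := dec (fun k => PL (e k)) pH w n.
  have wP h : HL h -> dot (PL (e n.+1)) h = dot (e n.+1) h.
    by have [_] := PLP (eH n.+1); apply.
  have sqe := sq_eqH (HLH (pH n.+1)) (eH n.+1) (HL_eq (pH n.+1) (eHL n) wP).
  rewrite -sqe; apply: (le_trans le).
  apply: ler_wpM2l; first by rewrite mulr_ge0 ?exprn_ge0 ?(ltW C0) ?(ltW rho0).
  by apply: ler_wsqrtr; exact: PL_sq.
exists N.+1 => // -[//|n] /= Nn e0 He0.
pose e k := iter k (fun e => PL (B (PL e))) e0.
have le := decay e n He0 (fun k => erefl _).
have eH : H (e n.+1).
  elim: (n.+1) => [//|k ih]; have [h _] := PLP ih; have [h' _] := PLP (BH (HLH h)).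
  exact: HLH h'.
rewrite -[PL _]/(e n.+1) /norm.
apply: (le_trans le).
rewrite ler_wpM2r ?sqrtr_ge0//.
apply: (@le_trans _ _ ((rho + eps) ^+ n.+1)); last first.
  by rewrite lerXn2r ?nnegrE ?addr_ge0 ?(ltW rho0) ?(ltW eps0) ?(le_trans (ltW rho0) rf)// lerD2r.
have := hN n Nn; rewrite mulr0 sub0r normrN ger0_norm; last first.
  by rewrite mulr_ge0 ?exprn_ge0 ?divr_ge0 ?addr_ge0 ?(ltW rho0) ?(ltW eps0) ?(ltW C0)//.
move=> /ltW hle; have re0 : 0 < rho + eps by rewrite addr_gt0.
have -> : C * rho ^+ n = C / (rho + eps) * (rho / (rho + eps)) ^+ n * (rho + eps) ^+ n.+1.
  by rewrite expr_div_n exprS; field; rewrite expf_neq0 ?gt_eqF.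
by rewrite -[leRHS]mul1r ler_wpM2r// exprn_ge0// ltW.
Qed.

(** In weak form the equation is [dot (u - B u) h = dot g h] on [HL], a square linear system that is
    injective by [rec_null]; differences of iterates and solution satisfy the homogeneous recursion. *)
Lemma discrete_equation : rho < 1 -> forall g, H g ->
     exists u, [/\ HL u,
       eqHH (PL (PL u - B (PL u))) (PL g),
       (forall v, HL v -> eqHH (PL (PL v - B (PL v))) (PL g) -> eqHH v u) &
       forall u0, HL u0 ->
         exists (C q : R), [/\ 0 <= q, q < 1 &
           forall n : nat,
             norm (iter n (fun w => PL g + PL (B (PL w))) u0 - u) <= C * q ^+ n]].
Proof.
move=> rho1 g Hg.
have PLeq v : HL v -> eqHH (PL v) v.
  by move=> Hv; have [h1 h2] := PLP (HLH Hv); exact: HL_eq.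
have BPL v : HL v -> B (PL v) = B v.
  by move=> Hv; apply: B_eq; [exact/HLH/(PLP (HLH Hv)).1|exact: HLH|exact: PLeq].
have B0 : B 0 = 0.
  have := B_lin (-1) H0 H0; rewrite scaleN1r oppr0 addr0 => ->.
  by rewrite scaleN1r addNr.
have BZ a u : H u -> B (a *: u) = a *: B u.
  by move=> Hu; have := B_lin a Hu H0; rewrite B0 !addr0.
have BD u v : H u -> H v -> B (u + v) = B u + B v.
  by move=> Hu Hv; have := B_lin 1 Hu Hv; rewrite !scale1r.
have B_comb x w : H w -> dot (B (comb b x)) w = \sum_i x i * dot (B (b i)) w.
  move=> Hw; suff [] : H (comb b x) /\ dot (B (comb b x)) w = \sum_i x i * dot (B (b i)) w by [].
  apply: (big_ind2 (fun v z => H v /\ dot (B v) w = z)).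
  - by split => //; rewrite -(scale0r 0) BZ// dotZl ?mul0r//; exact: BH.
  - move=> u c u' c' [Hu <-] [Hu' <-]; split; first exact: HD.
    by rewrite BD// dotDl//; exact: BH.
  - by move=> i _; split; [exact: HZ|rewrite BZ// dotZl//; exact: BH].
have BB v w : HL v -> HL w -> B (v - w) = B v - B w.
  move=> Hv Hw; have := B_lin (-1) (HLH Hw) (HLH Hv).
  by rewrite !scaleN1r [- w + v]addrC [- B w + B v]addrC.
have weak v : HL v -> forall h, HL h -> dot (PL (PL v - B (PL v))) h = dot v h - dot (B v) h.
  move=> Hv h Hh; have Pv := (PLP (HLH Hv)).1.
  have [_ ->//] := PLP (HB (HLH Pv) (BH (HLH Pv))).
  rewrite dotB//; [|exact: HLH|exact/BH/HLH|exact: HLH].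
  by rewrite BPL// (PLP (HLH Hv)).2.
have weakH v : HL v -> HL (PL (PL v - B (PL v))).
  move=> Hv; have Pv := (PLP (HLH Hv)).1.
  by have [] := PLP (HB (HLH Pv) (BH (HLH Pv))).
have inj x : (forall i, dot (comb b x - B (comb b x)) (b i) = 0) -> dot (comb b x) (comb b x) = 0.
  move=> e; rewrite dotE//; congr (_%:C); apply: rec_null => // h /HLP[Hh [y Ey]].
  have Hc := combH x; have HBc := BH Hc.
  apply/eqP; rewrite -subr_eq0 -dotB//.
  rewrite (dot_eq (HB Hc HBc) (HB Hc HBc) Hh (combH y) (eqH_refl _) Ey).
  by rewrite (dot_combr HD HZ H0 dotDl dotZl dotC bH _ (HB Hc HBc)) big1// => i _; rewrite e mulr0.
have [x xg] := gram_solve HD HZ H0 dotDl dotZl dotC dot_ge0 bH BH B_comb inj Hg.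
have Hu := combHL x; have uH := combH x; move: (comb b x) Hu uH xg => u Hu uH xg.
have HBu := BH uH; have HuB := HB uH HBu.
have ug h : HL h -> dot u h - dot (B u) h = dot g h.
  move=> /HLP[Hh [y Ey]]; apply/eqP; rewrite -dotB// -subr_eq0 -dotB//.
  rewrite (dot_eq (HB HuB Hg) (HB HuB Hg) Hh (combH y) (eqH_refl _) Ey).
  by rewrite (dot_combr HD HZ H0 dotDl dotZl dotC bH _ (HB HuB Hg)) big1// => i _; rewrite xg mulr0.
have Pg := (PLP Hg).1; have Pgw := (PLP Hg).2.
exists u; split => //.
- apply: HL_eq => //; first exact: weakH.
  by move=> h Hh; rewrite weak// ug// Pgw.
- move=> v Hv eqv; have vH := HLH Hv.
  have vg h : HL h -> dot v h - dot (B v) h = dot g h.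
    move=> Hh; rewrite -weak// -Pgw//.
    exact: (dot_eq (HLH (weakH _ Hv)) (HLH Pg) (HLH Hh) (HLH Hh) eqv (eqH_refl _)).
  have Hvu := HLB Hv Hu.
  have s0 : sq (v - u) = 0.
    apply: rec_null => // h Hh; have hH := HLH Hh.
    have BvH := BH vH; rewrite BB// !dotB//; have := vg h Hh; rewrite -(ug h Hh) => eh.
    apply/eqP; rewrite -subr_eq0; apply/eqP.
    by transitivity (dot v h - dot (B v) h - (dot u h - dot (B u) h)); [ring|rewrite eh subrr].
  by have := eqHD (sq_eq0 (HLH Hvu) s0) (eqH_refl u); rewrite subrK add0r.
move=> u0 Hu0; have [C C0 dec] := iteration_decay.
pose w n := iter n (fun w => PL g + PL (B (PL w))) u0.
have wS n : w n.+1 = PL g + PL (B (PL (w n))) by [].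
have w0 : w 0%N = u0 by [].
have wE n : iter n (fun w => PL g + PL (B (PL w))) u0 = w n by [].
move: w wS w0 wE => w wS w0 wE.
have PB v : HL v -> HL (PL (B v)) /\ forall h, HL h -> dot (PL (B v)) h = dot (B v) h.
  by move=> Hv; exact: PLP (BH (HLH Hv)).
have wHL n : HL (w n).
  elim: n => [|n ih]; first by rewrite w0.
  by rewrite wS BPL//; apply: HLD => //; exact: (PB _ ih).1.
have dHL n : HL (w n - u) by exact: HLB.
have drec n h : HL h -> dot (w n.+1 - u) h = dot (B (w n - u)) h.
  move=> Hh; have hH := HLH Hh; have [P1 P2] := PB _ (wHL n).
  have wH := HLH (wHL n); have BwH := BH wH.
  rewrite wS BPL// BB// !dotB//; [|exact/HD/HLH/P1/HLH].
  rewrite dotDl//; [|exact: HLH..].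
  rewrite Pgw// P2// -(ug h Hh).
  by ring.
have le := dec (fun n => w n - u) dHL drec.
exists (norm (w 0%N - u) * (1 + C / rho)), rho; split => //; first exact: ltW.
move=> n; rewrite /norm wE.
case: n => [|n].
  by rewrite expr0 mulr1 ler_peMr ?sqrtr_ge0// lerDl divr_ge0// ltW.
apply: (le_trans (le n)); rewrite mulrC -mulrA ler_wpM2l ?sqrtr_ge0//.
rewrite mulrDl mul1r exprS mulrA divfK ?gt_eqF// lerDr.
by rewrite mulr_ge0 ?exprn_ge0 ?ltW.
Qed.

End projected_iteration.

(** * The iteration on the two circles *)

Section monomials.
Context {R : realType}.
Local Notation plane := (R * R)%type.
Local Notation Re := complex.Re.
Local Notation Im := complex.Im.
Local Open Scope complex_scope.

Definition trig_monomial (bar : bool) (n : nat) (c x : plane) : R[i] :=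
  (if bar then (to_complex (x - c))^* else to_complex (x - c)) ^+ n.

Definition trig_poly L (c : plane) (a b : 'I_L.+1 -> R[i]) (x : plane) : R[i] :=
  \sum_(l < L.+1) (a l * to_complex (x - c) ^+ l + b l * ((to_complex (x - c))^* ) ^+ l).

Lemma HL_circleP L c r u : HL_circle L c r u <->
  L2 (circle c r) u /\ exists a b, eqL2 (circle c r) u (trig_poly (L := L) c a b).
Proof. by []. Qed.

Lemma monomial_L2 bar n c (r : R) : 0 < r -> measurable (circle c r) ->
  (hausdorff1 (circle c r) < +oo)%E -> L2 (circle c r) (trig_monomial bar n c).
Proof.
move=> r0 mC fC; set D := circle c r in mC fC *.
pose z (x : plane) : R[i] := if bar then (to_complex (x - c))^* else to_complex (x - c).
have reB (b : bool) (w : R[i]) : Re (if b then w^* else w) = Re w by case: b; case: w.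
have imB (b : bool) (w : R[i]) : Im (if b then w^* else w) = (-1) ^+ b * Im w.
  by case: b; case: w => ? ?; rewrite /= ?mulN1r ?mul1r.
have rez x : Re (z x) = x.1 - c.1 by rewrite /z reB.
have imz x : Im (z x) = (-1) ^+ bar * (x.2 - c.2) by rewrite /z imB.
have mr : measurable_fun D (fun x => Re (z x) : R).
  rewrite (_ : (fun x => _) = (fun x => x.1 - c.1)); last by apply/funext.
  by apply: measurable_funB => //; apply: measurable_funTS; exact: measurable_fst.
have mi : measurable_fun D (fun x => Im (z x) : R).
  rewrite (_ : (fun x => _) = (fun x => (-1) ^+ bar * (x.2 - c.2))); last by apply/funext.
  apply: measurable_funM => //; apply: measurable_funB => //; apply: measurable_funTS.
  exact: measurable_snd.
have mn : measurable_fun D (fun x => Re (z x ^+ n) : R) /\ measurable_fun D (fun x => Im (z x ^+ n) : R).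
  elim: n => [|n [ihr ihi]]; first by split; exact: measurable_cst.
  split.
    rewrite (_ : (fun x => _) = (fun x => Re (z x) * Re (z x ^+ n) - Im (z x) * Im (z x ^+ n))).
      by apply: measurable_funB; exact: measurable_funM.
    by apply/funext => x; rewrite exprS ReM.
  rewrite (_ : (fun x => _) = (fun x => Re (z x) * Im (z x ^+ n) + Im (z x) * Re (z x ^+ n))).
    by apply: measurable_funD; exact: measurable_funM.
  by apply/funext => x; rewrite exprS ImM.
have nz x : D x -> Re (z x ^+ n) ^+ 2 + Im (z x ^+ n) ^+ 2 = (r ^+ 2) ^+ n.
  move=> Dx; have rr : Re (z x) ^+ 2 + Im (z x) ^+ 2 = r ^+ 2.
    rewrite rez imz exprMn sqrr_sign mul1r.
    have <- : enorm (x - c) = r by move: Dx; rewrite /D circleE.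
    by rewrite enorm_sqr.
  elim: n {mn} => [|n ih]; first by rewrite !expr0 /= expr1n expr0n/= addr0.
  by rewrite (exprS (z x)) ReM ImM (exprS (r ^+ 2)) -ih -rr; ring.
case: mn => mn1 mn2; split => //.
rewrite (eq_integral (fun=> ((r ^+ 2) ^+ n)%:E)); last by move=> x /set_mem Dx; rewrite nz.
by rewrite integral_cst// lte_mul_pinfty// lee_fin exprn_ge0// sqr_ge0.
Qed.

End monomials.

Section iteration.
Context {R : realType}.
Local Notation plane := (R * R)%type.
Local Notation Re := complex.Re.
Local Notation Im := complex.Im.
Local Notation HH := ((plane -> R[i]) * (plane -> R[i]))%type.
Variables (x1 : plane) (r1 : R) (x2 : plane) (r2 : R) (Lam1 Lam2 : R) (L : nat).
Hypothesis r10 : 0 < r1.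
Hypothesis r20 : 0 < r2.
Hypothesis cp1 : coupled x1 r1 x2 r2 Lam1.
Hypothesis cp2 : coupled x2 r2 x1 r1 Lam2.
Let C1 := circle x1 r1.
Let C2 := circle x2 r2.
Let mC1 : measurable C1 := coupled_meas cp1.
Let mC2 : measurable C2 := coupled_meas cp2.
Let V : lmodType R[i] := ((plane -> R[i]^o) * (plane -> R[i]^o))%type.
Let H : V -> Prop := calH x1 r1 x2 r2.
Let dot : V -> V -> R[i] := dotH x1 r1 x2 r2.
Local Open Scope complex_scope.

Let HD (u v : V) : H u -> H v -> H (u + v).
Proof. by move=> [u1 u2] [v1 v2]; split; exact: L2D. Qed.
Let HZ a (u : V) : H u -> H (a *: u).
Proof. by move=> [u1 u2]; split; exact: L2Z. Qed.
Let H0 : H 0. Proof. by split; exact: L20. Qed.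
Let dotDl (u v w : V) : H u -> H v -> H w -> dot (u + v) w = dot u w + dot v w.
Proof.
by move=> [u1 u2] [v1 v2] [w1 w2]; rewrite /dot /dotH !dotL2Dl// addrACA.
Qed.
Let dotZl a (u w : V) : H u -> H w -> dot (a *: u) w = a * dot u w.
Proof. by move=> [u1 u2] [w1 w2]; rewrite /dot /dotH !dotL2Zl// mulrDr. Qed.
Let dotC (u v : V) : H u -> H v -> dot v u = (dot u v)^*%R.
Proof.
move=> [u1 u2] [v1 v2]; rewrite /dot /dotH (dotL2C mC1 u1 v1) (dotL2C mC2 u2 v2).
by rewrite -rmorphD.
Qed.
Let dot_ge0 (u : V) : H u -> 0 <= dot u u.
Proof.
move=> [u1 u2]; rewrite /dot /dotH (ReL2 mC1 u1) (ReL2 mC2 u2).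
by rewrite addr_ge0// lecR; apply: Rintegral_ge0 => x _; rewrite addr_ge0 ?sqr_ge0.
Qed.

Let sq (u : V) : R := sqnorm C1 u.1 + sqnorm C2 u.2.
Let dotE (u : V) : H u -> dot u u = (sq u)%:C.
Proof.
by move=> [u1 u2]; rewrite /dot /dotH (ReL2 mC1 u1) (ReL2 mC2 u2) /sq rmorphD.
Qed.
Let sqnorm_ge0 D u : 0 <= sqnorm D u :> R.
Proof. by apply: Rintegral_ge0 => x _; rewrite addr_ge0 ?sqr_ge0. Qed.

Let eqHH := eqH x1 r1 x2 r2.
Let eqH_refl u : eqHH u u. Proof. by split; apply: filterE. Qed.
Let eqHD (u u' v v' : V) : eqHH u u' -> eqHH v v' -> eqHH (u + v) (u' + v').
Proof.
move=> [h1 h2] [h3 h4]; split.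
  by apply: filterS2 h1 h3 => x e1 e2 Dx /=; rewrite !fctE e1// e2.
by apply: filterS2 h2 h4 => x e1 e2 Dx /=; rewrite !fctE e1// e2.
Qed.
Let eqHZ a (u u' : V) : eqHH u u' -> eqHH (a *: u) (a *: u').
Proof.
move=> [h1 h2]; split.
  by apply: filterS h1 => x e1 Dx /=; rewrite !fctE e1.
by apply: filterS h2 => x e1 Dx /=; rewrite !fctE e1.
Qed.
Let dot_eq (u u' v v' : V) : H u -> H u' -> H v -> H v' -> eqHH u u' -> eqHH v v' ->
  dot u v = dot u' v'.
Proof.
move=> [u1 u2] [u1' u2'] [v1 v2] [v1' v2'] [e1 e2] [e3 e4].
by rewrite /dot /dotH (dotL2_ae mC1 u1 u1' v1 v1' e1 e3) (dotL2_ae mC2 u2 u2' v2 v2' e2 e4).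
Qed.
Let sq_eq0 (u : V) : H u -> sq u = 0 -> eqHH u 0.
Proof.
move=> [u1 u2] /eqP; rewrite paddr_eq0// => /andP[/eqP n1 /eqP n2].
by split; apply: dotL2_eq0 => //; rewrite (ReL2 _)// -/(sqnorm _ _) ?n1 ?n2.
Qed.

Let I : finType := (bool * bool * 'I_L.+1)%type.
Let b (i : I) : V :=
  let: (second, bar, n) := i in
  if second then (0, trig_monomial bar n x2) else (trig_monomial bar n x1, 0).

Let comb1 (x : I -> R[i]) y : (comb b x).1 y = \sum_i x i * (b i).1 y.
Proof. exact: (big_morph (fun v : V => v.1 y)). Qed.
Let comb2 (x : I -> R[i]) y : (comb b x).2 y = \sum_i x i * (b i).2 y.
Proof. exact: (big_morph (fun v : V => v.2 y)). Qed.

Let sum_index (F : I -> R[i]) : \sum_i F i = \sum_(l < L.+1) (F (false, false, l) + F (false, true, l)) +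
   \sum_(l < L.+1) (F (true, false, l) + F (true, true, l)).
Proof.
transitivity (\sum_(p : bool * bool) \sum_(l < L.+1) F (p, l)).
  by rewrite pair_bigA; apply: eq_bigr => -[p l].
transitivity (\sum_(p : bool) \sum_(q : bool) \sum_(l < L.+1) F (p, q, l)).
  rewrite [RHS](pair_bigA _ (fun p q => \sum_(l < L.+1) F (p, q, l))).
  by apply: eq_bigr => -[p q].
by rewrite !big_bool /= !big_split/= addrC; congr (_ + _); rewrite addrC.
Qed.

Let combE (x : I -> R[i]) : comb b x =
  (trig_poly x1 (fun l => x (false, false, l)) (fun l => x (false, true, l)),
   trig_poly x2 (fun l => x (true, false, l)) (fun l => x (true, true, l))).
Proof.
rewrite [LHS]surjective_pairing; congr pair; apply/funext => y.
  by rewrite comb1 sum_index [X in _ + X]big1 ?addr0// => l _; rewrite !mulr0 addr0.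
by rewrite comb2 sum_index [X in X + _]big1 ?add0r// => l _; rewrite !mulr0 addr0.
Qed.

Let bH i : H (b i).
Proof.
case: i => [[[] bar] n]; split => /=; try exact: L20.
  exact: (monomial_L2 _ _ r20 mC2 (coupled_finite cp2)).
exact: (monomial_L2 _ _ r10 mC1 (coupled_finite cp1)).
Qed.

Let combH x : H (comb b x). Proof. exact: (comb_in HD HZ H0 bH). Qed.

Let HL := calHL x1 r1 x2 r2 L.
Let HLP (u : V) : HL u <-> H u /\ exists x, eqHH u (comb b x).
Proof.
split.
  move=> [/HL_circleP[Lu1 [a1 [b1 E1]]] /HL_circleP[Lu2 [a2 [b2 E2]]]]; split; first by split.
  exists (fun i => let: (second, bar, l) := i in
    if second then (if bar then b2 l else a2 l) else (if bar then b1 l else a1 l)).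
  by rewrite combE; split; [exact: E1|exact: E2].
move=> [[Lu1 Lu2] [x]]; rewrite combE => -[/= E1 E2]; split; apply/HL_circleP; split => //.
  exists (fun l => x (false, false, l)), (fun l => x (false, true, l)); exact: E1.
exists (fun l => x (true, false, l)), (fun l => x (true, true, l)); exact: E2.
Qed.

Let HLH u : HL u -> H u. Proof. by case/HLP. Qed.
Let HLZ0 (u : V) : HL u -> HL (0 : V).
Proof.
move=> Hu; apply/HLP; split => //; exists (fun=> 0).
rewrite /comb big1 => [|i _]; [exact: eqH_refl|by rewrite scale0r].
Qed.

Let PL : V -> V := projL x1 r1 x2 r2 L.

Let PL_proj (u v : V) : HL v -> (forall w, HL w -> dot (u - v) w = 0) ->
  HL (PL u) /\ (forall w, HL w -> dot (u - PL u) w = 0).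
Proof.
move=> Hv vw; have ex : is_orthogonal_projection x1 r1 x2 r2 HL u v by split.
by have [h1 h2] : is_orthogonal_projection x1 r1 x2 r2 HL u (PL u) := xgetPex 0 (ex_intro _ _ ex).
Qed.
Let B : V -> V := opB x1 r1 x2 r2.
Let BH (u : V) : H u -> H (B u).
Proof. by move=> [u1 u2]; split; [exact: coupled_L2 cp2 _ u2|exact: coupled_L2 cp1 _ u1]. Qed.
Let B_eq (u v : V) : H u -> H v -> eqHH u v -> B u = B v.
Proof.
move=> [u1 u2] [v1 v2] [e1 e2]; congr pair; [exact: coupled_ae cp2 _ _ u2 v2 e2|exact: coupled_ae cp1 _ _ u1 v1 e1].
Qed.
Let B_lin a (u v : V) : H u -> H v -> B (a *: u + v) = a *: B u + B v.
Proof.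
move=> [u1 u2] [v1 v2]; congr pair; [exact: coupled_lin cp2 a _ _ u2 v2|exact: coupled_lin cp1 a _ _ u1 v1].
Qed.

Hypothesis Lam1_gt0 : 0 < Lam1.
Hypothesis Lam2_gt0 : 0 < Lam2.
Let rho := Num.sqrt (Lam1 * Lam2).

(* The test function [w] itself gives [N = <gamma u, w> <= X u * a], with [N] the squared norm of [w] and
   [a] its norm on the interior arc. Multiplied by [X' w], where [X' w * a <= Lam' * N], it yields the
   second bound; with [a ^ 2 <= N] it yields the first. *)
Let half_step c r c' r' Lam Lam' : coupled c r c' r' Lam -> coupled c' r' c r Lam' ->
  forall X X' : (plane -> R[i]) -> R,
  (forall u w, L2 (circle c r) u -> L2 (circle c' r') w ->
    Re (dotL2 (circle c' r') (gamma c r c' r' u) w) <= X u * Num.sqrt (sqnorm (circle_int c' r' c r) w)) ->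
  (forall u, 0 <= X u) ->
  (forall w, L2 (circle c' r') w -> 0 <= X' w /\
     X' w * Num.sqrt (sqnorm (circle_int c' r' c r) w) <= Lam' * sqnorm (circle c' r') w) ->
  (forall w, L2 (circle c' r') w -> sqnorm (circle c' r') w = 0 -> X' w = 0) ->
  0 < Lam' ->
  forall u w, L2 (circle c r) u -> L2 (circle c' r') w ->
    dotL2 (circle c' r') w w = dotL2 (circle c' r') (gamma c r c' r' u) w ->
    sqnorm (circle c' r') w <= X u ^+ 2 /\ X' w <= Lam' * X u.
Proof.
move=> cp cp' X X' form X0 X'0 Xn Lam0 u w Lu Lw eqw.
have mC' := coupled_meas cp'.
have := form u w Lu Lw; rewrite -eqw (ReL2 mC' Lw) /= -[Rintegral _ _ _]/(sqnorm _ w).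
set N := sqnorm (circle c' r') w; set a := Num.sqrt _ => le.
have n0 D v : 0 <= sqnorm D v :> R by exact: sqnorm_ge0.
have a0 : 0 <= a by exact: sqrtr_ge0.
have aN : a ^+ 2 <= N.
  by rewrite sqr_sqrtr// /N (coupled_split cp' Lw) lerDl.
have [X'w XL] := X'0 _ Lw; rewrite -/a -/N in XL.
split.
  have h : N ^+ 2 <= X u ^+ 2 * N.
    apply: (@le_trans _ _ ((X u * a) ^+ 2)); first by rewrite ler_pXn2r ?nnegrE ?mulr_ge0 ?X0 ?n0.
    by rewrite exprMn ler_wpM2l ?sqr_ge0.
  have [N0|N0] := eqVneq N 0; first by rewrite N0 sqr_ge0.
  have {}N0 : 0 < N by rewrite lt_neqAle eq_sym N0 n0.
  by rewrite -(ler_pM2r N0) -expr2.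
have [N0|N0] := eqVneq N 0; first by rewrite (Xn _ Lw N0) mulr_ge0 ?X0 ?ltW.
have {}N0 : 0 < N by rewrite lt_neqAle eq_sym N0 n0.
rewrite -(ler_pM2r N0); apply: (@le_trans _ _ (X' w * (X u * a))); first by rewrite ler_wpM2l.
by rewrite mulrCA mulrC -[leRHS]mulrA [X u * N]mulrC mulrA ler_wpM2r ?X0.
Qed.

Let weighted c r c' r' Lam : coupled c r c' r' Lam -> exists X : (plane -> R[i]) -> R, exists K : R,
  [/\ 0 < K, forall u, 0 <= X u,
    forall u w, L2 (circle c r) u -> L2 (circle c' r') w ->
    Re (dotL2 (circle c' r') (gamma c r c' r' u) w) <= X u * Num.sqrt (sqnorm (circle_int c' r' c r) w),
    forall u, L2 (circle c r) u -> X u * Num.sqrt (sqnorm (circle_int c r c' r') u) <= Lam * sqnorm (circle c r) u &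
    forall u, L2 (circle c r) u -> X u <= K * Num.sqrt (sqnorm (circle c r) u)].
Proof.
move=> cp; have [sg [ta [sg0 ta0 form qf]]] := coupled_form cp.
pose X u := sg * Num.sqrt (sqnorm (circle_int c r c' r') u) +
     ta * Num.sqrt (sqnorm (circle c r `\` circle_int c r c' r') u).
exists X, (sg + ta + 1); split => //.
- by rewrite ltr_wpDl// addr_ge0.
- by move=> u; rewrite addr_ge0// mulr_ge0// sqrtr_ge0.
- move=> u Lu; rewrite (coupled_split cp Lu).
  have := qf _ _ (sqrtr_ge0 (sqnorm (circle_int c r c' r') u))
    (sqrtr_ge0 (sqnorm (circle c r `\` circle_int c r c' r') u)).
  by rewrite !sqr_sqrtr ?sqnorm_ge0.
move=> u Lu; rewrite (coupled_split cp Lu) /X.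
set a := sqnorm _ _; set d := sqnorm _ _.
have a0 : 0 <= a by exact: sqnorm_ge0.
have d0 : 0 <= d by exact: sqnorm_ge0.
have h1 : Num.sqrt a <= Num.sqrt (a + d) by rewrite ler_wsqrtr// lerDl.
have h2 : Num.sqrt d <= Num.sqrt (a + d) by rewrite ler_wsqrtr// lerDr.
have h3 := ler_wpM2l sg0 h1; have h4 := ler_wpM2l ta0 h2.
by have := sqrtr_ge0 (a + d); lra.
Qed.

Let rho0 : 0 < rho. Proof. by rewrite sqrtr_gt0 mulr_gt0. Qed.

(** The components decouple into two interlaced sequences; scaling them by the square roots of the two
    bounds makes both half steps contract by the same [rho]. *)
Lemma iteration_decay : exists2 C : R, 0 < C & forall v : nat -> V,
  (forall n, HL (v n)) -> (forall n h, HL h -> dot (v n.+1) h = dot (B (v n)) h) ->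
  forall n, Num.sqrt (sq (v n.+1)) <= C * rho ^+ n * Num.sqrt (sq (v 0%N)).
Proof.
have [X1 [K1 [K10 X10 form1 q1 b1]]] := weighted cp1.
have [X2 [K2 [K20 X20 form2 q2 b2]]] := weighted cp2.
pose P (u : V) := X1 u.1 / Num.sqrt Lam1; pose Q (u : V) := X2 u.2 / Num.sqrt Lam2.
have sL1 : 0 < Num.sqrt Lam1 by rewrite sqrtr_gt0.
have sL2 : 0 < Num.sqrt Lam2 by rewrite sqrtr_gt0.
pose K := K1 / Num.sqrt Lam1 + K2 / Num.sqrt Lam2.
have K0 : 0 < K by rewrite addr_gt0 ?divr_gt0.
pose C := (Num.sqrt Lam1 + Num.sqrt Lam2) * K.
exists C; first by rewrite mulr_gt0// addr_gt0.
move=> v vHL vrec.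
have vH n : H (v n) by exact: HLH.
have nul c r X K' : (forall u, 0 <= X u) ->
    (forall u, L2 (circle c r) u -> X u <= K' * Num.sqrt (sqnorm (circle c r) u)) ->
    forall w, L2 (circle c r) w -> sqnorm (circle c r) w = 0 -> X w = 0 :> R.
  move=> X0 bX w Lw w0; apply/eqP; rewrite eq_le X0 andbT.
  by have := bX _ Lw; rewrite w0 sqrtr0 mulr0.
have HL0 : HL (0 : V) by exact: HLZ0 (vHL 0%N).
have dot0 (D : set plane) (u z : plane -> R[i]) : (forall x, z x = 0) -> dotL2 D u z = 0.
  move=> z0; rewrite /dotL2 (_ : (fun x => _) = (fun=> 0)); last first.
    by apply/funext => x; rewrite z0 rmorph0 mulr0.
  by rewrite /cintegral /Rintegral !integral0_eq.
have rec2 n : dotL2 C2 (v n.+1).2 (v n.+1).2 = dotL2 C2 (gamma x1 r1 x2 r2 (v n).1) (v n.+1).2.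
  pose h : V := ((0 : V).1, (v n.+1).2).
  have hL : HL h := conj (proj1 HL0) (proj2 (vHL n.+1)).
  have := vrec n h hL; rewrite /dot /dotH (dot0 C1 (v n.+1).1 h.1)// (dot0 C1 (B (v n)).1 h.1)//.
  by rewrite !add0r.
have rec1 n : dotL2 C1 (v n.+1).1 (v n.+1).1 = dotL2 C1 (gamma x2 r2 x1 r1 (v n).2) (v n.+1).1.
  pose h : V := ((v n.+1).1, (0 : V).2).
  have hL : HL h := conj (proj1 (vHL n.+1)) (proj2 HL0).
  have := vrec n h hL; rewrite /dot /dotH (dot0 C2 (v n.+1).2 h.2)// (dot0 C2 (B (v n)).2 h.2)//.
  by rewrite !addr0.
have step n : [/\ sqnorm C2 (v n.+1).2 <= X1 (v n).1 ^+ 2, X2 (v n.+1).2 <= Lam2 * X1 (v n).1,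
    sqnorm C1 (v n.+1).1 <= X2 (v n).2 ^+ 2 & X1 (v n.+1).1 <= Lam1 * X2 (v n).2].
  have [v1 v2] := vH n; have [w1 w2] := vH n.+1.
  have [] := half_step cp1 cp2 form1 X10 (fun w Lw => conj (X20 w) (q2 w Lw)) (nul _ _ _ _ X20 b2) Lam2_gt0 v1 w2 (rec2 n).
  by have [] := half_step cp2 cp1 form2 X20 (fun w Lw => conj (X10 w) (q1 w Lw)) (nul _ _ _ _ X10 b1) Lam1_gt0 v2 w1 (rec1 n).
have sqL1 : Num.sqrt Lam1 ^+ 2 = Lam1 by rewrite sqr_sqrtr ?ltW.
have sqL2 : Num.sqrt Lam2 ^+ 2 = Lam2 by rewrite sqr_sqrtr ?ltW.
have rhoE : rho = Num.sqrt Lam1 * Num.sqrt Lam2 by rewrite /rho sqrtrM ?ltW.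
have stepP n : P (v n.+1) <= rho * Q (v n).
  have [_ _ _ le] := step n; rewrite /P /Q ler_pdivrMr// rhoE; apply: le_trans le _.
  by rewrite -[in leLHS]sqL1; rewrite le_eqVlt; apply/orP; left; apply/eqP; field; rewrite gt_eqF.
have stepQ n : Q (v n.+1) <= rho * P (v n).
  have [_ le _ _] := step n; rewrite /P /Q ler_pdivrMr// rhoE; apply: le_trans le _.
  by rewrite -[in leLHS]sqL2; rewrite le_eqVlt; apply/orP; left; apply/eqP; field; rewrite gt_eqF.
have bound n : P (v n) <= rho ^+ n * (K * Num.sqrt (sq (v 0%N))) /\
               Q (v n) <= rho ^+ n * (K * Num.sqrt (sq (v 0%N))).
  elim: n => [|n [ihP ihQ]].
    rewrite expr0 mul1r; have [v1 v2] := vH 0%N; set S := Num.sqrt _.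
    have S0 : 0 <= S by exact: sqrtr_ge0.
    have l1 : Num.sqrt (sqnorm C1 (v 0%N).1) <= S by rewrite ler_wsqrtr// lerDl.
    have l2 : Num.sqrt (sqnorm C2 (v 0%N).2) <= S by rewrite ler_wsqrtr// lerDr.
    rewrite /K mulrDl; split.
      apply: (@le_trans _ _ (K1 / Num.sqrt Lam1 * S)); last by rewrite lerDl mulr_ge0// divr_ge0// ltW.
      rewrite /P ler_pdivrMr// mulrAC divfK ?gt_eqF//; apply: le_trans (b1 _ v1) _.
      by rewrite ler_wpM2l// ltW.
    apply: (@le_trans _ _ (K2 / Num.sqrt Lam2 * S)); last by rewrite lerDr mulr_ge0// divr_ge0// ltW.
    rewrite /Q ler_pdivrMr// mulrAC divfK ?gt_eqF//; apply: le_trans (b2 _ v2) _.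
    by rewrite ler_wpM2l// ltW.
  rewrite exprS -mulrA; split.
    by apply: le_trans (stepP n) _; rewrite ler_wpM2l// ltW.
  by apply: le_trans (stepQ n) _; rewrite ler_wpM2l// ltW.
move=> n; have [s1 _ s2 _] := step n; have [bP bQ] := bound n.
set z := rho ^+ n * _ in bP bQ.
have -> : C * rho ^+ n * Num.sqrt (sq (v 0%N)) = (Num.sqrt Lam1 + Num.sqrt Lam2) * z by rewrite /C /z; ring.
have XP : X1 (v n).1 <= Num.sqrt Lam1 * z.
  by rewrite mulrC; move: bP; rewrite /P ler_pdivrMr.
have XQ : X2 (v n).2 <= Num.sqrt Lam2 * z.
  by rewrite mulrC; move: bQ; rewrite /Q ler_pdivrMr.
apply: (@le_trans _ _ (X1 (v n).1 + X2 (v n).2)); last by rewrite mulrDl lerD.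
rewrite -(@ler_pXn2r _ 2) ?nnegrE ?sqrtr_ge0 ?addr_ge0// sqr_sqrtr; last exact: addr_ge0.
apply: (le_trans (lerD s2 s1)); rewrite sqrrD.
by have := mulr_ge0 (X10 (v n).1) (X20 (v n).2); lra.
Qed.

Let sqE (u : V) : sqdot dot u = Re (dot u u). Proof. by []. Qed.

Let decay : exists2 C : R, 0 < C & forall v : nat -> V,
  (forall n, HL (v n)) -> (forall n h, HL h -> dot (v n.+1) h = dot (B (v n)) h) ->
  forall n, Num.sqrt (sqdot dot (v n.+1)) <= C * rho ^+ n * Num.sqrt (sqdot dot (v 0%N)).
Proof.
have [C C0 dec] := iteration_decay; exists C => // v vHL vrec n.
have := dec v vHL vrec n; rewrite !sqE !dotE//; exact: HLH.
Qed.

Let dot_eq0 (u : V) : H u -> dot u u = 0 -> eqHH u 0.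
Proof.
move=> Hu; rewrite dotE// => /eqP; rewrite eq_complex /= => /andP[/eqP s0 _]; exact: sq_eq0.
Qed.

Lemma ddcosmo_iterates (f : R) : rho <= f -> forall eps : R, 0 < eps ->
  \forall n \near \oo, forall e0, calH x1 r1 x2 r2 e0 ->
    normH x1 r1 x2 r2 (iter n (fun e => projL x1 r1 x2 r2 L (opB x1 r1 x2 r2 (projL x1 r1 x2 r2 L e))) e0) <=
    (f + eps) ^+ n * normH x1 r1 x2 r2 e0.
Proof.
exact: (iterates_bound HD HZ H0 dotDl dotZl dotC dot_ge0 bH eqH_refl eqHD eqHZ dot_eq dot_eq0
  HLP PL_proj BH rho0 decay).
Qed.

Lemma ddcosmo_solution : rho < 1 -> forall g, calH x1 r1 x2 r2 g ->
  exists u, [/\ HL u, eqHH (PL (PL u - B (PL u))) (PL g),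
    (forall v, HL v -> eqHH (PL (PL v - B (PL v))) (PL g) -> eqHH v u) &
    forall u0, HL u0 -> exists (C q : R), [/\ 0 <= q, q < 1 & forall n : nat,
      normH x1 r1 x2 r2 (iter n (fun w => PL g + PL (B (PL w))) u0 - u) <= C * q ^+ n]].
Proof.
exact: (discrete_equation HD HZ H0 dotDl dotZl dotC dot_ge0 bH eqH_refl eqHD eqHZ dot_eq dot_eq0
  HLP PL_proj BH B_eq B_lin rho0 decay).
Qed.

End iteration.

(** * The rate f *)

(** What remains of [rate_ge_acute] when everything but [s] has been replaced by a bound in [s], for
    the angles up to a right angle, where [s <= sqrt (1 / 2)]. *)
Lemma rate_polynomial_pos (R : realFieldType) (s k K : R) : 0 <= s -> s <= 71/100 ->
  k = 1 - 2 * s ^+ 2 -> K = 174 / 100 * (1 + s) ->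
  0 < (4 * s ^+ 2 + k * (1 - 71/100 * s) ^+ 2 * (K - (1 - s ^+ 2)) - (K - 1 - s ^+ 2) ^+ 2) * (4 + k)
    + 2 * K * ((4 * k + 1) * (s / 2 * (1 - s / 2)) * (1 / 2 + 63 / 100 * s)).
Proof.
move=> s0 sb -> ->.
case: (lerP s (7/20)) => sm.
- have a0 : 0 <= 7/20 - s by lra.
  have B := @bernstein_products _ s _ 8 s0 a0.
  move: (B 0 isT) (B 1 isT) (B 2 isT) (B 3 isT) (B 4 isT) (B 5 isT) (B 6 isT) (B 7 isT) (B 8 isT).
  clear B; rewrite /=.
  lra.
- have a0 : 0 <= s - 7/20 by lra.
  have b0 : 0 <= 71/100 - s by lra.
  have B := @bernstein_products _ _ _ 8 a0 b0.
  move: (B 0 isT) (B 1 isT) (B 2 isT) (B 3 isT) (B 4 isT) (B 5 isT) (B 6 isT) (B 7 isT) (B 8 isT).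
  clear B; rewrite /=.
  lra.
Qed.


Section rate_bounds.
Context {R : realType}.

Lemma sin_le_id (x : R) : 0 <= x -> sin x <= x.
Proof.
rewrite le_eqVlt => /orP[/eqP <-|x0]; first by rewrite sin0.
have [y _] := @MVT R sin cos 0 x x0 (fun z _ => is_derive_sin z)
  (@continuous_subspaceT _ _ _ _ (@continuous_sin R)).
rewrite sin0 !subr0 => ->; apply: ler_piMl; [exact: ltW|exact: cos_le1].
Qed.

Lemma sin_pi4 : (sin (pi / 4) : R) ^+ 2 = 1 / 2.
Proof.
have h : (pi / 4) *+ 2 = pi / 2 :> R.
  by move: (pi : R) => P; lra.
have := @cos_mulr2n R (pi / 4); rewrite h cos_pihalf => e.
have := @cos2Dsin2 R (pi / 4).
by move: e; rewrite -mulr_natr; lra.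
Qed.

(** Below the first quarter turn the sine lies above its chord: by the mean value theorem,
    dipping below would force its decreasing slope first below and then above that of the chord. *)
Lemma sin_ge_chord (b x : R) : 0 < b -> b <= pi / 2 -> 0 < x -> x < b -> x * (sin b / b) <= sin x.
Proof.
move=> b0 bp x0 xb; rewrite leNgt; apply/negP => lt.
have cs A : {within A, continuous (@sin R)}.
  by apply: continuous_subspaceT; exact: continuous_sin.
have [y /[!in_itv]/= /andP[y0 yx]] := @MVT R sin cos 0 x x0 (fun z _ => is_derive_sin z) (cs _).
have [z /[!in_itv]/= /andP[z0 zb]] := @MVT R sin cos x b xb (fun z _ => is_derive_sin z) (cs _).
rewrite sin0 !subr0 => e1 e2.
have : cos z < cos y.
  by rewrite ltr_cos ?in_itv/=; [apply: lt_trans z0|apply/andP; split..]; lra.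
set m := sin b / b in lt.
have eb : sin b = m * b by rewrite /m divfK// gt_eqF.
have h1 : cos y < m by rewrite -(ltr_pM2r x0) -e2; lra.
have h2 : m < cos z.
  by rewrite -(@ltr_pM2r _ (b - x)) ?subr_gt0// -e1 eb; lra.
lra.
Qed.

Lemma rate_f_sqr_ge (theta X : R) : let s := sin (theta / 2) in
  let g := rate_g theta in let h := rate_h theta in
  0 <= g -> 0 <= h -> 4 * X <= 1 + s ^+ 2 + g + Num.sqrt (4 * s ^+ 2 + h) ->
  X <= rate_f theta ^+ 2.
Proof.
move=> s g h g0 h0 le; rewrite /rate_f -/s -/g -/h exprMn sqr_sqrtr.
  by rewrite exprVn; lra.
by have := sqrtr_ge0 (4 * s ^+ 2 + h); have := sqr_ge0 s; lra.
Qed.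

Variable theta : R.
Hypothesis theta_gt0 : 0 < theta.
Hypothesis theta_ltpi : theta < pi.
Let s := sin (theta / 2).
Let k := pospart (cos theta).
Let t := theta / pi.
Let A := pospart (rate_alpha theta).
Let Y := A * t * (1 - t).
Let g0 := k * (1 - t) ^+ 2 / 2.
Let r := Y / 2 + s ^+ 2 * (Num.sqrt (1 + Y / s ^+ 2) - 1).

Let pi0 : 0 < (pi : R). Proof. exact: pi_gt0. Qed.

Let s0 : 0 < s.
Proof.
apply: sin_gt0_pi; rewrite ?in_itv /=; apply/andP; split; first by rewrite divr_gt0.
by have := pi0; move: (pi : R) theta_ltpi => P; lra. Qed.

Let s1 : s <= 1. Proof. exact: sin_le1. Qed.

Let t0 : 0 < t. Proof. by rewrite divr_gt0. Qed.
Let t1 : t < 1. Proof. by rewrite ltr_pdivrMr// mul1r. Qed.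

Let piM : (pi - theta) / pi = 1 - t.
Proof. by rewrite mulrBl divff// gt_eqF. Qed.

Lemma cos_half_angle : cos theta = 1 - 2 * s ^+ 2.
Proof.
have := @cos_mulr2n R (theta / 2); have -> : (theta / 2) *+ 2 = theta by lra.
move=> ->.
have := @cos2Dsin2 R (theta / 2); rewrite -/s -mulr_natr; lra.
Qed.

Let k0 : 0 <= k. Proof. by rewrite /k /pospart le_max lexx. Qed.
Let A0 : 0 <= A. Proof. by rewrite /A /pospart le_max lexx. Qed.
Let Y0 : 0 <= Y. Proof.
by apply: mulr_ge0; [apply: mulr_ge0; [exact: A0|exact: ltW]|rewrite subr_ge0; exact: ltW].
Qed.
Let g00 : 0 <= g0. Proof. by apply: mulr_ge0; [apply: mulr_ge0; rewrite ?sqr_ge0|]. Qed.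

Let r_ge : Y / 2 <= r.
Proof.
rewrite /r lerDl mulr_ge0 ?sqr_ge0// subr_ge0 -{1}[1]sqrtr1.
by apply: ler_wsqrtr; rewrite lerDl divr_ge0 ?sqr_ge0.
Qed.

Let gE : rate_g theta = g0 + r.
Proof.
rewrite /rate_g -/k -/A -/s -/t piM /g0 /r /Y.
rewrite (_ : A / s ^+ 2 * t * (1 - t) = A * t * (1 - t) / s ^+ 2); last by ring.
by field.
Qed.

Let hE : rate_h theta = (g0 + r) ^+ 2 + 2 * (g0 + r) * (1 + s ^+ 2) - 2 * (1 - s ^+ 2) * g0.
Proof.
rewrite /rate_h -/k gE -/s.
rewrite (_ : (pi - theta) ^+ 2 / pi ^+ 2 = (1 - t) ^+ 2); last by rewrite -piM expr_div_n.
have -> : cos (theta / 2) ^+ 2 = 1 - s ^+ 2 by have := @cos2Dsin2 R (theta / 2); rewrite -/s; lra.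
by rewrite /g0; field.
Qed.

(** With [g0] the part of [rate_g] that comes from [cos theta] and [r] the rest, isolating the inner
    root and squaring turns [K / 4 <= f ^ 2] into an inequality without roots. *)
Lemma rate_lower_bound (K : R) : let N := K - 1 - s ^+ 2 in
  N ^+ 2 <= 4 * s ^+ 2 + 2 * g0 * (K - (1 - s ^+ 2)) + 2 * r * K ->
  K / 4 <= rate_f theta ^+ 2.
Proof.
move=> N le; have r0 : 0 <= r by apply: le_trans r_ge; apply: divr_ge0.
have h0 : 0 <= rate_h theta.
  rewrite hE (_ : _ - _ = (g0 + r) ^+ 2 + 4 * s ^+ 2 * g0 + 2 * r * (1 + s ^+ 2)); last by ring.
  have S0 : 0 <= s ^+ 2 by exact: sqr_ge0.
  by have := sqr_ge0 (g0 + r); have := mulr_ge0 S0 g00; have := mulr_ge0 r0 S0; lra.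
apply: rate_f_sqr_ge => //; first by rewrite gE addr_ge0.
rewrite -/s gE; set q := Num.sqrt _.
suff : N - (g0 + r) <= q by rewrite /N; lra.
have q0 : 0 <= q by exact: sqrtr_ge0.
have [|p0] := lerP (N - (g0 + r)) 0; first by move=> /le_trans; apply.
rewrite -(@ler_pXn2r _ 2) ?nnegrE// ?(ltW p0)//.
rewrite /q sqr_sqrtr ?hE; last by rewrite -hE addr_ge0// mulr_ge0 ?sqr_ge0.
move: le; rewrite /N; nra.
Qed.

(** [f] would be [(1 + s) / 2] if [g] and [h] were zero, and both only make it larger. *)
Lemma rate_ge : ((1 + s) / 2) ^+ 2 <= rate_f theta ^+ 2.
Proof.
have := @rate_lower_bound ((1 + s) ^+ 2); rewrite /=.
have r0 : 0 <= r by apply: le_trans r_ge; apply: divr_ge0.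
have -> : (1 + s) ^+ 2 / 4 = ((1 + s) / 2) ^+ 2 by field.
apply; have -> : (1 + s) ^+ 2 - 1 - s ^+ 2 = 2 * s by ring.
have h1 : 0 <= g0 * ((1 + s) ^+ 2 - (1 - s ^+ 2)) by rewrite mulr_ge0//; have := sqr_ge0 s; have := s0; nra.
have h2 : 0 <= r * (1 + s) ^+ 2 by rewrite mulr_ge0// sqr_ge0.
by rewrite exprMn; lra.
Qed.

(** For acute angles the surplus [rate_g], bounded below with [s / 2 <= theta / pi <= 71 / 100 * s],
    makes up for the constant [87 / 100] in place of [(1 + s) / 2]. *)
Lemma rate_ge_acute : theta < pi / 2 -> 87 / 100 * ((1 + s) / 2) <= rate_f theta ^+ 2.
Proof.
move=> thp.
have c0 : 0 < cos theta.
  apply: cos_gt0_pihalf; apply/andP; split => //.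
  by rewrite (lt_trans _ theta_gt0)// oppr_lt0 divr_gt0.
have kE : k = 1 - 2 * s ^+ 2.
  by rewrite /k /pospart max_r ?ltW// cos_half_angle.
have k1 : 0 < 1 - 2 * s ^+ 2 by rewrite -cos_half_angle.
have ts : t <= 71 / 100 * s.
  have x0 : 0 < theta / 2 by rewrite divr_gt0.
  have xb : theta / 2 < pi / 4 by move: (pi : R) thp => P; lra.
  have b0 : 0 < pi / 4 :> R by rewrite divr_gt0.
  have bp : pi / 4 <= pi / 2 :> R by move: (pi : R) pi0 => P; lra.
  have := sin_ge_chord b0 bp x0 xb; rewrite -/s.
  have -> : theta / 2 * (sin (pi / 4) / (pi / 4)) = t * (2 * sin (pi / 4)).
    rewrite /t; move: (sin _) => q; move: (pi : R) pi0 => P P0; field; exact: lt0r_neq0.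
  have := sin_pi4; set q := sin _ => q2.
  have q0 : 0 <= q by by apply: sin_ge0_pi; apply/andP; split; move: (pi : R) pi0 => P; lra.
  have q7 : 705 / 1000 <= q by nra.
  by move=> le; have := t0; nra.
have st : s / 2 <= t.
  have : s <= theta / 2 by apply: sin_le_id; rewrite divr_ge0// ltW.
  have := pihalf_lt2 R.
  move=> P2 hs; rewrite /t ler_pdivlMr//; move: (pi : R) pi0 P2 => P P0 P2.
  have : 0 <= s * (4 - P) by rewrite mulr_ge0 ?(ltW s0)//; lra.
  lra.
have sb : s <= 71 / 100 by have := s0; nra.
set al := rate_alpha theta.
have alE : al = (s ^+ 2 * (1 - 2 * s ^+ 2) + t ^+ 2) / (s ^+ 2 + t ^+ 2 * (1 - 2 * s ^+ 2)).
  rewrite /al /rate_alpha -/s cos_half_angle -/s.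
  have -> : theta = t * pi by rewrite divfK// gt_eqF.
  have := lt0r_neq0 pi0; move: (pi : R) => P P0.
  set S := s ^+ 2; set C := 1 - _.
  have -> : P ^+ 2 * S * C + (t * P) ^+ 2 = P ^+ 2 * (S * C + t ^+ 2) by ring.
  have -> : P ^+ 2 * S + (t * P) ^+ 2 * C = P ^+ 2 * (S + t ^+ 2 * C) by ring.
  by rewrite -mulf_div divff ?mul1r// expf_neq0.
have den0 : 0 < s ^+ 2 + t ^+ 2 * (1 - 2 * s ^+ 2).
  by apply: addr_gt0; [exact: exprn_gt0|apply: mulr_gt0 => //; exact: exprn_gt0].
have st2 : s ^+ 2 <= 4 * t ^+ 2.
  have := s0; nra.
have ts2 : t ^+ 2 <= s ^+ 2.
  have := s0; have := t0; nra.
have al_ge : (4 * (1 - 2 * s ^+ 2) + 1) / (4 + (1 - 2 * s ^+ 2)) <= al.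
  rewrite alE ler_pdivrMr; last lra.
  rewrite mulrAC ler_pdivlMr//. set S := s ^+ 2 in k1 st2 ts2 *. set T := t ^+ 2 in st2 ts2 *.
  have S0 : 0 <= S by exact: sqr_ge0.
  have : 0 <= S * (1 - S) * (4 * T - S) by rewrite !mulr_ge0//; lra.
  nra.
have al_le : al <= 1.
  rewrite alE ler_pdivrMr// mul1r. have := sqr_ge0 s; nra.
have AE : A = al.
  rewrite /A /pospart max_r//; apply: le_trans al_ge; rewrite divr_ge0//; lra.
have Yle : Y <= 1 / 4.
  rewrite /Y AE -mulrA. have : t * (1 - t) <= 1/4 by have := sqr_ge0 (t - 1/2); lra.
  have : 0 <= t * (1 - t) by rewrite mulr_ge0// ?subr_ge0 ltW.
  by nra.
have Yge : (4 * (1 - 2 * s ^+ 2) + 1) / (4 + (1 - 2 * s ^+ 2)) * (s / 2 * (1 - s / 2)) <= Y.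
  rewrite /Y AE -[leRHS]mulrA; apply: ler_pM => //.
  - by rewrite divr_ge0//; lra.
  - by rewrite mulr_ge0//; have := s0; lra.
  - by have := s0; nra.
have rge : Y * (1 / 2 + 63 / 100 * s) <= r.
  have s2 : 0 < s ^+ 2 by rewrite exprn_gt0.
  set q := Num.sqrt (1 + Y / s ^+ 2).
  have q0 : 0 <= q by exact: sqrtr_ge0.
  have q2 : q ^+ 2 = 1 + Y / s ^+ 2.
    by rewrite sqr_sqrtr// addr_ge0// divr_ge0// ltW.
  have qY : (s * q) ^+ 2 = s ^+ 2 + Y.
    by rewrite exprMn q2 mulrDr mulr1 mulrCA divff ?mulr1// gt_eqF.
  have sq : s * q <= 867 / 1000.
    by have := mulr_ge0 (ltW s0) q0; have := sb; nra.
  have Yq : Y = s ^+ 2 * (q - 1) * (q + 1).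
    by move: qY; rewrite exprMn; nra.
  have q1 : 1 <= q by rewrite -(@ler_pXn2r _ 2) ?nnegrE// expr1n q2 lerDl divr_ge0// ltW.
  have h1 : 63 / 100 * (s * (q + 1)) <= 1 by have := sb; lra.
  have h2 : 0 <= s ^+ 2 * (q - 1) by rewrite mulr_ge0 ?(ltW s2)// subr_ge0.
  have := ler_wpM2l h2 h1; rewrite mulr1 /r -/q; move: Yq; set W := s ^+ 2 * (q - 1) => Yq.
  have -> : W * (63 / 100 * (s * (q + 1))) = Y * (63 / 100 * s) by rewrite Yq; ring.
  lra.
have g0ge : (1 - 2 * s ^+ 2) * (1 - 71/100 * s) ^+ 2 / 2 <= g0.
  rewrite /g0 kE ler_pM2r// ler_pM2l//.
  by have := t1; nra.
have := @rate_lower_bound (174 / 100 * (1 + s)); rewrite /=.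
have -> : 174 / 100 * (1 + s) / 4 = 87 / 100 * ((1 + s) / 2) by field.
apply; have := rate_polynomial_pos (ltW s0) sb erefl erefl.
move: g0ge rge Yge k1; set kk := 1 - 2 * s ^+ 2; set K := 174 / 100 * (1 + s).
set U := (1 - 71 / 100 * s) ^+ 2; set W := 1 / 2 + _; set T := s / 2 * _ => g0ge rge Yge k1.
have K0 : 0 < K by have := s0; rewrite /K; lra.
have W0 : 0 < W by have := s0; rewrite /W; lra.
have Kc : 0 <= K - (1 - s ^+ 2) by rewrite /K; have := s0; have := sqr_ge0 s; lra.
have D0 : 0 < 4 + kk by lra.
have h1 := ler_wpM2r Kc g0ge.
have h2 : (4 * kk + 1) * T * W <= r * (4 + kk).
  rewrite -ler_pdivrMr//; apply: le_trans rge.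
  have -> : (4 * kk + 1) * T * W / (4 + kk) = (4 * kk + 1) / (4 + kk) * T * W by ring.
  by rewrite ler_pM2r.
move=> pol; rewrite -subr_ge0 -(pmulr_lge0 _ D0).
have h3 := ler_wpM2r (ltW D0) h1.
have h4 := ler_wpM2l (ltW K0) h2.
lra.
Qed.

End rate_bounds.

(** * The rate of the ddCOSMO iteration *)

Section geometry.
Context {R : realType}.
Local Notation plane := (R * R)%type.

Lemma lens_dot (c1 c2 M e p : plane) (r1 r2 l h1 h2 : R) : 0 < r1 -> 0 < r2 ->
  lens_frame c1 r1 c2 r2 M e l h1 h2 -> circle c1 r1 p -> circle c2 r2 p ->
  dotp (c1 - p) (c2 - p) = h1 * h2 + l ^+ 2.
Proof.
move=> r10 r20 fr; rewrite !circleE//= => p1 p2.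
have [e1 _ _ [c1E c2E] [rl1 rl2]] := fr.
have q1 : (p.1 - c1.1) ^+ 2 + (p.2 - c1.2) ^+ 2 = r1 ^+ 2 by rewrite -p1 enorm_sqr.
have q2 : (p.1 - c2.1) ^+ 2 + (p.2 - c2.2) ^+ 2 = r2 ^+ 2 by rewrite -p2 enorm_sqr.
have q3 : (c2.1 - c1.1) ^+ 2 + (c2.2 - c1.2) ^+ 2 = (h2 - h1) ^+ 2.
  transitivity ((h2 - h1) ^+ 2 * (e.1 ^+ 2 + e.2 ^+ 2)); last by rewrite e1 mulr1.
  by rewrite c1E c2E /frame_pt /=; ring.
by rewrite /dotp /=; lra.
Qed.

Lemma lens_angle (c1 c2 M e p : plane) (r1 r2 l h1 h2 s : R) : 0 < r1 -> 0 < r2 ->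
  lens_frame c1 r1 c2 r2 M e l h1 h2 -> circle c1 r1 p -> circle c2 r2 p ->
  0 < s -> s < 1 -> 1 - 2 * s ^+ 2 = (h1 * h2 + l ^+ 2) / (r1 * r2) ->
  [/\ 0 < angle p c1 c2, angle p c1 c2 < pi & sin (angle p c1 c2 / 2) = s].
Proof.
move=> r10 r20 fr p1 p2 s0 s1 sE.
have th : angle p c1 c2 = acos (1 - 2 * s ^+ 2).
  rewrite /angle (lens_dot r10 r20 fr p1 p2) sE.
  by move: p1 p2; rewrite !circleE//= enorm_distC => ->; rewrite enorm_distC => ->.
have s2 : 0 < s ^+ 2 by rewrite exprn_gt0.
have s3 : s ^+ 2 < 1 by rewrite expr_lt1// ltW.
have t0 : 0 < angle p c1 c2 by rewrite th acos_gt0//; apply/andP; split; lra.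
have tp : angle p c1 c2 < pi by rewrite th acos_ltpi//; apply/andP; split; lra.
split=> //; set th' := angle _ _ _ in t0 tp th *.
have cE : cos th' = 1 - 2 * s ^+ 2 by rewrite th acosK// in_itv/=; apply/andP; split; lra.
have sp : 0 < sin (th' / 2) by apply: sin_gt0_pi; apply/andP; split; lra.
apply/eqP; rewrite -(@eqrXn2 _ 2) ?(ltW sp) ?(ltW s0)//.
by apply/eqP; have := cos_half_angle th'; rewrite cE; lra.
Qed.

(** At most one of the two interior arcs exceeds a half circle, and then the angle is acute, because
    [s] is below the cosines of both half angles. *)
Lemma arc_bounds_rate (cr sr ce se theta : R) : 0 < cr -> 0 < sr -> 0 < ce -> 0 < se ->
  cr ^+ 2 + sr ^+ 2 = 1 -> ce ^+ 2 + se ^+ 2 = 1 -> 0 < cr * ce - sr * se ->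
  0 < theta -> theta < pi -> sin (theta / 2) = cr * ce - sr * se ->
  arc_bound ce (cr * ce - sr * se) * arc_bound cr (cr * ce - sr * se) <= rate_f theta ^+ 2.
Proof.
move=> cr0 sr0 ce0 se0 rr1 ee1 s0 t0 tp sE.
have se_cr := cr_ge_se cr0 sr0 ce0 se0 rr1 ee1 erefl s0.
have ge := rate_ge t0 tp; have ga := rate_ge_acute t0 tp.
rewrite sE in ge ga; set s := cr * ce - sr * se in s0 sE ge ga *.
have cE := cos_half_angle theta; rewrite sE in cE.
have acute : s ^+ 2 < 1 / 2 -> theta < pi / 2.
  move=> sl; rewrite ltNge; apply/negP => th.
  have : cos theta <= 0.
    have -> : theta = (theta - pi / 2) + pi / 2 by ring.
    rewrite cosDpihalf oppr_le0 sin_ge0_pi//; apply/andP; split; lra.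
  by lra.
have crl := lt_unit sr0 rr1; have cel := lt_unit se0 ee1.
have sce : s < ce.
  apply: (@le_lt_trans _ _ (cr * ce)); last by rewrite gtr_pMl.
  by rewrite gerBl mulr_ge0// ltW.
have scr : s < cr.
  apply: (@le_lt_trans _ _ (cr * ce)); last by rewrite gtr_pMr.
  by rewrite gerBl mulr_ge0// ltW.
have sq x : 0 < x -> s < x -> x ^+ 2 < 1 / 2 -> s ^+ 2 < 1 / 2.
  move=> x0 sx; apply: lt_trans; rewrite ltr_pXn2r// nnegrE ltW//.
rewrite /arc_bound; case: ifPn => ceh; case: ifPn => crh; [lra| | |].
- by apply: ga; apply: acute; exact: (sq ce).
- by rewrite mulrC; apply: ga; apply: acute; exact: (sq cr).
- by rewrite -expr2.
Qed.
End geometry.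

Theorem proposition2p15 (R : realType) (x1 x2 : R * R) (r1 r2 : R) (L : nat)
    (p : R * R) :
  0 < r1 -> 0 < r2 ->
  disk x1 r1 `&` disk x2 r2 !=set0 ->
  ~ (disk x1 r1 `<=` disk x2 r2) ->
  ~ (disk x2 r2 `<=` disk x1 r1) ->
  (circle x1 r1 `&` circle x2 r2) p ->
  let theta := angle p x1 x2 in
  let H := calH x1 r1 x2 r2 in
  let HL := calHL x1 r1 x2 r2 L in
  let norm := normH x1 r1 x2 r2 in
  let eqH := eqH x1 r1 x2 r2 in
  let B := opB x1 r1 x2 r2 in
  let PL := projL x1 r1 x2 r2 L in
  (forall eps : R, 0 < eps ->
     \forall n \near \oo, forall e0, H e0 ->
       norm (iter n (fun e => PL (B (PL e))) e0) <=
       (rate_f theta + eps) ^+ n * norm e0) /\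
  (forall g, H g ->
     exists u, [/\ HL u,
       eqH (PL (PL u - B (PL u))) (PL g),
       (forall v, HL v -> eqH (PL (PL v - B (PL v))) (PL g) -> eqH v u) &
       forall u0, HL u0 ->
         exists (C q : R), [/\ 0 <= q, q < 1 &
           forall n : nat,
             norm (iter n (fun w => PL g + PL (B (PL w))) u0 - u) <= C * q ^+ n]]).
Proof.
move=> r10 r20 meet n12 n21 [p1 p2].
have [M [e [l [h1 [h2 fr]]]]] := lens_frame_exists r10 r20 meet n12 n21.
have [cr [sr [ce [se [pos units i1 i2 [s0 cosE]]]]]] := half_angles r10 r20 fr.
have [cr0 sr0 ce0 se0] := pos; have [rr1 ee1] := units.
have [[h1E l1E] [h2E l2E]] := (i1, i2).
set s := cr * ce - sr * se in s0 cosE.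
have s1 : s < 1.
  have c1 := lt_unit sr0 rr1; have c2 := lt_unit se0 ee1.
  by rewrite /s; nra.
have [t0 tp sE] := lens_angle r10 r20 fr p1 p2 s0 s1 cosE.
have cp1 := lens_coupled r10 r20 fr pos units i1 i2 s0.
have swap : ce * cr - se * sr = s by rewrite /s; ring.
have cp2 : coupled x2 r2 x1 r1 (arc_bound cr s).
  rewrite -swap; apply: (lens_coupled r20 r10 (lens_frame_sym fr)) => //.
  - by rewrite !mulNr h2E l2E; split; ring.
  - by rewrite !mulNr h1E l1E; split; ring.
  - by rewrite swap.
have bounds x : 0 < arc_bound x s /\ arc_bound x s < 1.
  by rewrite /arc_bound; case: ifP => _; split; lra.
have [L10 L11] := bounds ce; have [L20 L21] := bounds cr.
have f0 : 0 <= rate_f (angle p x1 x2) by rewrite /rate_f mulr_ge0// sqrtr_ge0.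
split.
  apply: (ddcosmo_iterates _ r10 r20 cp1 cp2 L10 L20).
  rewrite -[leRHS]ger0_norm// -sqrtr_sqr ler_wsqrtr//.
  exact: arc_bounds_rate.
apply: (ddcosmo_solution _ r10 r20 cp1 cp2 L10 L20).
rewrite -[ltRHS]sqrtr1 ltr_sqrt//.
by rewrite mulr_ilt1// ltW.
Qed.
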